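(* Let $n\ge 1$, let $u,u'\in F_{2n}$ be fixed point free involutions in $S_{2n}$, and let $[u,w_0]$ and $[u',w_0]$ denote the upper intervals in the poset $\mathrm{Br}(F_{2n})$. If $f:[u,w_0]\to[u',w_0]$ is a poset isomorphism, then the Kazhdan-Lusztig-Vogan polynomials satisfy $P_{v,u}=P_{f(v),u'}$ for all fixed point free involutions $v\ge u$.
   Context: Let $W=S_{2n}$ be the group of permutations of $[2n]=\{1,\dots,2n\}$ (products are compositions of functions), with Coxeter generators $S=\{s_1,\dots,s_{2n-1}\}$, $s_i=(i\ \ i+1)$, length function $\ell$ (number of inversions), identity $e$, longest element $w_0$ given by $w_0(i)=2n+1-i$, and Bruhat order $\le$. The right descent set is $D_{\mathrm R}(w)=\{s\in S\mid \ell(ws)<\ell(w)\}$. $F_{2n}\subset W$ is the set of fixed point free involutions, and $\mathrm{Br}(F_{2n})$ is $F_{2n}$ with the order induced by the Bruhat order; its maximum is $w_0$. Let $\theta(w)=w_0ww_0$ (so $\theta(s_i)=s_{2n-i}$), $x\ast w=\theta(w^{-1})xw$ for $x,w\in W$ (twisted conjugation), and $\iota=\{\theta(w^{-1})w\mid w\in W\}$ (twisted identities). The poset $\mathrm{Br}(\iota)$ is $\iota$ with the order induced by the Bruhat order; it is graded with rank function $\rho=\ell/2$ and minimum $e$; $\lhd$ denotes its cover relation and $[u,w]_\iota=\{x\in\iota\mid u\le x\le w\}$. The map $x\mapsto w_0x$ is an order-reversing bijection between $\iota$ and $F_{2n}$. $Q$-polynomials: for $u,w\in\iota$, $Q_{u,w}\in\mathbb{Z}[q]$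 are determined by $Q_{u,u}=1$, $Q_{u,w}=0$ if $u\not\le w$, and, for any $s\in D_{\mathrm R}(w)$: $Q_{u,w}=Q_{u\ast s,w\ast s}$ if $u\ast s\lhd u$; $Q_{u,w}=qQ_{u\ast s,w\ast s}+(q-1)Q_{u,w\ast s}$ if $u\lhd u\ast s$; $Q_{u,w}=qQ_{u,w\ast s}$ if $u\ast s=u$. (It is a known fact that this is consistent.) The Kazhdan-Lusztig-Vogan (KLV) polynomials are those associated with the orbits of $K=\mathrm{Sp}(2n,\mathbb{C})$ on the flag variety of $G=\mathrm{SL}(2n,\mathbb{C})$ (all local systems are trivial and the orbits are indexed by $\iota$, or equivalently by $F_{2n}$). Indexed by $\iota$, they are the polynomials $P^\iota_{u,w}(q)$ uniquely determined by: $P^\iota_{u,w}=0$ if $u\not\le w$; $P^\iota_{w,w}=1$; $\deg P^\iota_{u,w}\le(\rho(w)-\rho(u)-1)/2$ if $u<w$; and $$q^{\rho(w)}P^\iota_{u,w}(q^{-1})=q^{\rho(u)}\sum_{v\in[u,w]_\iota}P^\iota_{v,w}(q)\,Q_{u,v}(q)\quad\text{for } u\le w.$$ Indexed by $F_{2n}$, they are $P_{w_0u,w_0w}=P^\iota_{u,w}$ for $u,w\in\iota$; thus $P_{v,u}=P^\iota_{w_0v,w_0u}$ for $u,v\in F_{2n}$, and $P_{v,u}$ is nonzero iff $v\ge u$. *)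

(* Defs.v *)
From mathcomp Require Import all_boot all_order all_algebra all_fingroup.

Set Implicit Arguments.
Unset Strict Implicit.
Unset Printing Implicit Defensive.

Import GRing.Theory.
Local Open Scope ring_scope.

(* Permutations of {1, ..., m} are encoded as 'S_m = {perm 'I_m}, shifting all
   indices down by one.  MathComp's group product applies its left factor
   first, so products of permutations are written here with [∘], the ordinary
   composition of functions (see [pcompE]). *)
Definition pcomp m (u v : 'S_m) : 'S_m := (v * u)%g.

Notation "u ∘ v" := (pcomp u v) (at level 40, left associativity).

Lemma pcompE m (u v : 'S_m) (i : 'I_m) : (u ∘ v) i = u (v i).
Proof. by rewrite permM. Qed.

Definition ell m (w : 'S_m) : nat :=
  #|[set p : 'I_m * 'I_m | (p.1 < p.2)%N && (w p.2 < w p.1)%N]|.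

Definition w0 m : 'S_m := perm (@rev_ord_inj m).

Definition simple m : {set 'S_m} :=
  [set s | [exists i : 'I_m, exists j : 'I_m,
              (j == i.+1 :> nat) && (s == tperm i j)]].

Definition bruhat_step m : rel 'S_m := fun u v =>
  [exists i : 'I_m, exists j : 'I_m,
     (v == u ∘ tperm i j) && (ell u < ell v)%N].

Definition bruhat m : rel 'S_m := connect (@bruhat_step m).

Definition DR m (w : 'S_m) : {set 'S_m} :=
  [set s in simple m | (ell (w ∘ s) < ell w)%N].

Definition theta m (w : 'S_m) : 'S_m := w0 m ∘ w ∘ w0 m.

Definition twist m (x w : 'S_m) : 'S_m := theta w^-1%g ∘ x ∘ w.

Definition iota_set m : {set 'S_m} :=
  [set theta w^-1%g ∘ w | w in [set: 'S_m]].

Definition fpf m : {set 'S_m} :=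
  [set x | (x ∘ x == 1%g) && [forall i, x i != i]].

(* The half is exact on twisted identities, which have even length. *)
Definition rho m (w : 'S_m) : nat := (ell w)./2.

Definition bruhat_lt m : rel 'S_m := fun u w => (u != w) && bruhat u w.

Definition iota_cover m : rel 'S_m := fun u w =>
  [&& u \in iota_set m, w \in iota_set m, bruhat_lt u w &
      [forall x in iota_set m, ~~ (bruhat_lt u x && bruhat_lt x w)]].

Definition iota_itv m (u w : 'S_m) : {set 'S_m} :=
  [set x in iota_set m | bruhat u x && bruhat x w].

Definition fpf_itv m (u w : 'S_m) : {set 'S_m} :=
  [set x in fpf m | bruhat u x && bruhat x w].

(* Families of polynomials indexed by twisted identities are functions on all
   of 'S_m x 'S_m; values outside [iota_set m] are left unconstrained. *)
Definition is_Qfamily m (Q : 'S_m -> 'S_m -> {poly int}) : Prop :=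
  [/\ {in iota_set m, forall u, Q u u = 1},
      {in iota_set m &, forall u w, ~~ bruhat u w -> Q u w = 0} &
      {in iota_set m &, forall u w, forall s, s \in DR w ->
         [/\ iota_cover (twist u s) u ->
               Q u w = Q (twist u s) (twist w s),
             iota_cover u (twist u s) ->
               Q u w = 'X * Q (twist u s) (twist w s)
                       + ('X - 1) * Q u (twist w s) &
             twist u s = u ->
               Q u w = 'X * Q u (twist w s)]}].

(* Identities involving q^-1 are stated in the fraction field of Z[q]. *)
Definition zq_frac (p : {poly int}) : {fraction {poly int}} :=
  FracField.tofrac p.

Definition eval_qinv (p : {poly int}) : {fraction {poly int}} :=
  (map_poly (fun c : int => c%:~R) p).[(zq_frac 'X)^-1].

(* [(size p).-1] is the degree of a nonzero polynomial [p]; the degree bound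
   is stated as 2 deg P <= rho w - rho u - 1, where the truncated subtraction
   is exact since u < w in Br(iota) implies rho u < rho w. *)
Definition is_KLVfamily m (Q P : 'S_m -> 'S_m -> {poly int}) : Prop :=
  [/\ {in iota_set m &, forall u w, ~~ bruhat u w -> P u w = 0},
      {in iota_set m, forall w, P w w = 1},
      {in iota_set m &, forall u w, bruhat_lt u w ->
         (2 * (size (P u w)).-1 <= rho w - rho u - 1)%N} &
      {in iota_set m &, forall u w, bruhat u w ->
         zq_frac 'X ^+ rho w * eval_qinv (P u w) =
         zq_frac 'X ^+ rho u *
           zq_frac (\sum_(v in iota_itv u w) P v w * Q u v)}].

Definition KLV_fpf m (P : 'S_m -> 'S_m -> {poly int}) (v u : 'S_m) :
  {poly int} := P (w0 m ∘ v) (w0 m ∘ u).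

(* Only the restriction of [f] to [A] is relevant. *)
Definition bruhat_iso m (A B : {set 'S_m}) (f : 'S_m -> 'S_m) : Prop :=
  [/\ {in A &, injective f}, f @: A = B &
      {in A &, forall x y, bruhat (f x) (f y) = bruhat x y}].

(* Main.v *)
Require Import Defs.
From mathcomp Require Import all_boot all_order all_algebra all_fingroup.
From mathcomp Require Import zify ring.

Set Implicit Arguments.
Unset Strict Implicit.
Unset Printing Implicit Defensive.

(* A special partial matching of a lower interval [e, w] of Br(iota) is an
   involution M that moves every element along a cover or fixes it, moves w
   down, and satisfies M x < M y whenever x is covered by y <> M x.  Twisted
   conjugation by a descent of w is an example.  The point is that every
   special partial matching M computes Q_{x,w} from the Q_{y,Mw} by the same
   recursion as a descent does.  As this recursion is purely order-theoretic,
   an isomorphism [e, w] -> [e, w'] transports Q, by induction along the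
   pullback of a descent of w', and then P, by uniqueness.

   The recursion for M follows by induction on w from a descent s of w that
   commutes with M on [e, w] and has s(w) <> M(w), since the steps for M and s
   commute.  To find s, note that the elements covered by M y, when M moves y
   up, are y and the M x with x covered by y and moved up; so M is determined
   inductively as long as elements are determined by what they cover.  The
   exceptions have rank at most 2, hence either M is itself a descent, or M
   agrees with a descent at the bottom and is twisted around it only on one
   side.  In the last case w is not above a certain element of rank 3; this
   bounds its first values, yields an explicit formula for M, and shows that
   another descent of w must move w differently. *)

(** * Inversions and the Bruhat order *)

(** The pullback of a descent of w' along the isomorphism is only known to be a special partial
    matching of [e, w], so such matchings have to be controlled without reference to generators.
    They can deviate from descents because w0 conjugates s_i to its mirror image s_{2n-i}: both
    generators move the minimum e to the same atom, but they act differently higher up. A matching M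
    with M(e) equal to this atom may follow s_i on one neighbouring atom and the mirror image on the
    other. The element of rank 3 that w then avoids is obtained from e by three consecutive
    conjugations. Above it, three elements that pairwise differ at 8 positions would need a common
    upper cover, although a cover changes at most 4 positions. Avoiding it forces w to send an
    initial segment of positions into a final segment with exactly two more elements, and M turns
    out to be conjugation by the transposition of the two positions left over. *)

Section Inversions.
Variable m : nat.
Implicit Types (u v : 'S_m) (a b : 'I_m).

Definition inv_set u : {set 'I_m * 'I_m} :=
  [set p : 'I_m * 'I_m | (p.1 < p.2)%N && (u p.2 < u p.1)%N].

(** Inversions of [u] inject into those of [u ∘ tperm a b]: transpose both positions if they stay in
    order, keep the pair otherwise. The new inversion [(a, b)] is missed. *)
Lemma ell_lt_tperm u a b : a < b -> u a < u b -> ell u < ell (u ∘ tperm a b).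
Proof.
move=> ab uab; set t := tperm a b.
pose f (p : 'I_m * 'I_m) := if t p.1 < t p.2 then (t p.1, t p.2) else p.
have fI : {in inv_set u &, injective f}.
  move=> [x y] [x' y']; rewrite !inE /= => /andP[xy uxy] /andP[xy' uxy'].
  rewrite /f /=; case: ifP => h1; case: ifP => h2 //.
  - by case=> /perm_inj -> /perm_inj ->.
  - case=> e1 e2; move: h2; rewrite -e1 -e2 /t !tpermK; lia.
  - case=> e1 e2; move: h1; rewrite e1 e2 /t !tpermK; lia.
have sub : f @: inv_set u \subset inv_set (u ∘ t).
  apply/subsetP=> q /imsetP[[x y]]; rewrite inE /= => /andP[xy uxy] ->.
  rewrite /f /=; case: ifP => h; rewrite inE /= !permM.
    by rewrite h /t !tpermK.
  move: h; rewrite xy /= /t; case: tpermP => [?|?|/eqP ? /eqP ?]; subst;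
  case: tpermP => [?|?|/eqP ? /eqP ?]; subst => //; rewrite ?ltnn; try lia.
have abI : (a, b) \in inv_set (u ∘ t).
  by rewrite inE /= ab !permM /t tpermL tpermR.
have nab : (a, b) \notin f @: inv_set u.
  apply/imsetP=> -[[x y]]; rewrite inE /= => /andP[xy uxy]; rewrite /f /=.
  case: ifP => h [e1 e2]; last by subst; lia.
  have ex : x = b by have := congr1 t e1; rewrite /t tpermK tpermL.
  have ey : y = a by have := congr1 t e2; rewrite /t tpermK tpermR.
  by move: xy; rewrite ex ey; lia.
rewrite /ell -/(inv_set u) -/(inv_set (u ∘ t)) -(card_in_imset fI).
apply: proper_card; apply/properP; split => //.
by exists (a, b).
Qed.

Lemma tperm_compK u a b : u ∘ tperm a b ∘ tperm a b = u.
Proof. by apply/permP=> x; rewrite !permM tpermK. Qed.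

Lemma ell_ltE u a b : a < b -> (ell u < ell (u ∘ tperm a b)) = (u a < u b).
Proof.
move=> ab; apply/idP/idP => [h|]; last exact: ell_lt_tperm.
rewrite ltnNge; apply/negP=> le; have lt : u b < u a.
  rewrite ltn_neqAle le andbT; apply/eqP=> /val_inj/perm_inj e.
  by rewrite e ltnn in ab.
have := @ell_lt_tperm (u ∘ tperm a b) a b ab.
rewrite tperm_compK !permM tpermL tpermR => /(_ lt); lia.
Qed.

(** For adjacent positions the transposition keeps the order of every other pair, so the injection
    in the opposite direction loses only [(a, b)]. *)
Lemma ell_adj u a b : b = a.+1 :> nat -> u a < u b ->
  ell (u ∘ tperm a b) = (ell u).+1.
Proof.
move=> ab uab; apply/eqP; rewrite eqn_leq ell_lt_tperm ?ab // andbT.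
set t := tperm a b; rewrite /ell -/(inv_set u) -/(inv_set (u ∘ t)).
have abI : (a, b) \in inv_set (u ∘ t).
  by rewrite inE /= !permM /t tpermL tpermR uab ab ltnSn.
rewrite (cardsD1 (a, b)) abI add1n ltnS.
pose f (p : 'I_m * 'I_m) := (t p.1, t p.2).
have fI : injective f by move=> [x y] [x' y'] [/perm_inj -> /perm_inj ->].
rewrite -(card_imset _ fI); apply: subset_leq_card.
apply/subsetP=> q /imsetP[[x y]]; rewrite !inE /= !permM => /and3P[nab xy uxy] ->.
rewrite /f /= uxy andbT.
move: nab uxy; rewrite xpair_eqE /t.
case: tpermP => [?|?|/eqP g1 /eqP g2]; subst;
case: tpermP => [?|?|/eqP h1 /eqP h2]; subst => //; rewrite ?eqxx ?ltnn //= => _ _.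
- by move: h1 h2; rewrite -!val_eqE /=; lia.
- by rewrite ab.
- by rewrite ab in xy; lia.
- by rewrite ab; lia.
- by move: g1 g2; rewrite -!val_eqE /=; lia.
Qed.

Lemma ell_inv u : ell u^-1%g = ell u.
Proof.
suff H v : ell v <= ell v^-1%g.
  by apply/eqP; rewrite eqn_leq H andbT -{2}[u]invgK H.
rewrite /ell -/(inv_set v) -/(inv_set v^-1%g).
pose f (p : 'I_m * 'I_m) := (v p.2, v p.1).
have fI : injective f by move=> [x y] [x' y'] [/perm_inj -> /perm_inj ->].
rewrite -(card_imset _ fI); apply: subset_leq_card.
by apply/subsetP=> q /imsetP[[x y]]; rewrite !inE /= => /andP[? ?] ->; rewrite !permK /=; apply/andP.
Qed.

Lemma w0E (i : 'I_m) : w0 m i = m - i.+1 :> nat.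
Proof. by rewrite permE. Qed.

Lemma ell_w0_comp u : ell (w0 m ∘ u) + ell u = ell (w0 m).
Proof.
rewrite /ell -/(inv_set u) -/(inv_set (w0 m ∘ u)) -/(inv_set (w0 m)) addnC.
rewrite -cardsUI.
have -> : inv_set u :&: inv_set (w0 m ∘ u) = set0.
  apply/setP=> -[x y]; rewrite !inE /= !permM !w0E.
  have := ltn_ord (u x); have := ltn_ord (u y); lia.
rewrite cards0 addn0; congr #|pred_of_set _|; apply/setP=> -[x y].
rewrite !inE /= !permM !w0E.
have := ltn_ord (u x); have := ltn_ord (u y); have := ltn_ord x; have := ltn_ord y.
have : u x = u y :> nat -> x = y :> nat by move=> /val_inj/perm_inj ->.
lia.
Qed.

Lemma bruhat_stepP u v :
  reflect (exists a b, [/\ a < b, u a < u b & v = u ∘ tperm a b])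
          (bruhat_step u v).
Proof.
apply: (iffP existsP) => [[a /existsP[b /andP[/eqP -> h]]]|[a [b [ab uab ->]]]].
  case: (ltngtP a b) => ab.
  - by exists a, b; rewrite -ell_ltE.
  - by exists b, a; rewrite -ell_ltE // [tperm b a]tpermC.
  - have e : u ∘ tperm a b = u.
      by apply/permP=> x; rewrite permM (val_inj ab) tperm1 perm1.
    by rewrite e ltnn in h.
by exists a; apply/existsP; exists b; rewrite eqxx ell_lt_tperm.
Qed.

Lemma bruhat_step_ell u v : bruhat_step u v -> ell u < ell v.
Proof. by case/existsP=> a /existsP[b /andP[]]. Qed.

Lemma bruhat_refl u : bruhat u u. Proof. exact: connect0. Qed.

Lemma bruhat_trans v u w : bruhat u v -> bruhat v w -> bruhat u w.
Proof. exact: connect_trans. Qed.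

Lemma bruhat_ind (P : 'S_m -> 'S_m -> Prop) :
  (forall u, P u u) ->
  (forall u v w, bruhat_step u v -> bruhat v w -> P v w -> P u w) ->
  forall u w, bruhat u w -> P u w.
Proof.
move=> P0 PS u w /connectP[p]; elim: p u => [|v p IH] u /=; first by move=> _ ->.
move=> /andP[uv pv] ew; apply: PS (uv) _ _; last exact: IH.
by apply/connectP; exists p.
Qed.

Lemma bruhat_ell u v : bruhat u v -> (u == v) || (ell u < ell v).
Proof.
move: u v; apply: bruhat_ind => [u|u v w]; first by rewrite eqxx.
move=> /existsP[a /existsP[b /andP[_ uv]]] _ /orP[/eqP <-|h]; first by rewrite uv orbT.
by rewrite (ltn_trans uv h) orbT.
Qed.

Lemma bruhat_w0 u v : bruhat u v -> bruhat (w0 m ∘ v) (w0 m ∘ u).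
Proof.
move: u v; apply: bruhat_ind => [u|u v w]; first exact: bruhat_refl.
move=> /bruhat_stepP[a [b [ab uab ->]]] _ /bruhat_trans; apply.
apply: connect1; apply/bruhat_stepP; exists a, b; split => //.
  by rewrite !permM tpermL tpermR !w0E; have := ltn_ord (u b); lia.
by apply/permP=> x; rewrite !permM tpermK.
Qed.

End Inversions.

(** * Permutations acting on natural numbers and the lifting property *)

Definition sw (i k : nat) : nat :=
  if k == i then i.+1 else if k == i.+1 then i else k.

Lemma swK i : involutive (sw i).
Proof. by move=> k; rewrite /sw; do ! case: eqP; lia. Qed.

Lemma swl i : sw i i = i.+1. Proof. by rewrite /sw eqxx. Qed.

Lemma swr i : sw i i.+1 = i. Proof. by rewrite /sw eqxx; case: eqP => // /esym/n_Sn. Qed.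

Lemma swD i k : k != i -> k != i.+1 -> sw i k = k.
Proof. by rewrite /sw => /negPf -> /negPf ->. Qed.

Lemma swP i k : k = i /\ sw i k = i.+1 \/ k = i.+1 /\ sw i k = i \/
  k <> i /\ k <> i.+1 /\ sw i k = k.
Proof. by rewrite /sw; case: eqP => [|?]; [left|case: eqP; auto]. Qed.

Section Action.
Variable m : nat.
Implicit Types (u v : 'S_m).

(* Indices are natural numbers from here on: [ap u] extends [u] by the identity,
   and [sg i] is the identity when [i.+1] is out of range. *)
Definition ap u (k : nat) : nat := if insub k is Some i then u i : nat else k.

Definition sg (i : nat) : 'S_m :=
  match insub i, insub i.+1 with Some a, Some b => tperm a b | _, _ => 1%g end.

Lemma apE u (i : 'I_m) : ap u i = u i.
Proof. by rewrite /ap valK. Qed.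

Lemma ap_ge u k : m <= k -> ap u k = k.
Proof. by move=> mk; rewrite /ap insubN // -leqNgt. Qed.

Lemma ap_lt u k : (ap u k < m) = (k < m).
Proof. by rewrite /ap; case: insubP => [i -> _|/negPf -> //]; apply: ltn_ord. Qed.

Lemma ap_mul u v k : ap (u * v)%g k = ap v (ap u k).
Proof.
case: (ltnP k m) => h; last by rewrite !ap_ge ?ap_ge.
by rewrite -[k]/(val (Ordinal h)) !apE permM.
Qed.

Lemma ap1 k : ap 1%g k = k.
Proof. by rewrite /ap; case: insubP => // i _ <-; rewrite perm1. Qed.

Lemma ap_invK u k : ap u^-1%g (ap u k) = k.
Proof. by rewrite -ap_mul mulgV ap1. Qed.

Lemma ap_inj u : injective (ap u).
Proof. exact: can_inj (ap_invK u). Qed.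

Lemma apP u v : (forall k, k < m -> ap u k = ap v k) -> u = v.
Proof. by move=> h; apply/permP=> i; apply: val_inj; rewrite /= -!apE; apply: h. Qed.

Lemma ap_tperm (a b : 'I_m) k :
  ap (tperm a b) k = if k == a then b : nat else if k == b then a : nat else k.
Proof.
case: (ltnP k m) => h.
  have [x ->] : exists x : 'I_m, k = x by exists (Ordinal h).
  rewrite apE !val_eqE; case: tpermP => [->|->|/eqP/negPf -> /eqP/negPf ->//].
    by rewrite eqxx.
  by rewrite eqxx; case: eqP => // ->.
rewrite ap_ge //; have := ltn_ord a; have := ltn_ord b.
by do ! case: eqP => //; lia.
Qed.

Lemma sgE i : i.+1 < m -> exists a b : 'I_m,
  [/\ a = i :> nat, b = i.+1 :> nat & sg i = tperm a b].
Proof.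
move=> h; have h' : i < m by apply: ltnW.
by exists (Ordinal h'), (Ordinal h); rewrite /sg !insubT.
Qed.

Lemma sg_out i : m <= i.+1 -> sg i = 1%g.
Proof. by move=> h; rewrite /sg (@insubN _ _ _ i.+1) -?leqNgt //; case: insub. Qed.

Lemma ap_sg i k : i.+1 < m -> ap (sg i) k = sw i k.
Proof. by case/sgE=> a [b [ea eb ->]]; rewrite ap_tperm ea eb. Qed.

Lemma sg_sq i : (sg i * sg i = 1)%g.
Proof.
case: (ltnP i.+1 m) => [/sgE[a [b [_ _ ->]]]|/sg_out ->]; first exact: tperm2.
by rewrite mulg1.
Qed.

Lemma sgV i : ((sg i)^-1 = sg i)%g.
Proof. by apply/eqP; rewrite eq_invg_mul sg_sq. Qed.

Lemma sg_comm i j : i.+1 < j -> (sg i * sg j = sg j * sg i)%g.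
Proof.
move=> ij; case: (ltnP j.+1 m) => h; last by rewrite (sg_out h) mulg1 mul1g.
have him : i.+1 < m by lia.
apply: apP => k _; rewrite !ap_mul !ap_sg //.
by rewrite /sw; do ! case: eqP; lia.
Qed.

Lemma sg_braid i : i.+2 < m ->
  (sg i * sg i.+1 * sg i = sg i.+1 * sg i * sg i.+1)%g.
Proof.
move=> h; have him : i.+1 < m by lia.
apply: apP => k _; rewrite !ap_mul !ap_sg //.
by rewrite /sw; do ! case: eqP; lia.
Qed.

Lemma bruhat_stepE u v a b : a < b < m -> ap u a < ap u b ->
  (forall k, k < m -> ap v k = ap u (if k == a then b else if k == b then a else k)) ->
  bruhat_step u v.
Proof.
case/andP=> ab bm uab h; have am := ltn_trans ab bm.
apply/bruhat_stepP; exists (Ordinal am), (Ordinal bm); split => //.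
  by rewrite -!apE.
by apply: apP => k km; rewrite h // ap_mul ap_tperm.
Qed.

Lemma bruhat_step_ap u v : bruhat_step u v -> exists a b,
  [/\ a < b < m, ap u a < ap u b &
   forall k, ap v k = ap u (if k == a then b else if k == b then a else k)].
Proof.
case/bruhat_stepP=> a [b [ab uab ->]]; exists a, b; split.
- by rewrite ab /=.
- by rewrite !apE.
- by move=> k; rewrite ap_mul ap_tperm.
Qed.

Definition asc i u := (i.+1 < m) && (ap u i < ap u i.+1).

(** The larger and the smaller of [u] and its product with [s_i], on the right ([sg i * u] applies
    [s_i] first) or on the left. Their monotonicity expresses the lifting property. *)
Definition upR i u := if asc i u then (sg i * u)%g else u.
Definition upL i u := if asc i u^-1%g then (u * sg i)%g else u.
Definition dwR i u := if asc i u then u else (sg i * u)%g.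
Definition dwL i u := if asc i u^-1%g then u else (u * sg i)%g.

Lemma step_sgR i u : asc i u -> bruhat_step u (sg i * u)%g.
Proof.
case/andP=> im au; apply: (bruhat_stepE (a := i) (b := i.+1)); rewrite ?ltnSn //.
by move=> k _; rewrite ap_mul ap_sg.
Qed.

Lemma ap_neq u i j : i != j -> ap u i != ap u j.
Proof. by apply: contraNneq => /ap_inj ->. Qed.

Lemma asc_sgR i u : i.+1 < m -> asc i (sg i * u)%g = ~~ asc i u.
Proof.
move=> im; rewrite /asc im !ap_mul !ap_sg // swl swr.
have : ap u i != ap u i.+1 by apply: ap_neq; lia.
lia.
Qed.

(** If [v = u t], then [v s = (u s)(s t s)], and [s] keeps the order of the two positions moved by
    [t] unless [t = s]. *)
Lemma step_liftR i u v : i.+1 < m -> bruhat_step u v ->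
  v = (sg i * u)%g \/ bruhat_step (sg i * u)%g (sg i * v)%g.
Proof.
move=> im /bruhat_step_ap[a [b [/andP[ab bm] uab hv]]].
case: (boolP ((a == i) && (b == i.+1))) => [/andP[/eqP ea /eqP eb]|nab].
  by left; apply: apP => k _; rewrite hv ap_mul ap_sg // ea eb.
right; apply: (bruhat_stepE (a := sw i a) (b := sw i b)).
- by move: nab; rewrite /sw; do ! case: eqP; lia.
- by rewrite !ap_mul !ap_sg // !swK.
- move=> k km; rewrite !ap_mul !ap_sg // hv; congr (ap u _).
  by rewrite /sw; do ! case: eqP; lia.
Qed.

Lemma upR_ge i u : bruhat u (upR i u).
Proof.
rewrite /upR; case: ifP => h; last exact: bruhat_refl.
by apply: connect1; apply: step_sgR.
Qed.

Lemma le_upR i u v : bruhat u v -> bruhat (upR i u) (upR i v).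
Proof.
case: (ltnP i.+1 m) => im; last by rewrite /upR /asc ltnNge im.
move: u v; apply: bruhat_ind => [u|u v w uv _ vw]; first exact: bruhat_refl.
apply: bruhat_trans vw; case: (step_liftR im uv) => [->|suv].
  rewrite /upR asc_sgR //; case: (asc i u) => /=; first exact: bruhat_refl.
  by rewrite mulgA sg_sq mul1g bruhat_refl.
rewrite {1}/upR; case: ifP => h.
  apply: bruhat_trans (connect1 suv) _.
  rewrite /upR; case: ifP => // av; first exact: bruhat_refl.
  apply: connect1.
  have := @step_sgR i (sg i * v)%g; rewrite asc_sgR // av => /(_ isT).
  by rewrite mulgA sg_sq mul1g.
exact: bruhat_trans (connect1 uv) (upR_ge _ _).
Qed.

Lemma le_dwR i u v : bruhat u v -> bruhat (dwR i u) (dwR i v).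
Proof.
case: (ltnP i.+1 m) => im; last by rewrite /dwR /asc ltnNge im (sg_out im) !mul1g.
have le_dw w : bruhat (dwR i w) w.
  rewrite /dwR; case: ifP => h; first exact: bruhat_refl.
  apply: connect1; have := @step_sgR i (sg i * w)%g.
  by rewrite asc_sgR // h mulgA sg_sq mul1g; apply.
move: u v; apply: bruhat_ind => [u|u v w uv _ vw]; first exact: bruhat_refl.
apply: bruhat_trans vw; case: (step_liftR im uv) => [->|suv].
  rewrite /dwR asc_sgR //; case: (asc i u) => /=; last exact: bruhat_refl.
  by rewrite mulgA sg_sq mul1g bruhat_refl.
rewrite {2}/dwR; case: ifP => h.
  exact: bruhat_trans (le_dw _) (connect1 uv).
apply: bruhat_trans (connect1 suv).
rewrite /dwR; case: ifP => au; last exact: bruhat_refl.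
by apply: connect1; apply: step_sgR.
Qed.

Lemma bruhat_inv u v : bruhat u v -> bruhat u^-1%g v^-1%g.
Proof.
move: u v; apply: bruhat_ind => [u|u v w uv _]; first exact: bruhat_refl.
apply: bruhat_trans; apply: connect1.
case/bruhat_stepP: uv => a [b [ab uab ->]].
apply/bruhat_stepP; exists (u a), (u b); rewrite !permK; split => //.
apply/permP=> x; rewrite invMg tpermV !permM.
have K y : x = u y -> u^-1%g x = y by move=> ->; rewrite permK.
case: (tpermP (u a) (u b) x) => [->|->|/eqP na /eqP nb]; rewrite ?permK ?tpermL ?tpermR //.
by rewrite tpermD // -(inj_eq (@perm_inj _ u)) permKV eq_sym.
Qed.

Lemma upLE i u : upL i u = (upR i u^-1)^-1%g.
Proof. by rewrite /upL /upR; case: ifP => _; rewrite ?invMg ?sgV invgK. Qed.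

Lemma upL_ge i u : bruhat u (upL i u).
Proof. by rewrite upLE -{1}[u]invgK; apply/bruhat_inv/upR_ge. Qed.

Lemma dwLE i u : dwL i u = (dwR i u^-1)^-1%g.
Proof. by rewrite /dwL /dwR; case: ifP => _; rewrite ?invMg ?sgV invgK. Qed.

Lemma le_upL i u v : bruhat u v -> bruhat (upL i u) (upL i v).
Proof. by move=> h; rewrite !upLE; apply/bruhat_inv/le_upR/bruhat_inv. Qed.

Lemma le_dwL i u v : bruhat u v -> bruhat (dwL i u) (dwL i v).
Proof. by move=> h; rewrite !dwLE; apply/bruhat_inv/le_dwR/bruhat_inv. Qed.

Lemma ell_sgR i u : asc i u -> ell (sg i * u)%g = (ell u).+1.
Proof.
case/andP=> im; case: (sgE im) => a [b [ea eb ->]] au.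
by apply: ell_adj; rewrite ?ea // -!apE ea eb.
Qed.

Lemma ell_sgL i u : asc i u^-1%g -> ell (u * sg i)%g = (ell u).+1.
Proof. by move=> h; rewrite -ell_inv invMg sgV ell_sgR // ell_inv. Qed.

End Action.

(** * Matchings and their conjugates *)

Notation matching n := {v : 'S_(2 * n) | v \in fpf (2 * n)}.

Section Matchings.
Variable n : nat.
Local Notation m := (2 * n).
Local Notation T := (matching n).
Implicit Types (u v x y z : T) (t : 'S_m).

Definition av v (k : nat) : nat := ap (val v) k.

Lemma avP u v : (forall k, k < m -> av u k = av v k) -> u = v.
Proof. by move=> h; apply/val_inj/apP. Qed.

Lemma val_sq v : (val v * val v = 1)%g.
Proof. by have := valP v; rewrite inE => /andP[/eqP]. Qed.

Lemma valV v : ((val v)^-1 = val v)%g.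
Proof. by apply/eqP; rewrite eq_invg_mul val_sq. Qed.

Lemma avK v : involutive (av v).
Proof. by move=> k; rewrite /av -ap_mul val_sq ap1. Qed.

Lemma av_inj v : injective (av v). Proof. exact: ap_inj. Qed.

Lemma av_lt v k : (av v k < m) = (k < m). Proof. exact: ap_lt. Qed.

Lemma av_neq v k : k < m -> av v k <> k.
Proof.
move=> km; have := valP v; rewrite inE => /andP[_ /forallP/(_ (Ordinal km))].
by rewrite -val_eqE /= -apE /= => /eqP.
Qed.

Lemma cj_subproof v t : (val v ^ t)%g \in fpf m.
Proof.
have := valP v; rewrite !inE => /andP[_ /forallP vi]; apply/andP; split.
  by apply/eqP; rewrite /Defs.pcomp -conjMg val_sq conj1g.
apply/forallP=> i; rewrite -[i](permKV t) permJ (inj_eq perm_inj); exact: vi.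
Qed.

Definition cj v t : T := exist _ (val v ^ t)%g (cj_subproof v t).

Lemma cjM v t t' : cj (cj v t) t' = cj v (t * t')%g.
Proof. by apply: val_inj; rewrite /= conjgM. Qed.

Lemma av_cj v t k : av (cj v t) (ap t k) = ap t (av v k).
Proof. by rewrite /av /= -!ap_mul /conjg mulKVg. Qed.

Definition N (i : nat) v : T := cj v (sg m i).

Lemma NK i : involutive (N i).
Proof. by move=> v; apply: val_inj; rewrite /= -conjgM sg_sq conjg1. Qed.

Lemma avN i v k : i.+1 < m -> av (N i v) k = sw i (av v (sw i k)).
Proof. by move=> im; rewrite -{1}[k](swK i) -(ap_sg (sw i k) im) av_cj ap_sg. Qed.

Lemma N_out i v : m <= i.+1 -> N i v = v.
Proof. by move=> h; apply: val_inj; rewrite /= sg_out // conjg1. Qed.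

Lemma N_comm i j v : (i.+1 < j) || (j.+1 < i) -> N i (N j v) = N j (N i v).
Proof.
move=> h; rewrite /N !cjM; congr cj.
by case/orP: h => h; [symmetry|]; apply: sg_comm.
Qed.

Lemma N_braid i v : i.+2 < m -> N i (N i.+1 (N i v)) = N i.+1 (N i (N i.+1 v)).
Proof. by move=> h; rewrite /N !cjM !mulgA sg_braid. Qed.

(* [s_i] is a descent of the twisted identity [w0 v] iff it is an ascent of
   the matching [v]. *)
Definition dn i v := (i.+1 < m) && (av v i < av v i.+1).

Lemma dn_lt i v : dn i v -> i.+1 < m. Proof. by case/andP. Qed.

Lemma w0_fpf : w0 m \in fpf m.
Proof.
rewrite inE; apply/andP; split.
  by apply/eqP/permP=> i; apply: val_inj; rewrite permM perm1 /= !w0E; have := ltn_ord i; lia.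
by apply/forallP=> i; rewrite permE -val_eqE /=; have := ltn_ord i; lia.
Qed.

Definition e : T := exist _ (w0 m) w0_fpf.

Lemma av_e k : k < m -> av e k = m - k.+1.
Proof. by move=> km; rewrite -[k]/(val (Ordinal km)) /av apE w0E. Qed.

Lemma avNfix i v : i.+1 < m -> (N i v == v) = (av v i == i.+1).
Proof.
move=> im; apply/eqP/eqP => [h|h].
  have := avN v i im; rewrite h swl => h1.
  have h2 := @av_neq v i (ltnW im); have h3 := @av_neq v _ im.
  have h4 : av v i <> av v i.+1 by move/av_inj; lia.
  by move: h1; rewrite /sw; do ! case: eqP; lia.
have h' : av v i.+1 = i by rewrite -h avK.
apply: avP => k km; rewrite avN //.
case: (eqVneq k i) => [->|ki]; first by rewrite swl h' swl.
case: (eqVneq k i.+1) => [->|ki']; first by rewrite swr h swr.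
rewrite (swD ki ki') swD //.
  by rewrite -h' (inj_eq (@av_inj v)).
by rewrite -h (inj_eq (@av_inj v)).
Qed.

(** Unless an arc joins [i] and [i.+1], the partners of both lie elsewhere. *)
Lemma sw_nfix i v : i.+1 < m -> N i v != v ->
  sw i (av v i) = av v i /\ sw i (av v i.+1) = av v i.+1.
Proof.
move=> im; rewrite avNfix // => /eqP nf.
have h2 := @av_neq v i (ltnW im); have h3 := @av_neq v _ im.
have h5 : av v i.+1 <> i by move=> h; apply: nf; rewrite -[X in av v X]h avK.
by split; apply: swD; apply/eqP.
Qed.

Lemma dn_nfix i v : dn i v -> N i v != v.
Proof.
case/andP=> im h; rewrite avNfix //; apply/eqP=> h1.
have h2 : av v i.+1 = i by rewrite -h1 avK.
by lia.
Qed.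

Lemma dnN i v : i.+1 < m -> N i v != v -> dn i (N i v) = ~~ dn i v.
Proof.
move=> im nf; have [s1 s2] := sw_nfix im nf.
rewrite /dn im !avN // swl swr s1 s2.
have h4 : av v i <> av v i.+1 by move/av_inj; lia.
lia.
Qed.

Lemma ell_dn i v : dn i v -> ell (val (N i v)) = (ell (val v)).+2.
Proof.
move=> d; have im := dn_lt d; have nf := dn_nfix d.
have -> : val (N i v) = (sg m i * (val v * sg m i))%g.
  by rewrite /= /conjg sgV.
rewrite ell_sgR ?ell_sgL ?valV //.
have [s1 s2] := sw_nfix im nf.
by rewrite /asc im !ap_mul !ap_sg // -!/(av v _) s1 s2; case/andP: d.
Qed.

(* The order is reversed, so that [v |-> w0 v] turns [le], [rk] and [N i] into
   the order, the rank and the twisted conjugation by [s_i] of Br(iota). *)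
Definition le x y := bruhat (val y) (val x).
Definition rk v := (ell (w0 m ∘ val v))./2.

Lemma le_refl x : le x x. Proof. exact: bruhat_refl. Qed.

Lemma le_trans y x z : le x y -> le y z -> le x z.
Proof. by rewrite /le => h h'; apply: bruhat_trans h' h. Qed.

Lemma rk_dn i v : dn i v -> rk v = (rk (N i v)).+1.
Proof.
move=> /ell_dn h; have := ell_w0_comp (val v); have := ell_w0_comp (val (N i v)).
rewrite h /rk; set a := ell (_ ∘ _); set b := ell (_ ∘ _); lia.
Qed.

Lemma rk_up i v : i.+1 < m -> N i v != v -> ~~ dn i v -> rk (N i v) = (rk v).+1.
Proof. by move=> im nf nd; rewrite (@rk_dn i) ?NK // dnN. Qed.

Lemma decr_le v a b : a <= b -> b < m ->
  (forall j, a <= j < b -> ~~ dn j v) -> av v b + (b - a) <= av v a.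
Proof.
move=> ab; elim: b ab => [|b IH] ab bm h; first by (have -> : a = 0 by lia); lia.
case: (eqVneq a b.+1) => [<-|nab]; first by rewrite subnn addn0.
have IH' : av v b + (b - a) <= av v a.
  by apply: IH => [||j hj]; [lia|lia|apply: h; lia].
have hb : ~~ dn b v by apply: h; lia.
have : av v b <> av v b.+1 by move/av_inj; lia.
by move: hb; rewrite /dn bm; lia.
Qed.

Lemma no_dn v : (forall j, ~~ dn j v) -> v = e.
Proof.
move=> h; apply: avP => k km; rewrite av_e //.
have h1 := @decr_le v 0 k isT km (fun j _ => h j).
have km' : m.-1 < m by lia.
have kk : k <= m.-1 by lia.
have h2 := @decr_le v k m.-1 kk km' (fun j _ => h j).
have : av v 0 < m by rewrite av_lt; lia.
lia.
Qed.

Lemma exists_dn v : v <> e -> exists i, dn i v.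
Proof.
move=> ve; case: (boolP [exists i : 'I_m, dn i v]) => [/existsP[i di]|].
  by exists i.
rewrite negb_exists => /forallP h; case: ve; apply: no_dn => j.
case: (ltnP j m) => jm; first exact: h (Ordinal jm).
by rewrite /dn; lia.
Qed.

Lemma dn_ind (P : T -> Prop) :
  P e -> (forall i v, dn i v -> P (N i v) -> P v) -> forall v, P v.
Proof.
move=> Pe PN v; have [k] := ubnP (rk v); elim: k v => // k IH v hk.
case: (eqVneq v e) => [-> //|/eqP/exists_dn[i di]].
by apply: PN (di) (IH _ _); rewrite (rk_dn di) in hk.
Qed.

Lemma no_dn_e i : ~~ dn i e.
Proof. by rewrite /dn; case: (ltnP i.+1 m) => //= h; rewrite !av_e; lia. Qed.

Lemma ell_rk v : ell (w0 m ∘ val v) = (rk v).*2.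
Proof.
elim/dn_ind: v => [|i v di IH].
  have := ell_w0_comp (w0 m); rewrite /rk -[val e]/(w0 m); set a := ell (_ ∘ _); lia.
rewrite (rk_dn di) doubleS -IH.
have := ell_w0_comp (val v); have := ell_w0_comp (val (N i v)).
rewrite (ell_dn di); set a := ell (_ ∘ _); set b := ell (_ ∘ _); lia.
Qed.

Lemma rk_e : rk e = 0.
Proof. by have := ell_w0_comp (w0 m); rewrite /rk -[val e]/(w0 m); lia. Qed.

Lemma le_eqVlt x y : le x y -> (x == y) || (rk x < rk y).
Proof.
move=> /bruhat_ell /orP[/eqP/val_inj -> |h]; first by rewrite eqxx.
have := ell_w0_comp (val x); have := ell_w0_comp (val y); rewrite !ell_rk.
by move: h => *; apply/orP; right; lia.
Qed.

Lemma le_rk x y : le x y -> rk x <= rk y.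
Proof. by move/le_eqVlt=> /orP[/eqP -> //|/ltnW]. Qed.

Lemma le_rk_eq x y : le x y -> rk y <= rk x -> x = y.
Proof. by move/le_eqVlt=> /orP[/eqP -> //|]; lia. Qed.

Lemma le_anti x y : le x y -> le y x -> x = y.
Proof. by move=> h /le_rk; apply: le_rk_eq. Qed.

Definition lt x y := (x != y) && le x y.

Lemma lt_rk x y : lt x y -> rk x < rk y.
Proof. by case/andP=> ne /le_eqVlt /orP[/eqP h|//]; rewrite h eqxx in ne. Qed.

Lemma rk0 v : rk v = 0 -> v = e.
Proof. by move=> h; case: (eqVneq v e) => // /eqP/exists_dn[i /rk_dn]; lia. Qed.

(** On the underlying permutation this is the Demazure product with [s_i] on both sides, hence
    monotone. *)
Definition dnm i v := if dn i v then N i v else v.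

Lemma asc_av i v : asc i (val v) = dn i v. Proof. by []. Qed.

Lemma asc_sgRV i v : i.+1 < m -> N i v != v ->
  asc i (sg m i * val v)^-1%g = dn i v.
Proof.
move=> im nf; have [s1 s2] := sw_nfix im nf.
by rewrite invMg sgV valV /asc /dn im !ap_mul !ap_sg // -!/(av v _) s1 s2.
Qed.

Lemma val_N i v : val (N i v) = (sg m i * val v * sg m i)%g.
Proof. by rewrite /= /conjg sgV mulgA. Qed.

Lemma dnmE i v : val (dnm i v) = upL i (upR i (val v)).
Proof.
case: (ltnP i.+1 m) => im; last first.
  by rewrite /dnm /upL /upR /dn /asc ltnNge im.
rewrite /dnm /upR asc_av; case: ifP => d.
  by rewrite /upL asc_sgRV ?d ?val_N // dn_nfix.
by rewrite /upL valV asc_av d.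
Qed.

Lemma le_dnm i x y : le x y -> le (dnm i x) (dnm i y).
Proof. by rewrite /le !dnmE => h; apply/le_upL/le_upR. Qed.

Lemma upmE i v : i.+1 < m -> N i v != v ->
  val (if dn i v then v else N i v) = dwL i (dwR i (val v)).
Proof.
move=> im nf; rewrite /dwR asc_av; case: ifP => d.
  by rewrite /dwL valV asc_av d.
by rewrite /dwL asc_sgRV // d val_N.
Qed.

(** If [v] joins [i] and [i.+1], lowering on the right makes both fixed points and lowering on the
    left then stops, so the result is no matching. This is why [le_upm] excludes fixed elements. *)
Lemma dw_fix i v : i.+1 < m -> N i v = v ->
  dwL i (dwR i (val v)) = (sg m i * val v)%g.
Proof.
move=> im fx; have /eqP := fx; rewrite avNfix // => /eqP h.
have h' : av v i.+1 = i by rewrite -h avK.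
have d : dn i v = false by rewrite /dn h h' im; lia.
rewrite /dwR asc_av d /dwL; suff -> : asc i (sg m i * val v)^-1%g by [].
rewrite /asc im invMg sgV valV !ap_mul !ap_sg // -!/(av v _) h h' swl swr; lia.
Qed.

Lemma le_upm i x y : i.+1 < m -> N i x != x -> N i y != y -> le x y ->
  le (if dn i x then x else N i x) (if dn i y then y else N i y).
Proof. by move=> im fx fy h; rewrite /le !upmE //; apply/le_dwL/le_dwR. Qed.

(** Defined through the rank; [atom_above] shows that every strict relation passes through such a
    pair, so these are the covers of the order. *)
Definition cov x y := le x y && (rk y == (rk x).+1).

(* A fixed element covering an [i]-up element would make [s_i y] and [N i x]
   differ by a single transposition, although [s_i y] has fixed points. *)
Lemma cov_fix i x y : i.+1 < m -> N i y = y -> cov x y -> ~~ dn i x ->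
  N i x != x -> False.
Proof.
move=> im fy /andP[xy /eqP rxy] dx fx.
have h : bruhat (sg m i * val y)%g (val (N i x)).
  rewrite -(dw_fix im fy); have := upmE im fx; rewrite (negPf dx) => ->.
  exact/le_dwL/le_dwR.
have ey : asc i (sg m i * val y)%g.
  have /eqP := fy; rewrite avNfix // => /eqP hy.
  have hy' : av y i.+1 = i by rewrite -hy avK.
  by rewrite /asc im !ap_mul !ap_sg // swl swr -!/(av _ _) hy hy'; lia.
have e1 := ell_sgR ey; rewrite mulgA sg_sq mul1g in e1.
have e2 := ell_w0_comp (val y); have e3 := ell_w0_comp (val (N i x)).
rewrite !ell_rk in e2 e3; have rx := rk_up im fx dx.
have {e1 e2 e3} E : ell (val (N i x)) = (ell (sg m i * val y)%g).+1 by lia.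
have ne : N i x != y.
  by apply/eqP=> exy; move: fx; rewrite -{2}[x](NK i) exy fy eqxx.
have /eqP hy := fy; rewrite avNfix // in hy; move/eqP: hy => hy.
have hy' : av y i.+1 = i by rewrite -hy avK.
case/connectP: h; set w := val (N i x) in E *.
set sy := (_ * _)%g in E * => -[|v [|v' p]] /=.
- by move=> _ h; move: E; rewrite h => /n_Sn.
(* Both [i] and [i.+1] are fixed by [sy], so the single transposition has to exchange them. *)
- move=> /andP[/bruhat_step_ap[a [b [/andP[ab bm] _ hv]]] _] ev.
  have fi : av (N i x) i = i.+1.
    have Ei := hv i; have Ei' := hv i.+1; move: Ei Ei'.
    rewrite !ap_mul !ap_sg -?ev -?/(av (N i x) _) -?/(av y _) //.
    have n1 := @av_neq (N i x) i (ltnW im); have n2 := @av_neq (N i x) i.+1 im.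
    have s1 : av y (sw i i) = i by rewrite swl.
    have s2 : av y (sw i i.+1) = i.+1 by rewrite swr.
    case: (i =P a) => [ea|nea]; last case: (i =P b) => [eb|neb].
    + case: (i.+1 =P a) => [|_]; first by lia.
      case: (i.+1 =P b) => [eb|_]; last by rewrite s2; lia.
      by rewrite -eb s2.
    + case: (i.+1 =P a) => [|_]; first by lia.
      case: (i.+1 =P b) => [|_]; first by lia.
      by rewrite s2; lia.
    + by rewrite s1.
  by have := avNfix (N i x) im; rewrite fi eqxx NK eq_sym (negPf fx).
- move=> /andP[/bruhat_step_ell h1 /andP[/bruhat_step_ell h2 h3]] ev.
  have /bruhat_ell : bruhat v' w by apply/connectP; exists p.
  by case/orP=> [/eqP e4|]; first rewrite -e4 in E; lia.
Qed.

End Matchings.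

(** * Order on matchings and special partial matchings *)

Section Order.
Variable n : nat.
Local Notation m := (2 * n).
Local Notation T := (matching n).
Local Notation e := (e n).
Implicit Types (u v x y z b : T) (M : T -> T).

Lemma lt_le x y : lt x y -> le x y. Proof. by case/andP. Qed.

Lemma cov_le x y : cov x y -> le x y. Proof. by case/andP. Qed.

Lemma cov_rk x y : cov x y -> rk y = (rk x).+1. Proof. by case/andP=> _ /eqP. Qed.

Lemma cov_neq x y : cov x y -> x <> y.
Proof. by move=> /cov_rk h ee; rewrite ee in h; lia. Qed.

Lemma cov_lt x y : cov x y -> lt x y.
Proof. by move=> h; rewrite /lt cov_le // andbT; apply/eqP/cov_neq. Qed.

Lemma lt_cov x y : lt x y -> rk y <= (rk x).+1 -> cov x y.
Proof. by move=> h r; rewrite /cov lt_le //=; have := lt_rk h; lia. Qed.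

Lemma dn_cov i v : dn i v -> cov (N i v) v.
Proof.
move=> d; rewrite /cov (rk_dn d) eqxx andbT; have := dnmE i v.
rewrite /dnm d /le => ->; exact: bruhat_trans (upR_ge _ _) (upL_ge _ _).
Qed.

Lemma up_cov i v : i.+1 < m -> N i v != v -> ~~ dn i v -> cov v (N i v).
Proof.
move=> im nf nd; rewrite -{1}[v](NK i); apply: dn_cov.
by rewrite dnN.
Qed.

Variant N_spec i v : bool -> Prop :=
  | NDn of dn i v & cov (N i v) v : N_spec i v true
  | NUp of i.+1 < m & cov v (N i v) & dn i (N i v) : N_spec i v false
  | NFx of N i v = v : N_spec i v false.

Lemma NP i v : N_spec i v (dn i v).
Proof.
case: (boolP (dn i v)) => d; first by apply: NDn => //; apply: dn_cov.
case: (eqVneq (N i v) v) => [|nf]; first exact: NFx.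
case: (ltnP i.+1 m) => im; last by rewrite N_out ?eqxx in nf.
by apply: NUp => //; [apply: up_cov|rewrite dnN].
Qed.

Lemma cov_up i v : cov v (N i v) -> [/\ i.+1 < m, dn i (N i v) & dn i v = false].
Proof.
by case: (NP i v) => // [_ c|->] /cov_rk; [have := cov_rk c|]; lia.
Qed.

Lemma cov_dn i v : cov (N i v) v -> dn i v.
Proof.
by case: (NP i v) => // [_ cx _|->] /cov_rk; [have := cov_rk cx|]; lia.
Qed.

Lemma e_min v : le e v.
Proof.
elim/dn_ind: v => [|i v d IH]; first exact: le_refl.
exact: le_trans IH (cov_le (dn_cov d)).
Qed.

(** Lowering and raising are monotone; the one combination they leave open, [x] moved up and [y]
    fixed, is excluded by [cov_fix]. *)
Lemma N_cov i x y : cov x y -> N i x <> y -> lt (N i x) (N i y).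
Proof.
move=> c ny; have xy := cov_le c; have r := cov_rk c.
have ne : N i x != N i y by apply/eqP=> /(can_inj (NK i)); apply: cov_neq.
rewrite /lt ne /=; case: (ltnP i.+1 m) => im; last by rewrite !N_out.
have := le_dnm i xy; rewrite /dnm.
case: (NP i x) => [dx cx|_ cx dx|fx]; case: (NP i y) => [dy cy|_ cy dy|fy] //.
- by move=> _; exact: le_trans (cov_le cx) (le_trans xy (cov_le cy)).
- by move=> _; rewrite fy; exact: le_trans (cov_le cx) xy.
- move=> h; case: ny; have -> : x = N i y; last exact: NK.
  by apply: le_rk_eq h _; have := cov_rk cy; lia.
- move=> _; have [_ _ nx] := cov_up cx; have [_ _ ny'] := cov_up cy.
  have := @le_upm n i x y im; rewrite nx ny'.
  by apply => //; rewrite eq_sym; apply/eqP/cov_neq.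
- have [_ _ nd] := cov_up cx; have := @cov_fix n i x y im fy c; rewrite nd.
  by case=> //; rewrite eq_sym; apply/eqP/cov_neq.
- move=> h; have ex : x = N i y by apply: le_rk_eq h _; have := cov_rk cy; lia.
  by case: (cov_neq c); rewrite -fx ex NK.
- by move=> _; rewrite fx; exact: le_trans xy (cov_le cy).
- by rewrite fx fy.
Qed.

Lemma le_dn_up i x y : dn i y -> le x y -> le (N i x) y.
Proof.
move=> dy xy; case: (NP i x) => [dx cx|im cx dx|->] //.
  exact: le_trans (cov_le cx) xy.
have [_ _ nd] := cov_up cx; have := @le_upm n i x y im; rewrite dy nd; apply=> //.
  by rewrite eq_sym; apply/eqP/cov_neq.
exact: dn_nfix.
Qed.

Lemma le_N i x y : dn i x -> dn i y -> le x y -> le (N i x) (N i y).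
Proof. by move=> dx dy /(le_dnm i); rewrite /dnm dx dy. Qed.

Lemma le_N_up i x y : ~~ dn i x -> dn i y -> le x y -> le x (N i y).
Proof. by move=> dx dy /(le_dnm i); rewrite /dnm (negPf dx) dy. Qed.

(** If the descent [i] of [y] is not one of [x], lower [y] only. Otherwise lower both and conjugate
    the cover [z] of [N i x] back, unless [z] is [x] itself; [cov_fix] prevents [z] from being
    fixed. *)
Lemma atom_above x y : lt x y -> exists2 z, cov x z & le z y.
Proof.
elim/dn_ind: y x => [|i y dy IH] x.
  by move=> /lt_rk; rewrite rk_e; lia.
move=> /andP[nxy xy]; have cy := dn_cov dy.
have im := dn_lt dy.
have low : le x (N i y) -> exists2 z, cov x z & le z y.
  case: (eqVneq x (N i y)) => [-> _|ne h]; first by exists y => //; apply: le_refl.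
  have [|z cz zy] := IH x; first by rewrite /lt ne.
  by exists z => //; apply: le_trans zy (cov_le cy).
case: (boolP (dn i x)) => dx; last by apply: low; apply: le_N_up.
have cx := dn_cov dx.
have l1 : lt (N i x) (N i y) by rewrite /lt (inj_eq (can_inj (NK i))) nxy le_N.
have ux : ~~ dn i (N i x) by rewrite dnN ?dx // dn_nfix.
have [z cz zy] := IH _ l1; have zy' := le_trans zy (cov_le cy).
case: (NP i z) => [dz cz'|_ cz' dz|fz].
- apply: low; suff -> : x = z by [].
  have r : rk z <= rk x by rewrite (cov_rk cz) (cov_rk cx).
  by have := le_dn_up dz (cov_le cz); rewrite NK => h; exact: le_rk_eq h r.
- exists (N i z); last exact: le_dn_up.
  have nz : N i (N i x) <> z.
    rewrite NK => ez; move: dz; rewrite -ez (negPf ux) //.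
  have := N_cov cz nz; rewrite NK => h; apply: lt_cov => //.
  by move: (cov_rk cz) (cov_rk cz') (cov_rk cx); clear; lia.
- case: (cov_fix im fz cz ux); rewrite NK eq_sym; exact: dn_nfix.
Qed.

Lemma coatom_above x y : lt x y -> exists2 z, le x z & cov z y.
Proof.
have [k] := ubnP (rk y - rk x); elim: k x => // k IH x hk xy.
have [z xz zy] := atom_above xy.
case: (eqVneq z y) => [ezy|nzy].
  by exists x; [exact: le_refl|rewrite -ezy].
have [||z' zz' cz'] := IH z; last by exists z' => //; apply: le_trans (cov_le xz) _.
  by move: hk (cov_rk xz) (lt_rk xy); clear; lia.
by rewrite /lt nzy.
Qed.

Lemma e_coatom y : y <> e -> exists z, cov z y.
Proof.
move=> ye; case: (@coatom_above e y) => [|z _ h]; last by exists z.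
by rewrite /lt e_min andbT eq_sym; apply/eqP.
Qed.

(* [M] is a special partial matching of the lower interval below [w]. *)
Definition spm M w := [/\ forall x, le x w -> le (M x) w /\ M (M x) = x,
  cov (M w) w,
  forall x, le x w -> [\/ cov (M x) x, M x = x | cov x (M x)] &
  forall x y, le y w -> cov x y -> M x <> y -> lt (M x) (M y)].

Lemma N_spm i w : dn i w -> spm (N i) w.
Proof.
move=> d; split.
- by move=> x xw; split; [exact: le_dn_up|exact: NK].
- exact: dn_cov.
- by move=> x _; case: (NP i x); [constructor 1|constructor 3|constructor 2].
- by move=> x y _; apply: N_cov.
Qed.

Section SPM.
Variables (M : T -> T) (w : T).
Hypothesis sM : spm M w.

Lemma spm_le x : le x w -> le (M x) w.
Proof. by case: sM => h _ _ _ /h[]. Qed.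

Lemma spmK x : le x w -> M (M x) = x.
Proof. by case: sM => h _ _ _ /h[]. Qed.

Lemma spm_top : cov (M w) w. Proof. by case: sM. Qed.

Lemma spm_case x : le x w -> [\/ cov (M x) x, M x = x | cov x (M x)].
Proof. by case: sM => _ _ h _ /h. Qed.

Lemma spm_cov x y : le y w -> cov x y -> M x <> y -> lt (M x) (M y).
Proof. by case: sM => _ _ _ h; apply: h. Qed.

Lemma spm_inj x y : le x w -> le y w -> M x = M y -> x = y.
Proof. by move=> hx hy E; rewrite -(spmK hx) E spmK. Qed.

Lemma spm_up x y : le y w -> cov x y -> cov x (M x) -> M x <> y ->
  cov y (M y) /\ cov (M x) (M y).
Proof.
move=> yw xy ux ne; have l := spm_cov yw xy ne; have r := lt_rk l.
move: (cov_rk xy) (cov_rk ux) => r1 r2.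
case: (spm_case yw) => [/cov_rk|E|cy]; [lia|by rewrite E in r; lia|].
by split=> //; apply: lt_cov => //; have := cov_rk cy; lia.
Qed.

(** Applying [M] to [b < M y] gives [M b < y]. As [M] changes ranks by at most one, it must move [b]
    down, to an element covered by [y]. *)
Lemma spm_lc y b : le y w -> cov y (M y) -> cov b (M y) -> b <> y ->
  cov (M b) b /\ cov (M b) y.
Proof.
move=> yw uy cb nb; have mw := spm_le yw.
have bw : le b w := le_trans (cov_le cb) mw.
have ne : M b <> M y by move/(spm_inj bw yw).
have := spm_cov mw cb ne; rewrite spmK // => l; have r := lt_rk l.
move: (cov_rk cb) (cov_rk uy) => r1 r2.
case: (spm_case bw) => [c|E|/cov_rk]; [|by rewrite E in r; lia|by lia].
by split=> //; apply: lt_cov => //; have := cov_rk c; lia.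
Qed.

(** Along a chain of covers from [y] up to [x], either [M y] is the next element or it lies below
    the image of the next element; the last image is [M x]. *)
Lemma spm_below y x : le x w -> cov (M x) x -> le y x -> le (M y) x.
Proof.
move=> xw cx; have [k] := ubnP (rk x - rk y); elim: k y => // k IH y hk yx.
case: (eqVneq y x) => [->|ne]; first exact: cov_le.
have [|z yz zx] := @atom_above y x; first by rewrite /lt ne.
case: (eqVneq (M y) z) => [-> //|/eqP nyz].
apply: le_trans (lt_le (spm_cov (le_trans zx xw) yz nyz)) (IH _ _ zx).
have yx' : lt y x by rewrite /lt ne.
by move: hk (cov_rk yz) (lt_rk yx'); clear; lia.
Qed.

Lemma spm_res x : le x w -> cov (M x) x -> spm M x.
Proof.
move=> xw cx; split=> //.
- by move=> y yx; split; [exact: spm_below|apply: spmK; apply: le_trans yx xw].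
- by move=> y yx; apply: spm_case; apply: le_trans yx xw.
- by move=> y z zx; apply: spm_cov; apply: le_trans zx xw.
Qed.

Lemma spm_coatom x : cov x w -> x <> M w -> cov (M x) x.
Proof.
move=> cx ne; have xw := cov_le cx.
have [] // := @spm_lc (M w) x (spm_le (le_refl w)); rewrite ?spmK ?le_refl //.
exact: spm_top.
Qed.

End SPM.

End Order.

(** * Elements with the same lower covers *)

Section Lower.
Variable n : nat.
Local Notation m := (2 * n).
Local Notation T := (matching n).
Local Notation e := (e n).
Implicit Types (u v x y z b : T) (M : T -> T).

Lemma av_ge v k : m <= k -> av v k = k. Proof. exact: ap_ge. Qed.

Lemma av_eq v (p q : nat) : av v p = q <-> p = av v q.
Proof. by split=> [<-|->]; rewrite avK. Qed.

Lemma av_iff v (p q : nat) : av v p = q -> forall x : nat, av v x = p <-> x = q.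
Proof. by move=> <- x; split=> [<-|->]; rewrite avK. Qed.

Lemma dn_av i v : dn i v -> av v i < av v i.+1. Proof. by case/andP. Qed.

Lemma dnN_l i v : dn i v -> av (N i v) i = av v i.+1.
Proof.
move=> d; have im := dn_lt d; have [_ h] := sw_nfix im (dn_nfix d).
by rewrite avN // swl h.
Qed.

Lemma dnN_r i v : dn i v -> av (N i v) i.+1 = av v i.
Proof.
move=> d; have im := dn_lt d; have [h _] := sw_nfix im (dn_nfix d).
by rewrite avN // swr h.
Qed.

Lemma ndn_av i v : ~~ dn i v -> i.+1 < m -> av v i.+1 < av v i.
Proof.
rewrite /dn => h im; move: h; rewrite im /=.
have : av v i <> av v i.+1 by move/av_inj; lia.
lia.
Qed.

Lemma decr_lt v p q : p < q < m -> (forall j, p <= j < q -> ~~ dn j v) ->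
  av v q < av v p.
Proof. by case/andP=> pq qm /(decr_le (ltnW pq) qm); lia. Qed.

(* Two different adjacent transpositions have the same effect on [v] only if
   [v] maps one pair of positions onto the other. *)
Lemma N_same i j v : dn i v -> i != j -> N i v = N j v ->
  av v i = j /\ av v i.+1 = j.+1.
Proof.
move=> di ij E; have im := dn_lt di.
have dj : dn j v by apply: cov_dn; rewrite -E; apply: dn_cov.
have jm := dn_lt dj.
have [si1 si2] := sw_nfix im (dn_nfix di); have [sj1 sj2] := sw_nfix jm (dn_nfix dj).
have := congr1 (fun x => av x i) E; rewrite /= !avN // swl si2.
have := dn_av di; have := dn_av dj.
case: (eqVneq i j.+1) => [ei|nij].
  have -> : sw j i = j by rewrite ei swr.
  by rewrite sj1 ei; lia.
rewrite (swD ij nij) /sw.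
by do ! case: eqP; lia.
Qed.

Definition nocross v := forall p q : nat, p < q -> q < av v p -> av v p < av v q -> False.

(** Two arcs that both open or both close at [i] and [i.+1] would cross here, so one closes at [i]
    and one opens at [i.+1]. *)
Lemma nocross_dn v i : nocross v -> dn i v -> av v i < i /\ i.+1 < av v i.+1.
Proof.
move=> nc d; have im := dn_lt d; have lt := dn_av d.
have := dn_nfix d; rewrite avNfix // => /eqP nf.
have h1 := @av_neq _ v i (ltnW im); have h2 := @av_neq _ v _ im.
have h3 : av v i.+1 <> i by move/av_eq/esym.
have c1 := nc i i.+1 (ltnSn i); have := nc (av v i) (av v i.+1) lt; rewrite !avK.
lia.
Qed.

Definition single v i := dn i v /\ forall r, dn r v -> N r v = N i v.

(** If [s] is the only descent, [v] decreases on either side of [s], and a crossing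
    [a < b < v a < v b] would give [v a <= s < b]. A second descent [r] with the same effect makes
    [v] pair [s, s.+1] with [r, r.+1], and then [N s v] has no descent left, so [v] has rank 1. *)
Lemma single_nocross v s : single v s -> 2 <= rk v -> nocross v.
Proof.
case=> ds hs r2; have sm := dn_lt ds.
case: (boolP [exists r : 'I_m, dn r v && (r != s :> nat)]).
  case/existsP=> r /andP[dr /eqP rs]; have rm := dn_lt dr.
  have [v1 v2] := N_same dr (introN eqP rs) (hs _ dr).
  have v3 : av v s = r by apply/av_eq.
  have v4 : av v s.+1 = r.+1 by apply/av_eq.
  have nd j : j <> s -> j <> r -> ~~ dn j v.
    move=> js jr; apply/negP=> dj; have [] := N_same dj (introN eqP js) (hs _ dj).
    by move=> /av_eq; rewrite v3.
  suff es : N s v = e by move: (rk_dn ds); rewrite es rk_e; lia.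
  have P (x : nat) : (av v x = r <-> x = s) /\ (av v x = r.+1 <-> x = s.+1) /\
    (av v x = s <-> x = r) /\ (av v x = s.+1 <-> x = r.+1).
    by rewrite (av_iff v1) (av_iff v2) (av_iff v3) (av_iff v4).
  have rs2 : r <> s.+1 :> nat by move=> h; have := P s; lia.
  have sr2 : s <> r.+1 :> nat by move=> h; have := P r; lia.
  apply: no_dn => j; apply/negP=> /andP[jm]; rewrite !avN //.
  have ndj := nd j.
  have p1 : av v j.+1 = r -> j.+1 = s by case: (av_iff v1 j.+1).
  have p2 : av v j = r.+1 -> j = s.+1 by case: (av_iff v2 j).
  have p3 : av v j = s.+1 -> j = r.+1 by case: (av_iff v4 j).
  have p4 : av v j.+1 = s -> j.+1 = r by case: (av_iff v3 j.+1).
  have D (x : nat) : x <> s -> x <> s.+1 -> sw s x = x by move=> /eqP ? /eqP ?; apply: swD.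
  have D1 := D r rs rs2; have D2 : sw s r.+1 = r.+1 by apply: D; clear -rs sr2; lia.
  case: (eqVneq j s) => [->|/eqP js].
    by rewrite swl swr v3 v4 D1 D2; clear; lia.
  case: (eqVneq j r) => [->|/eqP jr].
    by rewrite D1 D2 v1 v2 swl swr; clear; lia.
  have lt := ndn_av (ndj js jr) jm.
  case: (eqVneq j s.+1) => [e1|/eqP js1].
    have -> : sw s j = s by rewrite e1 swr.
    rewrite (D j.+1) ?v3; try by clear -e1; lia.
    have := swP s r; have := swP s (av v j.+1); have ej : av v j = r.+1 by rewrite e1.
    by rewrite ej in lt; clear -lt p1 e1 rs2 sr2 rs; lia.
  case: (eqVneq j.+1 s) => [e1|/eqP js2].
    have -> : sw s j.+1 = s.+1 by rewrite e1 swl.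
    rewrite (D j) ?v4; try by clear -e1; lia.
    have := swP s r.+1; have := swP s (av v j).
    have ej : av v j.+1 = r by rewrite e1.
    by rewrite ej in lt; clear -lt p2 e1 rs2 sr2 rs; lia.
  rewrite (D j) ?(D j.+1); try by clear -js js1 js2; lia.
  have := swP s (av v j); have := swP s (av v j.+1).
  by clear -lt p3 p4 jr js js1 js2 rs2 sr2 rs; lia.
rewrite negb_exists => /forallP nd.
have {}nd j : j <> s -> ~~ dn j v.
  move=> js; case: (ltnP j m) => jm; last by rewrite /dn; lia.
  by have := nd (Ordinal jm); rewrite negb_and /= negbK; case/orP=> // /eqP.
have dec (p q : nat) : p < q < m -> (q <= s) || (s < p) -> av v q < av v p.
  by move=> pq qs; apply: decr_lt => // j hj; apply: nd => js; lia.
move=> a b ab bva vab.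
have bm : b < m by case: ltnP => // h; have := av_ge v h; lia.
have vbm : av v b < m by rewrite av_lt.
have d1 := dec a b; have d2 := dec (av v a) (av v b); rewrite !avK in d2.
lia.
Qed.

Definition samelow z z' := forall b, cov b z <-> cov b z'.

Lemma samelow_sym z z' : samelow z z' -> samelow z' z.
Proof. by move=> h b; split=> /h. Qed.

(** [z'] also covers [N s z]; conjugating this cover by [s_s] gives [z < N s z']. So no descent of
    [z] is a descent of [z']. *)
Lemma samelow_up z z' s : samelow z z' -> z <> z' -> dn s z -> dn s (N s z') /\ rk (N s z') = (rk z).+1.
Proof.
move=> sl ne d; have c := dn_cov d; have c' := (sl _).1 c.
have := @N_cov n s _ _ c'; rewrite NK => /(_ ne)/lt_rk.
have r : rk z = rk z' by rewrite (cov_rk c) (cov_rk c').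
by rewrite r; case: (NP s z') => [_ /cov_rk|im /cov_rk|->] *; try lia.
Qed.

Lemma cov_dn_other z s b : dn s z -> cov b z -> b <> N s z -> dn s b.
Proof.
move=> d c ne; have c' := dn_cov d.
have /lt_rk : lt (N s b) (N s z).
  by apply: N_cov => // E; apply: ne; rewrite -E NK.
have := cov_rk c; have := cov_rk c'.
by case: (NP s b) => // [_ /cov_rk|->] *; lia.
Qed.

Lemma N_rk i v : rk (N i v) <= (rk v).+1 <= (rk (N i v)).+2.
Proof. by case: (NP i v) => [_ /cov_rk|_ /cov_rk|->]; lia. Qed.

Lemma N_far i j v : i <> j.+1 -> j <> i.+1 -> N i (N j v) = N j (N i v).
Proof.
move=> h h'; case: (eqVneq i j) => [-> //|/eqP ij].
by apply: N_comm; lia.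
Qed.

Lemma N_br i j v : (j = i.+1) \/ (i = j.+1) -> i.+1 < m -> j.+1 < m ->
  N i (N j (N i v)) = N j (N i (N j v)).
Proof. by case=> -> h h'; rewrite N_braid. Qed.

(** If [s] and [s'] commuted, [e0] would be [N s (N s' z)], of rank at least [rk z], while it lies
    two below [z]. So they are adjacent, and the braid relation shows that [s] moves [e0] up, to the
    element [N s' z']. *)
Lemma samelow_hexagon z z' s s' : samelow z z' -> z <> z' -> dn s z -> dn s' z' ->
  N s z <> N s' z' ->
  let e0 := N s' (N s z) in
  [/\ s' = s.+1 \/ s = s'.+1, z = N s (N s' e0), z' = N s' (N s e0),
      N s' z' = N s e0 & cov e0 (N s e0) /\ cov e0 (N s' e0)].
Proof.
move=> sl ne d d' nc e0; have sm := dn_lt d; have sm' := dn_lt d'.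
have [_ rs'] := samelow_up (samelow_sym sl) (not_eq_sym ne) d'.
have c := dn_cov d; have c' := dn_cov d'.
have dc : dn s' (N s z) by apply: cov_dn_other d' _ nc; apply/sl.
have dd : dn s (N s' z') by apply: cov_dn_other d _ (not_eq_sym nc); apply/sl.
have ce : cov e0 (N s z) by apply: dn_cov.
have rz : rk z = rk z' by rewrite (cov_rk ((sl _).1 c)) (cov_rk c).
have adj : s' = s.+1 \/ s = s'.+1.
  case: (eqVneq s' s.+1) => [|/eqP h1]; first by left.
  case: (eqVneq s s'.+1) => [|/eqP h2]; first by right.
  move: (N_rk s (N s' z)); rewrite N_far // -/e0.
  by move: (cov_rk c) (cov_rk ce) rs' rz; clear; lia.
have E1 : N s e0 = N s' (N s (N s' z)) by rewrite /e0 N_br.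
have up : cov e0 (N s e0).
  have := cov_rk ce; have := cov_rk c; have := N_rk s (N s' z).
  have := N_rk s' (N s (N s' z)); rewrite -E1.
  by case: (NP s e0) => // [_ /cov_rk|->]; move: rs' rz; clear; lia.
have ced : cov e0 (N s' z').
  apply: lt_cov; last by move: (cov_rk ce) (cov_rk c) (cov_rk c') rz; clear; lia.
  by apply: N_cov => [|E]; [apply/sl|apply: nc; rewrite -E NK].
have E2 : N s e0 = N s' z'.
  case: (eqVneq (N s e0) (N s' z')) => // /eqP h.
  have /lt_rk := N_cov ced h.
  by move: (cov_rk up) (cov_rk ced) (cov_rk (dn_cov dd)); clear; lia.
split=> //; first by rewrite /e0 !NK.
  by rewrite E2 NK.
by split=> //; rewrite /e0 NK.
Qed.

(* Two descents of [z] in the situation of [samelow_hexagon] would yield a fixed-point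
   free involution sending [j] to [j + 2] and [j + 2] to [j]  with
   a descent pattern in between. *)
Lemma samelow_hexagon_uniq z z' r1 r2 s' : samelow z z' -> z <> z' ->
  dn r1 z -> dn r2 z -> dn s' z' -> N r1 z <> N s' z' -> N r2 z <> N s' z' ->
  r1 = r2.
Proof.
move=> sl ne d1 d2 d' n1 n2.
have [a1 e1 f1 _ _] := samelow_hexagon sl ne d1 d' n1.
have [a2 e2 f2 _ _] := samelow_hexagon sl ne d2 d' n2.
have [dy ry] := samelow_up (samelow_sym sl) (not_eq_sym ne) d'.
have rz : rk z = rk z' by have c := dn_cov d1; rewrite (cov_rk ((sl _).1 c)) (cov_rk c).
have g1 : z' = N r1 (N s' z).
  by rewrite f1 N_br ?(dn_lt d1) ?(dn_lt d') ?NK //; tauto.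
have g2 : z' = N r2 (N s' z).
  by rewrite f2 N_br ?(dn_lt d2) ?(dn_lt d') ?NK //; tauto.
set y := N s' z in dy ry g1 g2.
have D1 : dn r1 y.
  case: (NP r1 y) => // [_ /cov_rk|h]; first by rewrite -g1; move: ry rz; clear; lia.
  by rewrite h in g1; move: ry rz; rewrite g1; clear; lia.
case: (eqVneq r1 r2) => // ne12.
have [] := N_same D1 ne12; first by rewrite -g1.
have := dn_av dy => h h1 h2.
have := avK y r1; have := avK y r1.+1; rewrite h1 h2.
by case: a1 h1 h2 h => E1; case: a2 => E2; subst; move: ne12; lia.
Qed.

(** The common lower cover has crossing arcs at [s, s.+1] and at [s', s'.+1]. Undoing the first
    crossing does not undo the second, so [z] would have a crossing. *)
Lemma uncross_uniq z z' s s' : nocross z -> nocross z' -> dn s z -> dn s' z' ->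
  N s z = N s' z' -> s < s' -> False.
Proof.
move=> nc nc' d d' E ss.
have sm := dn_lt d; have sm' := dn_lt d'.
have [a1 b1] := nocross_dn nc d; have [a2 b2] := nocross_dn nc' d'.
have zE (x : nat) : av z x = sw s (av (N s' z') (sw s x)) by rewrite -avN // -E NK.
have c1 : av (N s' z') s.+1 = av z s by rewrite -E dnN_r.
have c2 : av (N s' z') s' = av z' s'.+1 by rewrite dnN_l.
have c3 : av (N s' z') s'.+1 = av z' s' by rewrite dnN_r.
case: (eqVneq s' s.+1) => [es|/eqP nes]; first by rewrite -es c2 in c1; lia.
have z1 : av z s' = av z' s'.+1 by rewrite zE (@swD s s') ?c2 ?swD; lia.
have z2 : av z s'.+1 = sw s (av z' s') by rewrite zE (@swD s s'.+1) ?c3; lia.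
case: (eqVneq (av z' s') s) => [e1|/eqP n1].
  rewrite e1 swl in z2; apply: (nc s.+1 s'); rewrite ?z1 -?z2 ?avK; lia.
case: (eqVneq (av z' s') s.+1) => [e2|/eqP n2].
  have := avK (N s' z') s'.+1; rewrite c3 e2 c1; lia.
rewrite swD in z2; try lia.
by apply: (nc (av z s'.+1) s'); rewrite ?avK ?z1 ?z2; lia.
Qed.

End Lower.

(** * Reversal of the positions *)

Section Flip.
Variable n : nat.
Local Notation m := (2 * n).
Local Notation T := (matching n).
Local Notation e := (e n).
Implicit Types (u v x y z : T).

(** The automorphism of the order that exchanges [N i] and [N (m - i.+2)]; it disposes of
    mirror-image cases. *)
Definition flip v : T := cj v (w0 m).

Lemma ap_w0 k : k < m -> ap (w0 m) k = m - k.+1.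
Proof. exact: av_e. Qed.

Lemma w0_sq : (w0 m * w0 m = 1)%g.
Proof. exact: (@val_sq _ e). Qed.

Lemma flipK : involutive flip.
Proof. by move=> v; rewrite /flip cjM w0_sq; apply: val_inj; rewrite /= conjg1. Qed.

Lemma av_flip v k : k < m -> av (flip v) (m - k.+1) = m - (av v k).+1.
Proof. by move=> km; rewrite -ap_w0 // av_cj ap_w0 // av_lt. Qed.

Lemma flipN i v : i.+1 < m -> flip (N i v) = N (m - i.+2) (flip v).
Proof.
move=> im; rewrite /flip /N !cjM; congr cj.
apply: apP => k km; rewrite !ap_mul.
have im' : (m - i.+2).+1 < m by lia.
rewrite !(ap_sg _ im) !(ap_sg _ im') !ap_w0 //; last by have := swP i k; lia.
have := swP i k; have := swP (m - i.+2) (m - k.+1); lia.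
Qed.

Lemma flip_dn i v : i.+1 < m -> dn (m - i.+2) (flip v) = dn i v.
Proof.
move=> im; rewrite /dn im; have -> : (m - i.+2).+1 = m - i.+1 by lia.
rewrite !av_flip; try lia.
have := av_lt v i; have := av_lt v i.+1; lia.
Qed.

Lemma flip_e : flip e = e.
Proof. by apply: val_inj; rewrite /= /conjg mulgA mulVg mul1g. Qed.

Lemma rk_flip v : rk (flip v) = rk v.
Proof.
elim/dn_ind: v => [|i v d IH]; first by rewrite flip_e.
have im := dn_lt d; rewrite (rk_dn d) -IH flipN // -rk_dn //.
by rewrite flip_dn.
Qed.

Lemma le_flip x y : le x y -> le (flip x) (flip y).
Proof.
rewrite /le => /bruhat_w0/bruhat_inv/bruhat_w0; rewrite /flip /=.
have wV : ((w0 m)^-1 = w0 m)%g by apply/eqP; rewrite eq_invg_mul w0_sq.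
by rewrite /Defs.pcomp !invMg !(valV x) !(valV y) wV /conjg wV !mulgA.
Qed.

Lemma cov_flip x y : cov (flip x) (flip y) = cov x y.
Proof.
rewrite /cov !rk_flip; congr (_ && _); apply/idP/idP; last exact: le_flip.
by move/le_flip; rewrite !flipK.
Qed.

End Flip.

(** * Classification of pairs with the same lower covers *)

Section Hexagon.
Variable n : nat.
Local Notation m := (2 * n).
Local Notation T := (matching n).
Local Notation e := (e n).
Implicit Types (u v x y z : T).

Lemma two_ups k v : cov v (N k v) -> cov v (N k.+1 v) ->
  [/\ k.+2 < m, av v k.+1 < av v k, av v k.+2 < av v k.+1 &
   forall x : nat, k <= x <= k.+2 -> av v x < k \/ k.+2 < av v x].
Proof.
move=> c1 c2; have [k1 _ /negbT d1] := cov_up c1; have [k2 _ /negbT d2] := cov_up c2.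
have nf i : i.+1 < m -> cov v (N i v) -> av v i <> i.+1.
  by move=> im c /eqP; rewrite -avNfix // => /eqP E; apply: (cov_neq c).
have h1 := nf _ k1 c1; have h2 := nf _ k2 c2.
have l1 := ndn_av d1 k1; have l2 := ndn_av d2 k2.
have f0 := @av_neq _ v k (ltnW k1); have f1 := @av_neq _ v _ k1.
have f2 := @av_neq _ v _ k2.
have g0 : av v k = k.+1 <-> k = av v k.+1 by exact: av_eq.
have g1 : av v k = k.+2 <-> k = av v k.+2 by exact: av_eq.
have g2 : av v k.+1 = k.+2 <-> k.+1 = av v k.+2 by exact: av_eq.
split=> // x /andP[kx xk].
have : x = k \/ x = k.+1 \/ x = k.+2 by lia.
case=> [->|[->|->]]; lia.
Qed.

Section Rotations.
Variables (k : nat) (v : T).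
Hypotheses (c1 : cov v (N k v)) (c2 : cov v (N k.+1 v)).

Let k2 : k.+2 < m. Proof. by case: (two_ups c1 c2). Qed.
Let k1 : k.+1 < m. Proof. exact: ltnW k2. Qed.

Let out (x : nat) : x < k \/ k.+2 < x -> sw k x = x /\ sw k.+1 x = x.
Proof. by move=> h; have := swP k x; have := swP k.+1 x; lia. Qed.

Let outv (x : nat) : k <= x <= k.+2 -> sw k (av v x) = av v x /\ sw k.+1 (av v x) = av v x.
Proof. by move=> h; apply: out; case: (two_ups c1 c2) => _ _ _; apply. Qed.

Let sw2 : sw k k.+2 = k.+2. Proof. by have := swP k k.+2; lia. Qed.
Let sw0 : sw k.+1 k = k. Proof. by have := swP k.+1 k; lia. Qed.

Lemma rot1 : [/\ av (N k v) k = av v k.+1, av (N k v) k.+1 = av v k &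
  av (N k v) k.+2 = av v k.+2].
Proof.
have [a0 b0] := @outv k ltac:(lia); have [a1 b1] := @outv k.+1 ltac:(lia).
have [a2 b2] := @outv k.+2 ltac:(lia).
by split; rewrite avN // ?swl ?swr ?sw2.
Qed.

(** The two tops of the hexagon over [v] permute the partners of [k], [k.+1], [k.+2] cyclically, in
    opposite directions. *)
Lemma rotA : [/\ av (N k (N k.+1 v)) k = av v k.+2,
  av (N k (N k.+1 v)) k.+1 = av v k & av (N k (N k.+1 v)) k.+2 = av v k.+1].
Proof.
have [a0 b0] := @outv k ltac:(lia); have [a1 b1] := @outv k.+1 ltac:(lia).
have [a2 b2] := @outv k.+2 ltac:(lia).
by split; rewrite !avN // ?swl ?swr ?sw2 ?swl ?sw0 ?swr ?b0 ?b1 ?b2.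
Qed.

Lemma rotB : [/\ av (N k.+1 (N k v)) k = av v k.+1,
  av (N k.+1 (N k v)) k.+1 = av v k.+2 & av (N k.+1 (N k v)) k.+2 = av v k].
Proof.
have [a0 b0] := @outv k ltac:(lia); have [a1 b1] := @outv k.+1 ltac:(lia).
have [a2 b2] := @outv k.+2 ltac:(lia).
by split; rewrite !avN // ?sw0 ?swl ?swr ?sw2 ?swl ?swr ?a0 ?a1 ?a2.
Qed.

Lemma rot_far (x : nat) : ~ (k <= x <= k.+2) -> ~ (k <= av v x <= k.+2) ->
  av (N k (N k.+1 v)) x = av v x /\ av (N k.+1 (N k v)) x = av v x.
Proof.
move=> hx hv; have [x1 x2] : sw k x = x /\ sw k.+1 x = x by apply: out; lia.
have [y1 y2] : sw k (av v x) = av v x /\ sw k.+1 (av v x) = av v x.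
  by apply: out; lia.
by rewrite !avN // !x1 !x2 ?y1 ?y2 ?x1 ?x2 ?y1 ?y2.
Qed.

End Rotations.

Lemma samelow_rk z z' : samelow z z' -> 2 <= rk z -> rk z' = rk z.
Proof.
move=> sl r; have [|c cz] := @e_coatom _ z; first by move=> ze; rewrite ze rk_e in r.
by rewrite (cov_rk cz) (cov_rk ((sl c).1 cz)).
Qed.

(** If [z'] is noncrossing, [av e0 k.+1] lies to the left of [k]. Then so does [av e0 k.+2], and in
    [z] the arcs ending at [k] and [k.+2] cross. *)
Lemma single_hexagon z z' k : k.+2 < m -> nocross z -> nocross z' -> forall e0,
  cov e0 (N k e0) -> cov e0 (N k.+1 e0) -> z = N k (N k.+1 e0) ->
  z' = N k.+1 (N k e0) -> False.
Proof.
move=> km nc nc' e0 c1 c2 ez ez'.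
have [_ l1 l2 h] := two_ups c1 c2.
have [b0 b1 b2] := rotB c1 c2; have [a0 a1 a2] := rotA c1 c2.
rewrite -ez in a0 a1 a2; rewrite -ez' in b0 b1 b2.
have h0 := h k; have h1 := h k.+1; have h2 := h k.+2.
have v0 : av z' (av e0 k.+1) = k by rewrite -b0 avK.
have v1 : av z' (av e0 k) = k.+2 by rewrite -b2 avK.
have w0 : av z (av e0 k.+1) = k.+2 by rewrite -a2 avK.
have w1 : av z (av e0 k.+2) = k by rewrite -a0 avK.
have n1 := nc' k k.+2; have n2 := nc' (av e0 k.+1) (av e0 k).
have n3 := nc (av e0 k.+2) (av e0 k.+1).
rewrite b0 b2 in n1; rewrite v0 v1 in n2; rewrite w0 w1 in n3.
by clear -n1 n2 n3 l1 l2 h0 h1 h2; lia.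
Qed.

Lemma samelow_single z z' s s' : samelow z z' -> z <> z' -> 2 <= rk z ->
  single z s -> single z' s' -> False.
Proof.
move=> sl ne r S S'; have r' := samelow_rk sl r.
have nc := single_nocross S r; have nc' : nocross z' by apply: single_nocross S' _; rewrite r'.
have [d hs] := S; have [d' hs'] := S'.
case: (eqVneq (N s z) (N s' z')) => [E|/eqP nE].
  case: (ltngtP s s') => ss.
  - exact: uncross_uniq nc nc' d d' E ss.
  - exact: uncross_uniq nc' nc d' d (esym E) ss.
  - by apply: ne; rewrite -(NK s z) E ss NK.
have [adj e1 e2 _ [u1 u2]] := samelow_hexagon sl ne d d' nE.
have dm := dn_lt d; have dm' := dn_lt d'.
move: e1 e2 u1 u2; move: (N s' (N s z)) => e0 e1 e2 u1 u2.
case: adj => E; rewrite E in e1 e2 u1 u2 dm dm'.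
  exact: single_hexagon nc nc' _ u1 u2 e1 e2.
exact: single_hexagon nc' nc _ u2 u1 e2 e1.
Qed.

(** The bottom [e0] of the hexagon of [k] and [k.+1] is shown to be [e]: the shared cover [N s z]
    ties the partners of [k.+1] and [k.+2] to [s], and the descents of [z] are too few for [e0] to
    have any. *)
Lemma samelow_pair z z' s k : samelow z z' -> z <> z' -> 2 <= rk z ->
  dn s z -> dn k z -> dn k.+1 z' -> N s z = N k.+1 z' -> N k z <> N k.+1 z' ->
  z = N k (N k.+1 e) /\ z' = N k.+1 (N k e).
Proof.
move=> sl ne r ds dk d' E nE.
have [_ ez ez' ec [u1 u2]] := samelow_hexagon sl ne dk d' nE.
move: ez ez' ec u1 u2; move: (N k.+1 (N k z)) => e0 ez ez' ec u1 u2.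
have [k2 l1 l2 out] := two_ups u1 u2.
have [a0 a1 a2] := rotA u1 u2; rewrite -ez in a0 a1 a2.
have [b0 b1 b2] := rotB u1 u2; rewrite -ez' in b0 b1 b2.
have [r0 r1 r2] := rot1 u1 u2; rewrite -ec -E in r0 r1 r2.
have sm := dn_lt ds.
have sk : s <> k by move=> es; apply: nE; rewrite es in E.
have o0 := out k ltac:(lia); have o1 := out k.+1 ltac:(lia).
have o2 := out k.+2 ltac:(lia).
(* Both [N s z] and [N k e0] are the common lower cover; compare them at [k] and [k.+2]. *)
have [g0 g1] : av e0 k.+2 = s /\ av e0 k.+1 = s.+1.
  rewrite avN // in r0; rewrite avN // in r2.
  have [[ek _]|[[ek _]|[ek [ek' E0]]]] := swP s k; first by case: sk.
    have E2 : sw s k.+2 = k.+2 by have := swP s k.+2; lia.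
    by rewrite E2 a2 in r2; have := swP s (av e0 k.+1); clear -r2 l2 ek o1 o2; lia.
  by rewrite E0 a0 in r0; have := swP s (av e0 k.+2); clear -r0 l2; lia.
rewrite g0 in l2 o2 a0 b1; rewrite g1 in l1 l2 o1 a2 b0.
have zs : av z s = k by rewrite -a0 avK.
have zs1 : av z s.+1 = k.+2 by rewrite -a2 avK.
have za : av z (av e0 k) = k.+1 by rewrite -a1 avK.
have zs' : av z' s = k.+1 by rewrite -b1 avK.
have zs1' : av z' s.+1 = k by rewrite -b0 avK.
have za' : av z' (av e0 k) = k.+2 by rewrite -b2 avK.
have e00 : av e0 (av e0 k) = k by rewrite avK.
have e01 : av e0 s.+1 = k.+1 by rewrite -g1 avK.
have e02 : av e0 s = k.+2 by rewrite -g0 avK.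
have dnz r2' : dn r2' z -> r2' = k \/ r2' = s.
  move=> d2; case: (eqVneq (N r2' z) (N k.+1 z')) => [E2|/eqP nE2].
    case: (eqVneq r2' s) => [|nrs]; [by right|left].
    have [] := N_same d2 nrs; first by rewrite E2.
    by move=> /av_eq ->.
  by left; apply: samelow_hexagon_uniq sl ne d2 dk d' nE2 nE.
have far (x : nat) : x <> k -> x <> k.+1 -> x <> k.+2 -> x <> s -> x <> s.+1 ->
   x <> av e0 k -> av z x = av e0 x /\ av z' x = av e0 x.
  move=> n1 n2 n3 n4 n5 n6; have q1 : ~ k <= x <= k.+2 by lia.
  have q2 : ~ k <= av e0 x <= k.+2.
    have := av_eq e0 x k; have := av_eq e0 x k.+1; have := av_eq e0 x k.+2.
    by rewrite g0 g1; lia.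
  by rewrite ez ez'; apply: rot_far q1 q2.
(* If [z'] has no lower cover from a different descent, it is noncrossing, and this forces a third
   descent [k.+2] on [z]. *)
case: (boolP [exists r' : 'I_m, dn r' z' && (N r' z' != N k.+1 z')]); last first.
  rewrite negb_exists => /forallP h.
  have S : single z' k.+1.
    split=> // r' dr'; have rm : r' < m by apply: ltnW; apply: dn_lt dr'.
    by have := h (Ordinal rm); rewrite dr' /= negbK => /eqP.
  have nc : nocross z' by apply: single_nocross S _; rewrite (samelow_rk sl).
  have n1 := nc k k.+2; rewrite b0 b2 in n1.
  have n2 := nc s.+1 (av e0 k); rewrite zs1' za' in n2.
  have am : av e0 k < m by rewrite av_lt; lia.
  have ak : k.+2 < av e0 k by clear -n1 n2 o0 o1 l1; lia.
  have sk' : s.+1 < k by clear -n1 o1 l1; lia.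
  suff lt : s.+1 < av z k.+3.
    have : dn k.+2 z by rewrite /dn a2 lt andbT; clear -am ak; lia.
    by case/dnz; clear -sk'; lia.
  case: (eqVneq k.+3 (av e0 k)) => [->|/eqP k3]; first by rewrite za; clear -sk'; lia.
  have [||||||E3 E3'] := @far k.+3; try by clear -sk' k3; lia.
  have n3 := nc (av z' k.+3) k.+2; rewrite avK b2 in n3.
  rewrite E3 -E3'; have n4 : av z' k.+3 <> s.+1 by move/av_eq; rewrite zs1'; clear; lia.
  by clear -n3 n4 k3 ak sk'; lia.
case/existsP=> r' /andP[dr' /eqP nr']; rewrite -E in nr'.
have [adj ey ey' _ _] := samelow_hexagon sl ne ds dr' (not_eq_sym nr').
have rm := dn_lt dr'.
have : z' = N s (N r' z) by rewrite ey' N_br ?NK //; tauto.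
move=> /(congr1 (fun x => av x s)); rewrite zs' !avN // swl => eqk.
(* A second hexagon, for the descents [s] of [z] and [r'] of [z'], locates the last partner. *)
have al : av e0 k = s.+2.
  case: adj => Er.
    rewrite Er swl in eqk; rewrite Er in rm; have n1 := @av_neq _ z s.+2 rm.
    have n2 : av z s.+2 = s -> s.+2 = k by move/av_eq->.
    have n3 : av z s.+2 = s.+1 -> s.+2 = k.+2 by move/av_eq->.
    have p1 := swP s.+1 (av z s.+2); have p2 := swP s (sw s.+1 (av z s.+2)).
    have n4 : av z s.+2 = k.+1 by clear -eqk n1 n2 n3 p1 p2 sk o2; lia.
    by rewrite -a1 -n4 avK.
  have E1 : sw r' s.+1 = s.+1 by have := swP r' s.+1; clear -Er; lia.
  rewrite E1 zs1 in eqk; have p1 := swP r' k.+2; have p2 := swP s (sw r' k.+2).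
  by clear -eqk p1 p2 Er o2 o1; lia.
rewrite al in far za za' e00 o0 l1 a1 b2.
(* [e0] pairs [k, k.+1, k.+2] with [s.+2, s.+1, s] and agrees with [z] elsewhere, where [z] has no
   descents but [k] and [s]. *)
suff ee : e0 = e by rewrite ez ez' ee.
apply: no_dn => j; apply/negP=> dj; have jm := dn_lt dj; have lt := dn_av dj.
have nd : j <> k -> j <> s -> av z j.+1 < av z j.
  by move=> jk js; apply: ndn_av => //; apply/negP=> /dnz; lia.
pose D (x : nat) := (x = k /\ av e0 x = s.+2 /\ av z x = s) \/
  (x = k.+1 /\ av e0 x = s.+1 /\ av z x = s.+2) \/
  (x = k.+2 /\ av e0 x = s /\ av z x = s.+1) \/
  (x = s /\ av e0 x = k.+2 /\ av z x = k) \/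
  (x = s.+1 /\ av e0 x = k.+1 /\ av z x = k.+2) \/
  (x = s.+2 /\ av e0 x = k /\ av z x = k.+1) \/
  (x <> k /\ x <> k.+1 /\ x <> k.+2 /\ x <> s /\ x <> s.+1 /\ x <> s.+2 /\
   av z x = av e0 x /\
   av e0 x <> k /\ av e0 x <> k.+1 /\ av e0 x <> k.+2 /\ av e0 x <> s /\
   av e0 x <> s.+1 /\ av e0 x <> s.+2).
have DP (x : nat) : D x.
  rewrite /D; case: (eqVneq x k) => [->|/eqP x1]; first by left.
  case: (eqVneq x k.+1) => [->|/eqP x2]; first by right; left.
  case: (eqVneq x k.+2) => [->|/eqP x3]; first by do 2 right; left.
  case: (eqVneq x s) => [->|/eqP x4]; first by do 3 right; left.
  case: (eqVneq x s.+1) => [->|/eqP x5]; first by do 4 right; left.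
  case: (eqVneq x s.+2) => [->|/eqP x6]; first by do 5 right; left.
  do 6 right; have [E3 _] := far _ x1 x2 x3 x4 x5 x6.
  by do ! split=> //; move/av_eq; rewrite ?al ?g0 ?g1 ?e00 ?e01 ?e02.
have := DP j; have := DP j.+1; rewrite /D => {DP} P1 P2.
case: P2 => [|[|[|[|[|[|]]]]]] P2; case: P1 => [|[|[|[|[|[|]]]]]] P1;
  by clear -P1 P2 lt nd o2; lia.
Qed.

Lemma samelow_flip z z' : samelow z z' -> samelow (flip z) (flip z').
Proof.
move=> sl b; split; rewrite -{1}[b]flipK cov_flip => /sl;
  by rewrite -cov_flip flipK.
Qed.

Definition hexagon_top z z' k k' := [/\ k' = k.+1 \/ k = k'.+1, k.+1 < m, k'.+1 < m,
  z = N k (N k' e) & z' = N k' (N k e)].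

(** The remaining case [k = s'.+1] is the mirror image of [samelow_pair]. *)
Lemma samelow_pair_sym z z' s k s' : samelow z z' -> z <> z' -> 2 <= rk z ->
  dn s z -> dn k z -> dn s' z' -> N s z = N s' z' -> N k z <> N s' z' ->
  hexagon_top z z' k s'.
Proof.
move=> sl ne r ds dk d' E nE; have sm := dn_lt ds; have km := dn_lt dk.
have sm' := dn_lt d'.
have [adj _ _ _ _] := samelow_hexagon sl ne dk d' nE.
case: adj => Es; first by subst s'; have [-> ->] := samelow_pair sl ne r ds dk d' E nE; split=> //; left.
pose i j := m - j.+2.
have ik : i s' = (i k).+1 by rewrite /i; lia.
have N0 : flip z <> flip z' by move/(can_inj (@flipK n)).
have H := @samelow_pair (flip z) (flip z') (i s) (i k) (samelow_flip sl) N0.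
rewrite rk_flip !flip_dn // -ik flip_dn // -!flipN // E in H.
have [|E1 E2] := H r ds dk d' erefl; first by move/(can_inj (@flipK n)).
rewrite -[z]flipK -[z']flipK E1 E2.
have K j : j.+1 < m -> m - (i j).+2 = j by rewrite /i; lia.
have L j : j.+1 < m -> (i j).+1 < m by rewrite /i; lia.
by split; rewrite ?flipN ?K ?flip_e ?L //; right.
Qed.

(** By [samelow_single], one of the two has descents with different effects. By
    [samelow_hexagon_uniq] these cannot both avoid a given lower cover of the other element, so one
    of them hits it and [samelow_pair_sym] applies. *)
Lemma samelow_hexagon_top z z' : samelow z z' -> z <> z' -> 2 <= rk z ->
  exists k k', hexagon_top z z' k k'.
Proof.
move=> sl ne r; have r' := samelow_rk sl r.
have [|s ds] := @exists_dn _ z; first by move=> ze; rewrite ze rk_e in r.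
have [|s' ds'] := @exists_dn _ z'; first by move=> ze; rewrite ze rk_e in r'; rewrite -r' in r.
have H x y p q : samelow x y -> x <> y -> 2 <= rk x -> dn p x -> dn q y ->
    ~ single x p -> exists k, hexagon_top x y k q.
  move=> sl' ne' rx dp dq nS.
  case: (boolP [exists l : 'I_m, dn l x && (N l x != N p x)]); last first.
    rewrite negb_exists => /forallP h; case: nS; split=> // l dl.
    have lm : l < m by apply: ltnW; apply: dn_lt dl.
    by have := h (Ordinal lm); rewrite dl /= negbK => /eqP.
  case/existsP=> l /andP[dl /eqP nl].
  case: (eqVneq (N p x) (N q y)) => [E|/eqP nE].
    exists l; apply: (samelow_pair_sym sl' ne' rx dp dl dq E).
    by rewrite -E.
  case: (eqVneq (N l x) (N q y)) => [E|/eqP nE'].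
    by exists p; exact: (samelow_pair_sym sl' ne' rx dl dp dq E nE).
  by case: nl; rewrite (samelow_hexagon_uniq sl' ne' dl dp dq nE' nE).
case: (boolP [forall l : 'I_m, dn l z ==> (N l z == N s z)]) => [/forallP h|/negP h].
  have S : single z s.
    split=> // l dl; have lm : l < m by apply: ltnW; apply: dn_lt dl.
    by have := h (Ordinal lm); rewrite dl /= => /eqP.
  have nS' : ~ single z' s' by move=> S'; apply: samelow_single sl ne r S S'.
  have [|k [a b c f g]] := H z' z s' s (samelow_sym sl) (not_eq_sym ne) _ ds' ds nS'.
    by rewrite r'.
  by exists s, k; split=> //; tauto.
have nS : ~ single z s.
  case=> _ hs; apply: h; apply/forallP=> l; apply/implyP=> dl.
  by apply/eqP/hs.
by have [k K] := H z z' s s' sl ne r ds ds' nS; exists k, s'.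
Qed.

End Hexagon.

(** * Rigidity of special partial matchings *)

Section Rigid.
Variable n : nat.
Local Notation m := (2 * n).
Local Notation T := (matching n).
Local Notation e := (e n).
Implicit Types (u v x y z b : T) (M : T -> T).

Lemma N_up i x y : cov x y -> cov x (N i x) -> N i x <> y ->
  cov y (N i y) /\ cov (N i x) (N i y).
Proof.
move=> xy ux ne; have l := N_cov xy ne; have r := lt_rk l.
move: (cov_rk xy) (cov_rk ux) => r1 r2.
case: (NP i y) r l => [_ /cov_rk r3|_ c _|->] r l; [lia| |lia].
by split=> //; apply: lt_cov => //; move: (cov_rk c) r1 r2; clear; lia.
Qed.

Lemma N_lc i y b : cov y (N i y) -> cov b (N i y) -> b <> y ->
  cov (N i b) b /\ cov (N i b) y.
Proof.
move=> uy cb nb; have [im d _] := cov_up uy.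
by apply: (spm_lc (N_spm d)) => //; apply: cov_le.
Qed.

(** [z] is noncrossing. At its descent it must have two short arcs side by side, since a longer arc
    leads to a second lower cover; two uncoverings then reach [e]. *)
Lemma single_cover_rk z : 2 <= rk z -> (forall b b', cov b z -> cov b' z -> b = b') ->
  rk z = 2.
Proof.
move=> r2 uq; have [|s d] := @exists_dn _ z; first by move=> ze; rewrite ze rk_e in r2.
have S : single z s by split=> // r dr; apply: uq; apply: dn_cov.
have nc := single_nocross S r2; have [as_ bs] := nocross_dn nc d.
move: d S as_ bs; case: s => [|p] d S as_ bs; first by [].
set s := p.+1 in d S as_ bs *.
have sm := dn_lt d; have cz := dn_cov d.
set a := av z s in as_; set b := av z s.+1 in bs.
have za : av z a = s by rewrite /a avK.
have zb : av z b = s.+1 by rewrite /b avK.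
have bm : b < m by rewrite /b av_lt.
pose c := N s z.
have cl : av c s = b by rewrite /c dnN_l.
have cr : av c s.+1 = a by rewrite /c dnN_r.
(* Descend from [c] by [q] and ascend by [s]: the result is covered by [N s c = z] and differs from
   [c]. *)
have key q : dn q c -> ~~ dn s (N q c) -> av (N q c) s <> s.+1 -> False.
  move=> dp nd nf; have cp := dn_cov dp.
  have nx : N s (N q c) != N q c by rewrite avNfix //; apply/eqP.
  have up := up_cov sm nx nd.
  have ne : N s (N q c) <> c.
    move=> E; have := cov_rk cp; have := cov_rk cz; rewrite -/c.
    have -> : N q c = z by rewrite -(NK s (N q c)) E /c NK.
    by clear; lia.
  have [_ cov2] := N_up cp up ne; rewrite {2}/c NK in cov2.
  by apply: ne; apply: uq.
have cE (x : nat) : x <> s -> x <> s.+1 -> av z x <> s -> av z x <> s.+1 -> av c x = av z x.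
  by move=> /eqP x1 /eqP x2 /eqP x3 /eqP x4; rewrite avN // (swD x1 x2) swD.
have ea : a.+1 = s.
  case: (eqVneq a.+1 s) => // /eqP nas; exfalso.
  have n1 := nc a p; rewrite za in n1.
  have n2 := nc (av z p) a; rewrite avK za in n2.
  have n3 : av z p <> p.+1 by move/av_eq; clear -nas; rewrite -/a; lia.
  have n4 : av z p <> p.+2 by move/av_eq; rewrite -/b; clear -bs; lia.
  have n5 : av z p <> a by move/av_eq; rewrite za; clear; lia.
  have n6 : av z p <> p by apply: av_neq; clear -sm; lia.
  have lt : a < av z p < p.+1 by clear -n1 n2 n3 n4 n5 n6 as_ nas; lia.
  have cp : av c p = av z p by apply: cE => //; clear; lia.
  have dp : dn p c by rewrite /dn cp cl; clear -sm lt bs; lia.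
  have x1 : av (N p c) p.+1 = av z p by rewrite dnN_r.
  have x2 : av (N p c) p.+2 = a.
    rewrite avN ?(dn_lt dp) //; have -> : sw p p.+2 = p.+2 by have := swP p p.+2; clear; lia.
    by rewrite cr; have := swP p a; clear -as_ nas; lia.
  apply: (key p) => //; first by rewrite /dn x1 x2; clear -lt; lia.
  by rewrite x1.
have eb : b = s.+2.
  case: (eqVneq b s.+2) => // /eqP nbs; exfalso.
  have n1 := nc s.+1 s.+2; rewrite -/b in n1.
  have n2 := nc (av z s.+2) s.+1; rewrite avK -/b in n2.
  have n3 : av z s.+2 <> s by move/av_eq; rewrite -/a; clear -as_; lia.
  have n4 : av z s.+2 <> s.+1 by move/av_eq; rewrite -/b; clear -nbs; lia.
  have n5 : av z s.+2 <> b by move/av_eq; rewrite zb; clear; lia.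
  have lt : s.+1 < av z s.+2 < b by clear -n1 n2 n3 n4 n5 bs nbs; lia.
  have cp : av c s.+2 = av z s.+2 by apply: cE => //; clear; lia.
  have dp : dn s.+1 c by rewrite /dn cp cr; clear -bm lt as_ bs nbs; lia.
  have x1 : av (N s.+1 c) s.+1 = av z s.+2 by rewrite dnN_l.
  have x2 : av (N s.+1 c) s = b.
    rewrite avN ?(dn_lt dp) //; have -> : sw s.+1 s = s by have := swP s.+1 s; clear; lia.
    by rewrite cl; have := swP s.+1 b; clear -bs nbs; lia.
  apply: (key s.+1) => //; first by rewrite /dn x1 x2; clear -lt; lia.
  by rewrite x2; clear -bs; lia.
have ap : a = p by case: ea.
have zp : av z p = p.+1 by rewrite -ap za.
have zs1 : av z p.+2 = p.+3 by [].
have zs2 : av z p.+3 = p.+2 by rewrite -zs1 avK.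
have zs : av z p.+1 = p by rewrite -zp avK.
have only j : dn j z -> j = s.
  move=> dj; case: (eqVneq j s) => // js; have [_ hS] := S.
  have [/av_eq] := N_same dj js (hS _ dj); rewrite zs => E _.
  by have := dn_av dj; rewrite E zp zs; clear; lia.
have cp : av c p = p.+2.
  by rewrite avN // (_ : sw s p = p) ?zp ?swl // swD //; clear; lia.
have dp : dn p c by rewrite /dn cl eb cp; clear -sm; lia.
suff ee : N p c = e.
  have : rk (N p c) = 0 by rewrite ee rk_e.
  by move: (cov_rk cz) (cov_rk (dn_cov dp)) r2; rewrite -/c; clear; lia.
have e0 : av (N p c) p = p.+3 by rewrite dnN_l // cl eb.
have e1 : av (N p c) p.+1 = p.+2 by rewrite dnN_r.
have e2 : av (N p c) p.+2 = p.+1 by rewrite -e1 avK.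
have e3 : av (N p c) p.+3 = p by rewrite -e0 avK.
have far (x : nat) : x < p \/ p.+3 < x -> av (N p c) x = av z x /\ (av z x < p \/ p.+3 < av z x).
  move=> hx; have q : av z x < p \/ p.+3 < av z x.
    have := av_eq z x p; have := av_eq z x p.+1; have := av_eq z x p.+2.
    by have := av_eq z x p.+3; rewrite zp zs zs1 zs2; clear -hx; lia.
  split=> //; have f : av c x = av z x by apply: cE; clear -hx q; lia.
  rewrite avN ?(dn_lt dp) // (_ : sw p x = x) ?f; last by have := swP p x; clear -hx; lia.
  by have := swP p (av z x); clear -q; lia.
apply: no_dn => j; apply/negP=> dj; have jm := dn_lt dj; have := dn_av dj.
have nd : j <> s -> av z j.+1 < av z j.
  by move=> js; apply: ndn_av => //; apply/negP=> /only.
have tri (x : nat) : x = p \/ x = p.+1 \/ x = p.+2 \/ x = p.+3 \/ (x < p \/ p.+3 < x) by lia.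
move: nd; case: (tri j) => [->|[->|[->|[->|hj]]]]; rewrite ?e0 ?e1 ?e2 ?e3; try by clear; lia.
  have [-> q] : av (N p c) p.+4 = av z p.+4 /\ (av z p.+4 < p \/ p.+3 < av z p.+4).
    by apply: far; clear; lia.
  by rewrite zs2; clear -q; lia.
have [-> q] := far j hj.
case: (tri j.+1) => [ej|[ej|[ej|[ej|/far[-> _]]]]]; try by clear -hj ej; lia.
  by rewrite ej e0 zp; clear -q ej hj; lia.
by clear -hj; lia.
Qed.

Lemma rk_hexagon_top z z' k k' : hexagon_top z z' k k' -> rk z <= 2.
Proof.
case=> _ _ _ -> _; have := N_rk k (N k' e); have := N_rk k' e.
by rewrite rk_e; clear; lia.
Qed.

(* The elements covered by [M y] are [y] and the [M x] for the [M]-up elements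
   [x] covered by [y], so [samelow_hexagon_top] and [single_cover_rk] force [M] and [N j] to commute
   as soon as they do so at the bottom. *)
Lemma spm_commute M w j : spm M w ->
  (le (N j e) w -> M (N j e) = N j (M e)) ->
  forall y, le y w -> le (N j y) w -> M (N j y) = N j (M y).
Proof.
move=> sM base y; have [k] := ubnP (rk y); elim: k y => // k IH y hk yw nyw.
case: (eqVneq y e) => [ye|/eqP ye]; first by rewrite ye in nyw *; exact: base.
have ry : 0 < rk y by case: posnP => // /rk0.
have NKx x : N j (N j x) = x by exact: NK.
have bel x : cov x y -> le x w by move=> c; apply: le_trans (cov_le c) yw.
have IH' x : cov x y -> le (N j x) w -> M (N j x) = N j (M x).
  by move=> c h; apply: IH => //; [move: (cov_rk c) hk; clear; lia|exact: bel].
have Nle x : cov x y -> le (N j x) w.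
  move=> c; case: (eqVneq (N j x) y) => [-> //|/eqP ne].
  exact: le_trans (lt_le (N_cov c ne)) nyw.
case: (spm_case sM yw) => [cd|fy|up].
- have := IH' _ cd (Nle _ cd); rewrite (spmK sM yw) => E.
  by rewrite -E (spmK sM (Nle _ cd)).
- case: (NP j y) => [_ cn|im cn dn'|fn]; last by rewrite fn fy fn.
    by have := IH' _ cn; rewrite NKx => /(_ yw) ->; rewrite NKx.
  case: (spm_case sM nyw) => [cd|->|cu]; last 2 first.
  + by rewrite fy.
  (* Otherwise [M (N j y)] would cover [N j y] only, although its rank is at least 3. *)
  + have [_] : 2 <= rk (M (N j y)) /\ rk (M (N j y)) <> 2.
      by move: (cov_rk cn) (cov_rk cu) ry; clear; lia.
    case; apply: single_cover_rk; first by move: (cov_rk cn) (cov_rk cu) ry; clear; lia.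
    have uq b : cov b (M (N j y)) -> b = N j y.
      move=> cb; case: (eqVneq b (N j y)) => // /eqP nb; exfalso.
      have [c1 c2] := spm_lc sM nyw cu cb nb.
      have bw : le b w := le_trans (cov_le cb) (spm_le sM nyw).
      have nx : M b <> y by move=> E; apply: (cov_neq c1); rewrite E -fy -E (spmK sM bw).
      have [c3 c4] := N_lc cn c2 nx.
      have := IH' _ c4; rewrite NKx (spmK sM bw) => /(_ (le_trans (cov_le c1) bw)) E.
      have ne : M (N j (M b)) <> y.
        by move=> E'; apply: (cov_neq c4); rewrite -fy -E' (spmK sM (bel _ c4)).
      have := lt_rk (spm_cov sM yw c4 ne); rewrite fy.
      have := N_rk j (M (N j (M b))); rewrite -E.
      by move: (cov_rk c1) (cov_rk c3) (cov_rk c4); clear; lia.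
    by move=> b b' /uq -> /uq ->.
  + exfalso; have ne : M y <> N j y by rewrite fy; apply: cov_neq.
    by have := lt_rk (spm_cov sM nyw cn ne); rewrite fy; move: (cov_rk cn) (cov_rk cd); clear; lia.
- case: (NP j y) => [_ cn|im cn dn'|fn].
    by have := IH' _ cn; rewrite NKx => /(_ yw) ->; rewrite NKx.
  case: (eqVneq (M y) (N j y)) => [E|/eqP ne]; first by rewrite -E (spmK sM yw) E NKx.
  have [cz cz1] := spm_up sM nyw cn up ne.
  have [cz' cz'1] := N_up up cn (not_eq_sym ne).
  case: (eqVneq (M (N j y)) (N j (M y))) => // /eqP nz; exfalso.
  (* Apart from [N j y] and [M y], a lower cover [b] on either side comes from an element covered by
     [y], and there [M] and [N j] commute by induction. *)
  have sl : samelow (M (N j y)) (N j (M y)).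
    move=> b; split=> cb.
    + case: (eqVneq b (N j y)) => [-> //|/eqP nb].
      have bw : le b w := le_trans (cov_le cb) (spm_le sM nyw).
      have [c1 c2] := spm_lc sM nyw cz cb nb.
      case: (eqVneq (M b) y) => [E|/eqP nx].
        by rewrite -(spmK sM bw) E.
      have [c3 c4] := N_lc cn c2 nx.
      have := IH' _ c4; rewrite NKx (spmK sM bw) => /(_ (le_trans (cov_le c1) bw)) E.
      set x' := N j (M b) in c3 c4 E.
      have ux : cov x' (M x').
        have := N_rk j (M x'); rewrite -E; move: (cov_rk c1) (cov_rk c3).
        case: (spm_case sM (bel _ c4)) => // [/cov_rk|->]; first by clear; lia.
        by move: (cov_rk c4) => _; clear; lia.
      case: (eqVneq (M x') y) => [E'|/eqP nx']; first by case: nb; rewrite E E'.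
      have [_ c5] := spm_up sM yw c4 ux nx'.
      case: (eqVneq b (M y)) => [->//|/eqP nb'].
      rewrite E; apply: (N_up c5 _ _).2; last by rewrite -E.
      rewrite -E /cov -[b in le _ b]NKx; apply/andP; split; last first.
        by apply/eqP; move: (cov_rk c1) (cov_rk c3) (cov_rk ux); clear; lia.
      rewrite NKx E; case: (NP j (M x')) => [_ /cov_rk|_ /cov_le //|->]; last exact: le_refl.
      by rewrite -E; move: (cov_rk c1) (cov_rk c3) (cov_rk ux); clear; lia.
    + case: (eqVneq b (M y)) => [-> //|/eqP nb].
      have [c1 c2] := N_lc cz' cb nb.
      case: (eqVneq (N j b) y) => [E|/eqP nx]; first by rewrite -(NKx b) E.
      have [c3 c4] := spm_lc sM yw up c2 nx.
      have xw : le (N j b) w := le_trans (cov_le c2) (spm_le sM yw).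
      set x' := M (N j b) in c3 c4.
      have Nw := Nle _ c4.
      have := IH' _ c4 Nw; rewrite {2}/x' (spmK sM xw) NKx => E.
      have r1 := cov_rk c1; have r3 := cov_rk c3; have r4 := cov_rk c4.
      have cb' : cov (N j x') b.
        move: (N_rk j x'); rewrite -E; case: (spm_case sM Nw) => [/cov_rk|E'|//].
          by move: r1 r3; rewrite E; clear; lia.
        by rewrite -E' E; move: r1 r3; clear; lia.
      have ux : cov x' (N j x').
        by case: (NP j x') (cov_rk cb') => [_ /cov_rk| //|->]; move: r1 r3; clear; lia.
      case: (eqVneq (N j x') y) => [E'|/eqP nx']; first by case: nb; rewrite -E E'.
      have [_ c5] := N_up c4 ux nx'.
      case: (eqVneq b (N j y)) => [->//|/eqP nb'].
      by rewrite -E in cb' nb' *; exact: (spm_up sM nyw c5 cb' nb').2.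
  have rz : 2 < rk (M (N j y)) by move: (cov_rk cz) (cov_rk cn) ry; clear; lia.
  have [k1 [k2 /rk_hexagon_top]] := samelow_hexagon_top sl nz (ltnW rz); by move: rz; clear; lia.
case: (NP j (M y)) => [_ cd|im cu du|->]; last 2 first.
- have [_] : 2 <= rk (N j (M y)) /\ rk (N j (M y)) <> 2.
    by move: (cov_rk up) (cov_rk cu) ry; clear; lia.
  case; apply: single_cover_rk; first by move: (cov_rk up) (cov_rk cu) ry; clear; lia.
  have uq b : cov b (N j (M y)) -> b = M y.
    move=> cb; case: (eqVneq b (M y)) => // /eqP nb; exfalso.
    have [c1 c2] := N_lc cu cb nb.
    have nx : N j b <> y by move=> E; apply: (cov_neq c1); rewrite E -fn -E NKx.
    have [c3 c4] := spm_lc sM yw up c2 nx.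
    have xw : le (N j b) w := le_trans (cov_le c2) (spm_le sM yw).
    have := IH' _ c4 (Nle _ c4); rewrite (spmK sM xw) NKx => E.
    have ne : N j (M (N j b)) <> y by move=> E'; apply: (cov_neq c4); rewrite -fn -E' NKx.
    have := lt_rk (N_cov c4 ne); rewrite fn.
    have := spm_case sM (Nle _ c4); rewrite E.
    case=> [/cov_rk|/(congr1 (@rk n))|/cov_rk];
      by move: (cov_rk c1) (cov_rk c3) (cov_rk c4); clear; lia.
  by move=> b b' /uq -> /uq ->.
- by rewrite fn.
exfalso; have nb : N j (M y) <> y.
  by move=> E; apply: (cov_neq up); rewrite -(NKx (M y)) E fn.
have [c1 c2] := spm_lc sM yw up cd nb.
have bw : le (N j (M y)) w := le_trans (cov_le cd) (spm_le sM yw).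
have := IH' _ c2 (Nle _ c2); rewrite (spmK sM bw) NKx => /(spm_inj sM (Nle _ c2) yw) E.
by apply: (cov_neq c2); rewrite -[LHS]NKx E fn.
Qed.

(** If [M] and [N j] agree on what [y] covers, then [M y] and [N j y] have the same lower covers.
    Atoms are assumed separately, since their images may have rank 2, where lower covers do not
    determine an element. *)
Lemma spm_rigid M w j y0 : spm M w -> le y0 w -> M e = N j e ->
  (forall y, le y y0 -> rk y = 1 -> M y = N j y) ->
  forall y, le y y0 -> M y = N j y.
Proof.
move=> sM y0w Me base y; have [k] := ubnP (rk y); elim: k y => // k IH y hk yy0.
case: (posnP (rk y)) => [/rk0 -> //|ry].
case: (eqVneq (rk y) 1) => [|/eqP r1]; first exact: base.
have yw := le_trans yy0 y0w.
have NKx x : N j (N j x) = x by exact: NK.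
have bel x : cov x y -> le x w by move=> c; apply: le_trans (cov_le c) yw.
have IH' x : cov x y -> M x = N j x.
  move=> c; apply: IH; last exact: le_trans (cov_le c) yy0.
  by move: (cov_rk c) hk; clear; lia.
case: (spm_case sM yw) => [cd|fy|up].
- by have := IH' _ cd; rewrite (spmK sM yw) => E; rewrite [in RHS]E NKx.
- case: (NP j y) => [_ cn|im cn dn'|fn]; last by rewrite fn.
    by have := IH' _ cn; rewrite NKx => E; rewrite -{1}E (spmK sM (bel _ cn)).
  have [_] : 2 <= rk (N j y) /\ rk (N j y) <> 2.
    by move: (cov_rk cn) ry r1; clear; lia.
  case; apply: single_cover_rk; first by move: (cov_rk cn) ry; clear; lia.
  have uq b : cov b (N j y) -> b = y.
    move=> cb; case: (eqVneq b y) => // /eqP nb; exfalso.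
    have [c1 c2] := N_lc cn cb nb; have E := IH' _ c2; rewrite NKx in E.
    have ne : M (N j b) <> y by rewrite E.
    by have := lt_rk (spm_cov sM yw c2 ne); rewrite E fy; move: (cov_rk c1) (cov_rk c2); clear; lia.
  by move=> b b' /uq -> /uq ->.
- case: (NP j y) => [_ cn|im cn dn'|fn].
  + by have := IH' _ cn; rewrite NKx => E; rewrite -{1}E (spmK sM (bel _ cn)).
  + case: (eqVneq (M y) (N j y)) => // /eqP nz; exfalso.
    have sl : samelow (M y) (N j y).
      move=> b; split=> cb; case: (eqVneq b y) => [-> //|/eqP nb].
      * have [c1 c2] := spm_lc sM yw up cb nb.
        have bw : le b w := le_trans (cov_le cb) (spm_le sM yw).
        have E := IH' _ c2; rewrite (spmK sM bw) in E.
        move: (M b) c1 c2 E => x c1 c2 E.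
        by rewrite E in c1 nb *; exact: (N_up c2 c1 nb).2.
      * have [c1 c2] := N_lc cn cb nb; have E := IH' _ c2; rewrite NKx in E.
        move: (N j b) c1 c2 E => x c1 c2 E.
        by rewrite -E in c1 nb *; exact: (spm_up sM yw c2 c1 nb).2.
    have rz : 2 < rk (M y) by move: (cov_rk up) ry r1; clear; lia.
    have [k1 [k2 /rk_hexagon_top]] := samelow_hexagon_top sl nz (ltnW rz); by move: rz; clear; lia.
  + have [_] : 2 <= rk (M y) /\ rk (M y) <> 2.
      by move: (cov_rk up) ry r1; clear; lia.
    case; apply: single_cover_rk; first by move: (cov_rk up) ry; clear; lia.
    have uq b : cov b (M y) -> b = y.
      move=> cb; case: (eqVneq b y) => // /eqP nb; exfalso.
      have bw : le b w := le_trans (cov_le cb) (spm_le sM yw).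
      have [c1 c2] := spm_lc sM yw up cb nb; have E := IH' _ c2.
      rewrite (spmK sM bw) in E.
      have ne : N j (M b) <> y by rewrite -E.
      by have := lt_rk (N_cov c2 ne); rewrite -E fn; move: (cov_rk c1) (cov_rk c2); clear; lia.
    by move=> b b' /uq -> /uq ->.
Qed.

End Rigid.

(** * Atoms and their two labels *)

Section Atoms.
Variable n : nat.
Local Notation m := (2 * n).
Local Notation T := (matching n).
Local Notation e := (e n).
Implicit Types (u v x y z : T) (M : T -> T).

Lemma N_e_flip i : i.+1 < m -> N i e = N (m - i.+2) e.
Proof.
move=> im; apply: avP => k km; have im' : (m - i.+2).+1 < m by lia.
rewrite !avN // !av_e; last 2 first.
- by have := swP (m - i.+2) k; lia.
- by have := swP i k; lia.
have := swP i k; have := swP (m - i.+2) k.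
have := swP i (m - (sw i k).+1); have := swP (m - i.+2) (m - (sw (m - i.+2) k).+1).
lia.
Qed.

Lemma N_mid : N n.-1 e = e.
Proof.
case: (ltnP n.-1.+1 m) => h; last exact: N_out.
by apply/eqP; rewrite avNfix // av_e; lia.
Qed.

Lemma atom_cov i : i.+1 < n -> cov e (N i e).
Proof.
move=> h; have im : i.+1 < m by lia.
by apply: up_cov => //; [rewrite avNfix // av_e; lia|exact: no_dn_e].
Qed.

Lemma atom_rep y : rk y = 1 -> exists2 l, l.+1 < n & y = N l e.
Proof.
move=> r; have [|l d] := @exists_dn _ y; first by move=> E; rewrite E rk_e in r.
have lm := dn_lt d; have yE : y = N l e.
  by rewrite -(NK l y) (rk0 (v := N l y)) //; have := rk_dn d; rewrite r => -[].
case: (ltngtP l.+1 n) => ln; first by exists l.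
  by exists (m - l.+2); [lia|rewrite yE -N_e_flip].
by move: r; rewrite yE -[l]/(l.+1.-1) ln N_mid rk_e.
Qed.

Lemma atom_eq k i : i.+1 < n -> k.+1 < m -> N k e = N i e -> k = i \/ k = m - i.+2.
Proof.
move=> h km E; case: (eqVneq k i) => [|ki]; [by left|right].
have [im d _] := cov_up (atom_cov h).
have [] := @N_same _ i k (N i e) d; [by rewrite eq_sym|by rewrite NK -E NK|].
by move=> <- _; rewrite -(dnN_r d) NK av_e.
Qed.

Lemma atom_inj k i : i.+1 < n -> k.+1 < n -> N k e = N i e -> k = i.
Proof. by move=> h h' E; have := @atom_eq k i h _ E; lia. Qed.

Lemma rk_atom i : i.+1 < n -> rk (N i e) = 1.
Proof. by move/atom_cov/cov_rk; rewrite rk_e. Qed.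

(** [M y] and [N i y] both cover exactly [y] and [N i e], so if they differ they are the two tops of
    a hexagon. As [N l (N i e) = N (m - i.+2) (N l e)], in the second case [M] acts by the other
    label of [M e]. *)
Lemma atom_case M w i l : spm M w -> i.+1 < n -> M e = N i e -> l.+1 < n ->
  le (N l e) w -> M (N l e) = N i (N l e) \/
  (l = i.+1 \/ i = l.+1) /\ M (N l e) = N l (N i e).
Proof.
move=> sM hi Me hl lw; set y := N l e.
case: (eqVneq l i) => [E|/eqP li].
  by left; rewrite /y E NK -Me (spmK sM (e_min w)).
case: (eqVneq (M y) (N i y)) => [|/eqP nz]; [by left|right].
have cl := atom_cov hl; have ci := atom_cov hi.
have ne : N i e <> y by move/esym/(atom_inj hi hl).
have [cz cz1] : cov y (M y) /\ cov (N i e) (M y).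
  by rewrite -Me; apply: (spm_up sM lw cl); rewrite Me.
have [cz' cz'1] := N_up cl ci ne.
have low b : cov b (M y) -> b = y \/ b = N i e.
  move=> cb; case: (eqVneq b y) => [|/eqP nb]; [by left|right].
  have [c1 c2] := spm_lc sM lw cz cb nb.
  have bw : le b w := le_trans (cov_le cb) (spm_le sM lw).
  rewrite -(spmK sM bw) -Me (@rk0 _ (M b)) //.
  by have := cov_rk c2; rewrite rk_atom // => -[].
have sl : samelow (M y) (N i y).
  move=> b; split=> [/low[->|->] //|cb].
  case: (eqVneq b y) => [-> //|/eqP nb]; have [c1 c2] := N_lc cz' cb nb.
  by rewrite -(NK i b) (@rk0 _ (N i b)) //; have := cov_rk c2; rewrite rk_atom // => -[].
have rz : rk (M y) = 2 by rewrite (cov_rk cz) rk_atom.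
have rz' : rk (N i y) = 2 by rewrite (cov_rk cz') rk_atom.
have [|k [k' [adj km km' zE z'E]]] := samelow_hexagon_top sl nz; first by rewrite rz.
have up a b : rk (N a (N b e)) = 2 -> cov (N b e) (N a (N b e)).
  move=> r; have := N_rk b e; rewrite rk_e => r1.
  by case: (NP a (N b e)) => // [_ /cov_rk|E]; [|rewrite E in r]; lia.
have ck' : cov (N k' e) (M y) by rewrite zE; apply: up; rewrite -zE.
have ck : cov (N k e) (M y) by apply/sl; rewrite z'E; apply: up; rewrite -z'E.
have K : (k = l \/ k = m - l.+2) \/ (k = i \/ k = m - i.+2).
  by case: (low _ ck) => E; [left|right]; apply: atom_eq.
have K' : (k' = l \/ k' = m - l.+2) \/ (k' = i \/ k' = m - i.+2).
  by case: (low _ ck') => E; [left|right]; apply: atom_eq.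
have lm : l.+1 < m by lia. have im : i.+1 < m by lia.
have il : l = i.+1 \/ i = l.+1 by clear -adj K K' hi hl li; lia.
split=> //.
have sw1 : N (m - i.+2) y = N l (N i e).
  by rewrite /y N_far ?(N_e_flip im) //; clear -il hi hl; lia.
have sw2 : N (m - l.+2) (N i e) = N i y.
  by rewrite N_far ?/y ?(N_e_flip lm) //; clear -il hi hl; lia.
case: K => -[] Ek; case: K' => -[] Ek'; rewrite Ek Ek' in adj zE;
  try by clear -adj il hi hl; lia.
- by rewrite zE.
- by case: nz; rewrite zE -N_e_flip // sw2.
- by case: nz; rewrite zE.
- by rewrite zE -N_e_flip // sw1.
Qed.

End Atoms.

(** * Matchings not above a cycle of atoms *)

Section RankCondition.
Variable n : nat.
Local Notation m := (2 * n).
Local Notation T := (matching n).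
Local Notation e := (e n).
Implicit Types (u v x y z : T) (M : T -> T).

Fixpoint cyc (a d : nat) : T := if d is d'.+1 then N a (cyc a.+1 d') else N a e.

(** The innermost conjugation acts on [e], so it can be replaced by its mirror image, which commutes
    with all the others and moves to the front. *)
Lemma cyc_flip a d : a + d.+2 < n -> cyc a d.+1 = N (m - (a + d).+3) (cyc a d).
Proof.
elim: d a => [|d IH] a h.
  rewrite [cyc a 1]/= [cyc a 0]/= (@N_e_flip n a.+1); last by lia.
  by rewrite N_far; [congr (N _ _)|..]; lia.
have -> : cyc a d.+2 = N a (cyc a.+1 d.+1) by [].
rewrite IH; last by lia.
rewrite N_far; [|lia|lia].
by congr (N _ _); lia.
Qed.

(* The condition [cyc a d] not below [y] only matters through the positions
   [0, ..., a], which [y] must then send to the last [a + d + 1] ones. *)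
Lemma rank_cond y a d : a + d.+1 < n -> ~ le (cyc a d) y ->
  forall k : nat, k <= a -> m <= av y k + (a + d).+1.
Proof.
elim/dn_ind: y a d => [|j y dj IH] a d h nle k ka.
  by rewrite av_e; lia.
have jm := dn_lt dj; have cj := dn_cov dj.
have H b c : b + c.+1 < n -> ~ le (cyc b c) (N j y) ->
    forall k : nat, k <= b -> m <= sw j (av y (sw j k)) + (b + c).+1.
  by move=> h1 h2 k' hk'; rewrite -avN //; exact: IH.
have up x : le x (N j y) -> le (N j x) y.
  by move=> xy; apply: le_dn_up => //; apply: le_trans xy (cov_le cj).
have n1 : ~ le (cyc a d) (N j y) by move=> h1; apply: nle (le_trans h1 (cov_le cj)).
(* Only two values of [j] disturb the bound: [j = a] mixes [[0, a]] with its complement, and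
   [j = m - (a + d).+2] does so for the last [a + d + 1] positions. There the cycle is shortened
   from the left or, by [cyc_flip], from the right. *)
case: (eqVneq j a) => [ja|/eqP ja].
  case: d => [|d] in h nle n1 *.
    by case: nle; rewrite /= -ja; apply: up; apply: e_min.
  have n2 : ~ le (cyc a.+1 d) (N j y) by move/up; rewrite ja.
  have := @H a.+1 d _ n2 (sw j k); rewrite swK.
  have := swP j k; have := swP j (av y k); lia.
case: (eqVneq j (m - (a + d).+2)) => [jd|/eqP jd].
  case: d => [|d] in h nle n1 jd *.
    case: nle; rewrite /= (@N_e_flip n a); last by lia.
    by rewrite -(_ : j = m - a.+2); [apply: up; apply: e_min|lia].
  have n2 : ~ le (cyc a d) (N j y).
    by move/up; rewrite jd addnS -cyc_flip //; lia.
  have := @H a d _ n2 (sw j k); rewrite swK.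
  have := swP j k; have := swP j (av y k); lia.
have := H a d h n1 (sw j k); rewrite swK.
have := swP j k; have := swP j (av y k); lia.
Qed.

(** [val x] is above [val y] in Bruhat order, and a Bruhat step puts the larger of two values in the
    earlier position. *)
Lemma le_top x y a b : le x y -> (forall k, k < a -> b <= av y k) ->
  forall k : nat, k < a -> b <= av x k.
Proof.
rewrite /av /le; move: (val y) (val x) => {x y}; apply: bruhat_ind => // u v w st _ IH hu.
apply: IH => k ka; have [c [d [/andP[cd _] ucd ->]]] := bruhat_step_ap st.
have := hu k ka; case: eqP => [kc|_]; first by rewrite kc; lia.
by case: eqP => [kd|//] _; apply: hu; lia.
Qed.

(** [y] and [N i y] differ at most at [i], [i.+1] and their partners; any other cover is a conjugate
    of a lower one. *)
Lemma cov_diff x y : cov x y -> exists L : seq nat,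
  size L = 4 /\ forall k : nat, av x k <> av y k -> k \in L.
Proof.
elim/dn_ind: y x => [|i y d IH] x c; first by have := cov_rk c; rewrite rk_e.
have im := dn_lt d; case: (eqVneq x (N i y)) => [->|/eqP ne].
  exists [:: i; i.+1; av y i; av y i.+1]; split=> // k; rewrite avN // !inE => h.
  have p1 := swP i k; have p2 := swP i (av y k).
  have := @av_eq _ y k i; have := @av_eq _ y k i.+1.
  case: (eqVneq k i) => [//|/eqP k1]; case: (eqVneq k i.+1) => [//|/eqP k2].
  have E : sw i k = k by lia.
  by rewrite E in h; lia.
have dx := cov_dn_other d c ne; have cx := dn_cov dx; have cy := dn_cov d.
have c' : cov (N i x) (N i y).
  apply: lt_cov; last by move: (cov_rk c) (cov_rk cx) (cov_rk cy); clear; lia.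
  by apply: N_cov => // E; apply: ne; rewrite -E NK.
have [L [sL hL]] := IH _ c'; exists (map (sw i) L); split; first by rewrite size_map.
move=> k hk; rewrite -[k](swK i) map_f //; apply: hL => E; apply: hk.
by rewrite -[x](NK i) -[y](NK i) (avN (N i x) k im) (avN (N i y) k im) E.
Qed.

(** At each position of [S] at least two of the three differ from [z], so
    [2 * size S <= 4 + 4 + 4]. *)
Lemma three_diff x1 x2 x3 z (S : seq nat) : uniq S -> 6 < size S ->
  cov x1 z -> cov x2 z -> cov x3 z ->
  (forall k : nat, k \in S -> av x1 k <> av x2 k /\ av x1 k <> av x3 k /\ av x2 k <> av x3 k) ->
  False.
Proof.
move=> uS sS /cov_diff[L1 [s1 h1]] /cov_diff[L2 [s2 h2]] /cov_diff[L3 [s3 h3]] h.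
have cnt L : size L = 4 -> count (mem L) S <= 4.
  move=> <-; rewrite -size_filter; apply: uniq_leq_size; first exact: filter_uniq.
  by move=> k; rewrite mem_filter => /andP[].
have := cnt _ s1; have := cnt _ s2; have := cnt _ s3.
suff : 2 * size S <= count (mem L1) S + count (mem L2) S + count (mem L3) S by lia.
have {}h k : k \in S -> 2 <= (k \in L1) + (k \in L2) + (k \in L3).
  move=> /h[n1 [n2 n3]]; have := h1 k; have := h2 k; have := h3 k.
  by case: (k \in L1); case: (k \in L2); case: (k \in L3) => //=; lia.
elim: S h {uS sS cnt} => //= k S IH h; have := h k (mem_head _ _).
have := IH (fun j hj => h j (mem_behead (s := k :: S) hj)); rewrite /=.
by lia.
Qed.

End RankCondition.

(** * Special partial matchings that are mixed at the bottom *)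

Section Mixed.
Variable n : nat.
Local Notation m := (2 * n).
Local Notation T := (matching n).
Local Notation e := (e n).
Implicit Types (u v x y z : T).

Variables (M : T -> T) (w : T) (p : nat).
Local Notation i := p.+1.
Hypotheses (sM : spm M w) (hp : p.+3 < n) (Me : M e = N i e).
Hypotheses (lp : le (N p e) w) (lq : le (N p.+2 e) w).
Hypotheses (Mp : M (N p e) = N i (N p e)) (Mq : M (N p.+2 e) = N p.+2 (N i e)).

(** By [spm_commute] it is enough to look at [e]. [M] acts as [N i] on the atom [p] and as the
    mirror image [N (m - p.+3)] on the atom [p.+2]; the excluded labels [p] and [m - p.+4] are the
    ones adjacent to these. *)
Lemma mixed_comm j : j <> p -> j <> m - p.+4 ->
  forall y, le y w -> le (N j y) w -> M (N j y) = N j (M y).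
Proof.
move=> jp jq; case: (leqP m j.+1) => jm; first by move=> y _ _; rewrite !N_out.
apply: (spm_commute sM) => lj; have hi : i.+1 < n by lia.
have MMe : M (N i e) = e by rewrite -Me (spmK sM (e_min w)).
have far l : l.+1 < n -> N l e = N j e -> l <> p -> l <> p.+2 -> N i (N l e) = N j (N i e).
  move=> hl E lp' lq'; case: (eqVneq l i) => [El|/eqP li].
    by rewrite -{1}El NK -El E NK.
  have jE := @atom_eq _ j l hl jm (esym E).
  by rewrite E N_far //; move: jE li lp' lq' hl hp; clear; lia.
case: (ltngtP j.+1 n) => jn.
- case: (eqVneq j p.+2) => [->|/eqP jp2]; first by rewrite Mq Me.
  case: (atom_case sM hi Me jn lj) => [->|[_ ->]]; last by rewrite Me.
  by rewrite Me; apply: far.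
- pose l := m - j.+2; have hl : l.+1 < n by rewrite /l; clear -jn jm; lia.
  have E : N l e = N j e by rewrite [RHS]N_e_flip.
  have lq' : l <> p.+2 by rewrite /l; clear -jq jm hp; lia.
  case: (eqVneq l p) => [El|/eqP lp'].
    have E' : N p e = N j e by rewrite -El.
    rewrite Me -E' Mp E' N_far //; move: El hp jn jm; rewrite /l; clear; lia.
  rewrite -E in lj *; case: (atom_case sM hi Me hl lj) => [->|[h _]].
    by rewrite Me; apply: far.
  case: (eqVneq l i) => [El|/eqP li]; last by move: h li lp' lq'; clear; lia.
  by move: h; rewrite El; clear; lia.
- by rewrite -[j]/(j.+1.-1) jn N_mid Me N_far ?N_mid //; move: jn hp; clear; lia.
Qed.

Let i' := m - p.+3.
Let im : i.+1 < m. Proof. by move: hp; clear; lia. Qed.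
Let Ni' : N i' e = N i e. Proof. by rewrite /i' [RHS]N_e_flip. Qed.

Lemma left_val a b c k : a <= p.+2 -> b <= p.+2 -> c <= p.+2 -> k <= p.+3 ->
  av (N a (N b (N c e))) k = m - (sw c (sw b (sw a k))).+1.
Proof.
move=> ha hb hc hk.
have h (q j : nat) : q <= p.+3 -> j <= p.+2 -> sw j q <= p.+3.
  by have := swP j q; clear; lia.
have h' (q j : nat) : q <= p.+3 -> j <= p.+2 -> sw j (m - q.+1) = m - q.+1.
  by have := swP j (m - q.+1); move: hp; clear; lia.
have am : a.+1 < m by move: ha hp; clear; lia.
have bm : b.+1 < m by move: hb hp; clear; lia.
have cm : c.+1 < m by move: hc hp; clear; lia.
have k1 := h _ _ hk ha; have k2 := h _ _ k1 hb; have k3 := h _ _ k2 hc.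
rewrite !avN // av_e; last by move: k3 hp; clear; lia.
by rewrite !h'.
Qed.

(** [mixed_comm] determines [M] on the lower covers [p1] and [p2] of [h]: their images are [q1] and
    [q2]. Then [M h] would cover [h], [q1] and [q2], which differ pairwise at 8 positions. *)
Lemma mixed_nle : ~ le (cyc n p 2) w.
Proof.
move=> hw; set h := cyc n p 2 in hw.
pose p1 := N i (N p.+2 e); pose p2 := N p (N i e).
pose q1 := N p.+2 p1; pose q2 := N i p2.
have D (q k : nat) : k <> q -> k <> q.+1 -> sw q k = k by move=> /eqP ? /eqP ?; apply: swD.
have t : (sw p p.+2 = p.+2) * (sw p p.+3 = p.+3) * (sw p.+1 p = p) *
    (sw p.+1 p.+3 = p.+3) * (sw p.+2 p = p) * (sw p.+2 p.+1 = p.+1).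
  by do ! split; apply: D; clear; lia.
pose t' := (t, swl, swr).
have [h0 h1 h2 h3] : [/\ av h p = m - p.+4, av h p.+1 = m - p.+1,
    av h p.+2 = m - p.+2 & av h p.+3 = m - p.+3].
  by split; rewrite /h /= left_val ?t' //; clear; lia.
have [a0 a1 a2 a3] : [/\ av q1 p = m - p.+1, av q1 p.+1 = m - p.+4,
    av q1 p.+2 = m - p.+3 & av q1 p.+3 = m - p.+2].
  by split; rewrite /q1 /p1 left_val ?t' //; clear; lia.
have [b0 b1 b2 b3] : [/\ av q2 p = m - p.+3, av q2 p.+1 = m - p.+2,
    av q2 p.+2 = m - p.+1 & av q2 p.+3 = m - p.+4].
  by split; rewrite /q2 /p2 left_val ?t' //; clear; lia.
have h0' : av h (m - p.+4) = p by rewrite -h0 avK.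
have h3' : av h (m - p.+3) = p.+3 by rewrite -h3 avK.
have c1 : cov p1 h.
  suff d : dn p h by have := dn_cov d; rewrite NK.
  by rewrite /dn h0 h1; move: hp; clear; lia.
have hE : h = N (m - p.+4) p2.
  by rewrite /h cyc_flip; [congr (N _ _); clear; lia|move: hp; clear; lia].
have c2 : cov p2 h.
  suff d : dn (m - p.+4) h by have := dn_cov d; rewrite [in N _ h]hE NK.
  rewrite /dn h0' (_ : (m - p.+4).+1 = m - p.+3) ?h3'; move: hp; clear; lia.
have u1 : cov p1 q1.
  suff d : dn p.+2 q1 by have := dn_cov d; rewrite NK.
  by rewrite /dn a2 a3; move: hp; clear; lia.
have u2 : cov p2 q2.
  suff d : dn p.+1 q2 by have := dn_cov d; rewrite NK.
  by rewrite /dn b1 b2; move: hp; clear; lia.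
have M1 : M p1 = q1.
  rewrite /p1 mixed_comm ?Mq //; try by move: hp; clear; lia.
    by rewrite N_braid //; move: hp; clear; lia.
  exact: le_trans (cov_le c1) hw.
have p2E : p2 = N i' (N p e).
  by rewrite /p2 -Ni' N_far // /i'; move: hp; clear; lia.
have M2 : M p2 = q2.
  rewrite p2E mixed_comm ?Mp /q2 ?p2E //; try by rewrite /i'; move: hp; clear; lia.
    by rewrite N_far // /i'; move: hp; clear; lia.
  by rewrite -p2E; apply: le_trans (cov_le c2) hw.
have n1 : M p1 <> h by rewrite M1 => /(congr1 (fun x => av x p)); rewrite h0 a0; move: hp; clear; lia.
have n2 : M p2 <> h by rewrite M2 => /(congr1 (fun x => av x p)); rewrite h0 b0; move: hp; clear; lia.
have [z0 z1] : cov h (M h) /\ cov q1 (M h) by rewrite -M1; apply: (spm_up sM hw c1) => //; rewrite M1.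
have [_ z2] : cov h (M h) /\ cov q2 (M h) by rewrite -M2; apply: (spm_up sM hw c2) => //; rewrite M2.
have inv (x : T) (a b : nat) : av x a = b -> av x b = a by move=> <-; rewrite avK.
apply: (@three_diff n h q1 q2 (M h) [:: p; p.+1; p.+2; p.+3; m - p.+1; m - p.+2; m - p.+3; m - p.+4]) => //.
  by rewrite /= !inE; move: hp; clear; lia.
move=> k; rewrite !inE; do 7 (case/orP; first by move/eqP=> ->;
  rewrite ?h0 ?h1 ?h2 ?h3 ?a0 ?a1 ?a2 ?a3 ?b0 ?b1 ?b2 ?b3 ?(inv _ _ _ h0) ?(inv _ _ _ h1)
  ?(inv _ _ _ h2) ?(inv _ _ _ h3) ?(inv _ _ _ a0) ?(inv _ _ _ a1)  ?(inv _ _ _ a2)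
  ?(inv _ _ _ a3) ?(inv _ _ _ b0) ?(inv _ _ _ b1)  ?(inv _ _ _ b2) ?(inv _ _ _ b3);
  move: hp; clear; lia).
move/eqP=> ->; rewrite (inv _ _ _ h0) (inv _ _ _ a1) (inv _ _ _ b3).
by move: hp; clear; lia.
Qed.

Lemma mixed_top y : le y w -> forall k : nat, k <= p -> m - p.+3 <= av y k.
Proof.
move=> yw k kp; have h : ~ le (cyc n p 2) y.
  by move=> h; apply: mixed_nle; apply: le_trans h yw.
have := rank_cond _ h kp; move: hp; clear; lia.
Qed.

Definition tsw (a b k : nat) : nat := if k == a then b else if k == b then a else k.

Lemma sw_tsw j a b k : sw j (tsw (sw j a) (sw j b) k) = tsw a b (sw j k).
Proof.
rewrite /tsw -(inj_eq (can_inj (swK j)) k) swK -(inj_eq (can_inj (swK j)) k) swK.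
by case: eqP => _; rewrite ?swK //; case: eqP; rewrite ?swK.
Qed.

Definition free y (a : nat) := [/\ m - p.+3 <= a, a < m & p < av y a].

(* [y] maps [0, ..., p] into the last [p + 3] positions, leaving two of them,
   [a] and [b], free. *)
Lemma mixed_formula y : le y w -> forall a b : nat, a <> b -> free y a -> free y b ->
  forall k : nat, av (M y) k = tsw a b (av y (tsw a b k)).
Proof.
have [k0] := ubnP (rk y); elim: k0 y => // k0 IH y hk yw a b ab fa fb.
have top := mixed_top yw.
case: (boolP [exists j : 'I_m, [&& dn j y, j != p :> nat & j != m - p.+4 :> nat]]).
  (* [M] commutes with this [N j], and [sw j] carries the free positions along. *)
  case/existsP=> j /and3P[dj /eqP jp /eqP jq]; have jm := dn_lt dj.
  have cj := dn_cov dj; have y1w := le_trans (cov_le cj) yw.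
  have fr (q : nat) : free y q -> free (N j y) (sw j q).
    case=> f1 f2 f3; have px := swP j q; split; rewrite ?avN ?swK //.
    - by move: px f1 jq hp jm; clear; lia.
    - by move: px f2 jm; clear; lia.
    - by have := swP j (av y q); move: f3 jp; clear; lia.
  have ab' : sw j a <> sw j b by move/(can_inj (swK j)).
  have E := IH (N j y) _ y1w _ _ ab' (fr a fa) (fr b fb).
  have My : M y = N j (M (N j y)).
    rewrite -{1}(NK j y); apply: mixed_comm => //; by rewrite NK.
  move=> k; rewrite My avN // E; last by move: (cov_rk cj) hk; clear; lia.
  by rewrite sw_tsw avN // swK sw_tsw swK.
rewrite negb_exists => /forallP nd.
have {}nd (j : nat) : j <> p -> j <> m - p.+4 -> ~~ dn j y.
  move=> jp jq; case: (ltnP j m) => jm; last by rewrite /dn; move: jm; clear; lia.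
  have := nd (Ordinal jm); rewrite /= !negb_and !negbK.
  by case/or3P=> // /eqP.
have pm : p < m by move: hp; clear; lia.
have d1 := decr_le (leq0n p) pm; have {}d1 := d1 y _.
have yp : av y p + p <= av y 0.
  rewrite -{2}[p]subn0; apply: d1 => j; move=> jp; apply: nd; move: jp hp; clear; lia.
have y0 : av y 0 < m by rewrite av_lt; move: hp; clear; lia.
have tp := top p (leqnn p).
(* [y] decreases on [[0, p]] and on the last [p.+3] positions, so the free positions are the first
   two of the latter and [tsw a b] is [sw i']. *)
have small (q : nat) : free y q -> q < m - p.+1.
  case=> f1 f2 f3; rewrite ltnNge; apply/negP=> hx.
  have ne : av y p <> q by move=> E; move: f3; rewrite -E avK ltnn.
  have : av y q < av y (av y p).
    apply: decr_lt; first by move: ne yp y0 hx f2; clear; lia.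
    by move=> j hj; apply: nd; move: hj tp hp; clear; lia.
  by rewrite avK; move: f3; clear; lia.
have sa := small _ fa; have sb := small _ fb; case: fa fb => a1 a2 a3 [b1 b2 b3].
have tE k : tsw a b k = sw i' k.
  rewrite /tsw /i'; have := swP (m - p.+3) k; case: eqP => [->|ka].
    by move: a1 b1 sa sb ab hp; clear; lia.
  case: eqP => [->|kb]; first by move: a1 b1 sa sb ab hp; clear; lia.
  by move: a1 b1 sa sb ab hp; clear -ka kb; lia.
have hi : i.+1 < n by move: hp; clear; lia.
have im' : i'.+1 < m by rewrite /i'; move: hp; clear; lia.
(* On atoms below [w], [M] agrees with [N i'] except possibly at [N p e], which is not below [y] by
   [le_top]. *)
have E : forall x, le x y -> M x = N i' x; last first.
  by move=> k; rewrite (E y (le_refl y)) avN // !tE.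
apply: (spm_rigid sM yw); first by rewrite Me Ni'.
move=> x xy /atom_rep[l hl xE]; rewrite xE in xy *; have lw := le_trans xy yw.
have fari : N i' (N l e) = N l (N i e).
  by rewrite -Ni' N_far // /i'; move: hl hp; clear; lia.
case: (eqVneq l i) => [->|/eqP li].
  by rewrite -{2}Ni' NK -Me (spmK sM (e_min w)).
case: (eqVneq l p.+2) => [l2|/eqP l2]; first by rewrite fari l2 Mq.
case: (eqVneq l p) => [lE|/eqP l3].
  have ty (k : nat) : k < p.+1 -> m - p.+1 <= av y k.
    move=> kp; have tk := top k kp.
    have ka : av y k <> a by move=> E; move: a3; rewrite -E avK; move: kp; clear; lia.
    have kb : av y k <> b by move=> E; move: b3; rewrite -E avK; move: kp; clear; lia.
    by move: tk ka kb a1 b1 sa sb ab hp; clear; lia.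
  have := le_top xy ty (ltnSn p); rewrite lE avN; last by move: hp; clear; lia.
  rewrite swl av_e; last by move: hp; clear; lia.
  by have := swP p (m - p.+2); move: hp; clear; lia.
case: (atom_case sM hi Me hl lw) => [->|[h _]]; last by move: h li l2 l3; clear; lia.
by rewrite fari N_far //; move: li l2 l3; clear; lia.
Qed.

Lemma mixed_free : exists a b, [/\ a < b, free w a, free w b &
  forall q : nat, free w q -> q = a \/ q = b].
Proof.
have top := mixed_top (le_refl w).
pose C := iota (m - p.+3) p.+3.
pose F := [seq q <- C | p < av w q]; pose G := [seq q <- C | ~~ (p < av w q)].
have memC q : (q \in C) = (m - p.+3 <= q < m).
  by rewrite mem_iota; have := hp; clear; lia.
have freeE q : free w q <-> q \in F.
  by rewrite mem_filter memC /free; split=> [[-> -> ->]|/and3P[]].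
have sG : size G = p.+1.
  apply/eqP; rewrite eqn_leq; apply/andP; split.
    rewrite -(size_map (av w)) -[X in _ <= X](size_iota 0); apply: uniq_leq_size.
      by rewrite map_inj_uniq ?filter_uniq ?iota_uniq //; apply: av_inj.
    by move=> _ /mapP[q qG ->]; move: qG; rewrite mem_filter mem_iota; clear; lia.
  rewrite -[X in X <= _](size_iota 0) -(size_map (av w)); apply: uniq_leq_size.
    by rewrite map_inj_uniq ?iota_uniq //; apply: av_inj.
  move=> _ /mapP[q qI ->]; move: qI; rewrite mem_iota add0n => /andP[_ qp].
  rewrite mem_filter memC avK av_lt top //=; move: hp qp; clear; lia.
have sF : size F = 2.
  have := count_predC (fun q => p < av w q) C; rewrite -!size_filter -/F size_iota.
  by rewrite -/G sG; clear; lia.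
have srt : sorted ltn F by apply: (sorted_filter ltn_trans); apply: iota_ltn_sorted.
case: F sF srt freeE => [|a [|b []]] //= _ /andP[ab _] freeE.
exists a, b; split=> //; [| |move=> q /freeE].
- by apply/freeE; rewrite mem_head.
- by apply/freeE; rewrite !inE eqxx orbT.
by rewrite !inE => /orP[] /eqP; [left|right].
Qed.

(** [M w] is the conjugate of [w] by the transposition of its free positions [a < b], and some
    descent lies in [[a, b)]. If it moves [w] like [M], then [b = a.+1], and a second descent is
    found to the left of [a]. *)
Lemma mixed_descent : exists j, [/\ dn j w, N j w <> M w, j <> p & j <> m - p.+4].
Proof.
have [a [b [ab fa fb uq]]] := mixed_free.
have top := mixed_top (le_refl w).
have ab' : a <> b by move: ab; clear; lia.
have Mw := mixed_formula (le_refl w) ab' fa fb.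
have [a1 am a3] := fa; have [b1 bm b3] := fb; have cw := spm_top sM.
have tL : tsw a b a = b by rewrite /tsw eqxx.
have tR : tsw a b b = a by rewrite /tsw eqxx; case: eqP.
have tD k : k <> a -> k <> b -> tsw a b k = k by move=> /eqP/negPf h1 /eqP/negPf h2; rewrite /tsw h1 h2.
have tK k : tsw a b (tsw a b k) = k.
  case: (eqVneq k a) => [->|/eqP ka]; first by rewrite tL tR.
  by case: (eqVneq k b) => [->|/eqP kb]; rewrite ?tR ?tL // !tD.
have nab : av w a <> b.
  move=> E; apply: (cov_neq cw); apply: avP => k _; rewrite Mw.
  have E' : av w b = a by rewrite -E avK.
  case: (eqVneq k a) => [->|/eqP ka]; first by rewrite tL E' tL E.
  case: (eqVneq k b) => [->|/eqP kb]; first by rewrite tR E tR E'.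
  rewrite (tD k ka kb) tD //; first by move/av_eq; rewrite E.
  by move/av_eq; rewrite E'.
have nba : av w b <> a by move/av_eq/esym.
have na := @av_neq _ w a am; have nb := @av_neq _ w b bm.
(* Otherwise the transposition on either side would lower [val w], giving [le w (M w)] against
   [cov (M w) w]. *)
have lt : av w a < av w b.
  rewrite ltnNge leq_eqVlt; apply/negP=> /orP[/eqP/av_inj/esym //|gt].
  have pm : m - p.+3 < m by move: am a1; clear; lia.
  pose t := tperm (Ordinal am) (Ordinal bm).
  have tE k : ap t k = tsw a b k by rewrite ap_tperm.
  have tV : (t^-1 = t)%g by exact: tpermV.
  have st1 : bruhat_step (t * val w)%g (val w).
    apply: (bruhat_stepE (a := a) (b := b)); rewrite ?ab // ?ap_mul ?tE ?tL ?tR //.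
    by move=> k _; rewrite ap_mul tE -/(tsw a b k) tK.
  have st2 : bruhat_step (val (M w)) (val w * t)%g.
    apply: (bruhat_stepE (a := a) (b := b)); rewrite ?ab // -?/(av (M w) _).
      by rewrite !Mw tL tR !tD.
    by move=> k _; rewrite ap_mul tE -/(tsw a b k) -/(av (M w) _) Mw tK.
  have /bruhat_inv := connect1 st1; rewrite invMg tV valV => h.
  have := le_rk (bruhat_trans (connect1 st2) h : le w (M w)).
  by rewrite (cov_rk cw); clear; lia.
have ex c d : c < d < m -> av w c < av w d -> exists2 j, dn j w & c <= j < d.
  move=> cd lcd; case: (boolP [exists j : 'I_m, dn j w && (c <= j < d)]).
    by case/existsP=> j /andP[dj hj]; exists j.
  rewrite negb_exists => /forallP h; have := @decr_lt _ w c d cd.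
  move=> dec; move: lcd; rewrite ltnNge => /negP[]; apply: ltnW; apply: dec => j hj.
  have jm : j < m by move: hj cd; clear; lia.
  by have := h (Ordinal jm); rewrite /= hj andbT.
have abm : a < b < m by rewrite ab.
have [j dj jab] := ex a b abm lt; have jm := dn_lt dj.
have good q : m - p.+3 <= q -> q <> p /\ q <> m - p.+4.
  by move: hp; clear; lia.
have [g1 g2] : j <> p /\ j <> m - p.+4 by apply: good; move: a1 jab; clear; lia.
case: (eqVneq (N j w) (M w)) => [E|/eqP ne]; last by exists j.
have Ek k : sw j (av w (sw j k)) = tsw a b (av w (tsw a b k)) by rewrite -Mw -E avN.
have free_j q : m - p.+3 <= q < m -> p < av w q -> q = a \/ q = b.
  by move=> /andP[q1 q2] q3; apply: uq.
have pc : p < m - p.+3 by move: hp; clear; lia.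
(* This would make [j] free, hence equal to [a] or [b]. *)
have bad : av w j = a -> False.
  move=> E1; have [||ja|jb] := free_j j.
  - by move: a1 jab jm; clear; lia.
  - by rewrite E1; move: a1 pc; clear; lia.
  - by apply: na; rewrite -{1}ja.
  - by move: jab; rewrite jb; clear; lia.
have ja : j = a.
  case: (eqVneq j a) => // /eqP nja; case: bad; apply/av_eq; have := Ek a.
  rewrite tL (tD (av w b)) //.
  have [[E1 _]|[[E1 _]|[_ [_ E1]]]] := swP j a; [by case: nja|by move: E1 jab; clear; lia|].
  by rewrite E1; have := swP j (av w a); move: lt; clear; lia.
have jb : j.+1 = b.
  case: (eqVneq j.+1 b) => // /eqP njb; case: bad; apply/av_eq; have := Ek b.
  rewrite tR (tD (av w a)) //.
  have [[E1 _]|[[E1 _]|[_ [_ E1]]]] := swP j b; [by move: E1 jab; clear; lia|by case: njb|].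
  by rewrite E1; have := swP j (av w b); move: lt; clear; lia.
(* If the free positions came first, [w] would send [[0, p]] into the last [p.+1] positions, and
   [N p e] could not lie below it. *)
case: (eqVneq a (m - p.+3)) => [ac|/eqP nac].
  have ty (k : nat) : k < p.+1 -> m - p.+1 <= av w k.
    move=> kp; have tk := top k kp.
    have ka : av w k <> a by move=> E1; move: a3; rewrite -E1 avK; move: kp; clear; lia.
    have kb : av w k <> b by move=> E1; move: b3; rewrite -E1 avK; move: kp; clear; lia.
    by move: tk ka kb ac hp; rewrite -jb ja; clear; lia.
  have := le_top lp ty (ltnSn p); rewrite avN; last by move: hp; clear; lia.
  rewrite swl av_e; last by move: hp; clear; lia.
  by have := swP p (m - p.+2); move: hp; clear; lia.
have wc : av w (m - p.+3) <= p.
  rewrite leqNgt; apply/negP=> h; case: (free_j (m - p.+3)) => //.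
  - by move: am a1; clear; lia.
  - by move/esym.
  - by move: a1 ab nac; clear; lia.
have cam : m - p.+3 < a < m by move: a1 nac am; clear; lia.
have [|j2 dj2 j2a] := ex _ _ cam; first by move: wc a3; clear; lia.
have [g3 g4] : j2 <> p /\ j2 <> m - p.+4 by apply: good; move: j2a; clear; lia.
(* An equal effect gives [av w j2 = a] by [N_same], so [j2] would be free. *)
exists j2; split=> //; rewrite -E => E2.
have j2j : j2 != j by apply/eqP=> h; move: j2a; rewrite h ja; clear; lia.
have [w1 _] := N_same dj2 j2j E2.
have [||E3|E3] := free_j j2.
- by move: j2a am; clear; lia.
- by rewrite w1 ja; move: a1 pc; clear; lia.
- by move: j2a; rewrite E3; clear; lia.
- by move: j2a ab; rewrite E3; clear; lia.
Qed.

End Mixed.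

(** * Special partial matchings have commuting descents *)

Section Descent.
Variable n : nat.
Local Notation m := (2 * n).
Local Notation T := (matching n).
Local Notation e := (e n).
Implicit Types (u v w x y z : T) (M : T -> T).

Lemma flip_le x y : le (flip x) (flip y) = le x y.
Proof. by apply/idP/idP => /le_flip //; rewrite !flipK. Qed.

Lemma spm_flip M w : spm M w -> spm (fun v => flip (M (flip v))) (flip w).
Proof.
move=> sM; have inj := can_inj (@flipK n).
have fw x : le x (flip w) -> le (flip x) w by move=> h; rewrite -flip_le flipK.
split=> /=.
- move=> x /fw xw; split; first by have := spm_le sM xw; rewrite -flip_le.
  by rewrite flipK (spmK sM xw) flipK.
- by rewrite flipK cov_flip; apply: spm_top sM.
- move=> x /fw xw; case: (spm_case sM xw) => h.
  + by constructor 1; rewrite -cov_flip flipK.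
  + by constructor 2; rewrite h flipK.
  + by constructor 3; rewrite -cov_flip flipK.
- move=> x y /fw yw c h; rewrite /lt flip_le (inj_eq inj).
  apply: (spm_cov sM yw); first by rewrite cov_flip.
  by move=> E; apply: h; rewrite E flipK.
Qed.

Definition commuting_descent M w := exists j, [/\ dn j w, N j w <> M w &
  forall y, le y w -> M (N j y) = N j (M y)].

Lemma mixed_commuting M w p : spm M w -> p.+3 < n -> M e = N p.+1 e ->
  le (N p e) w -> le (N p.+2 e) w -> M (N p e) = N p.+1 (N p e) ->
  M (N p.+2 e) = N p.+2 (N p.+1 e) -> commuting_descent M w.
Proof.
move=> sM hp Me lp lq Mp Mq.
have [j [dj ne jp jq]] := mixed_descent sM hp Me lp lq Mp Mq.
exists j; split=> // y yw; apply: (mixed_comm sM hp Me lp lq Mp Mq jp jq yw).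
exact: le_dn_up.
Qed.

Lemma flip_atom i : i.+1 < m -> flip (N i e) = N i e.
Proof. by move=> im; rewrite flipN // flip_e -N_e_flip. Qed.

(** [flip] fixes the atoms but exchanges the labels [i] and [m - i.+2], which turns this case into
    the previous one. *)
Lemma mixed_commuting_flip M w p : spm M w -> p.+3 < n -> M e = N p.+1 e ->
  le (N p e) w -> le (N p.+2 e) w -> M (N p e) = N p (N p.+1 e) ->
  M (N p.+2 e) = N p.+1 (N p.+2 e) -> commuting_descent M w.
Proof.
move=> sM hp Me lp lq Mp Mq.
have p0 : p.+1 < m by move: hp; clear; lia.
have p1 : p.+2 < m by move: hp; clear; lia.
have p2 : p.+3 < m by move: hp; clear; lia.
have [|||||j [dj ne hj]] := @mixed_commuting _ (flip w) p (spm_flip sM) hp; rewrite ?flip_e ?flip_atom //.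
- by rewrite Me flip_atom.
- by rewrite -flip_le flipK flip_atom.
- by rewrite -flip_le flipK flip_atom.
- rewrite Mp flipN // flip_atom //; rewrite N_far; [|move: hp; clear; lia|move: hp; clear; lia].
  by rewrite -N_e_flip.
- rewrite Mq flipN // flip_atom //; rewrite N_far; [|move: hp; clear; lia|move: hp; clear; lia].
  by rewrite -N_e_flip.
have jm := dn_lt dj; exists (m - j.+2).
have K y : N (m - j.+2) y = flip (N j (flip y)) by rewrite flipN // flipK.
split.
- by rewrite -[w]flipK flip_dn.
- by rewrite K => E; apply: ne; rewrite -[LHS]flipK E flipK.
move=> y yw; have := hj (flip y); rewrite flip_le flipK => /(_ yw) E.
by rewrite !K -E !flipK.
Qed.

(** If [M e = e], then [M] is the middle conjugation. Otherwise [M e] has two labels, and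
    [spm_rigid] applies if [M] agrees with one of them on all atoms. If both fail, they fail at the
    two neighbours of [i]: the mixed situation or its mirror image. *)
Lemma spm_descent M w : spm M w ->
  (exists j, dn j w /\ forall y, le y w -> M y = N j y) \/ commuting_descent M w.
Proof.
move=> sM; have ew := e_min w.
have use j : (forall y, le y w -> M y = N j y) ->
    exists j, dn j w /\ forall y, le y w -> M y = N j y.
  move=> h; exists j; split=> //; apply: cov_dn; rewrite -h; first exact: spm_top sM.
  exact: le_refl.
have dec j : M e = N j e -> (forall y, le y w -> M y = N j y) \/
    exists l, [/\ l.+1 < n, le (N l e) w & M (N l e) <> N j (N l e)].
  move=> Me; case: (boolP [forall y, le y w && (rk y == 1) ==> (M y == N j y)]).
    move/forallP=> h; left; apply: (spm_rigid sM (le_refl w) Me) => y yw ry.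
    by have := h y; rewrite yw ry eqxx /= => /eqP.
  rewrite negb_forall => /existsP[y]; rewrite negb_imply => /andP[/andP[yw /eqP ry] /eqP ne].
  by have [l hl E] := atom_rep ry; right; exists l; rewrite -E.
case: (eqVneq (M e) e) => [Me|/eqP Me].
  have mid0 := N_mid n; have nx x : N n.-1 (N n.-1 x) = x by exact: NK.
  have low y : le y w -> cov y (M y) -> rk y = 1 -> forall b, cov b (M y) -> b = y.
    move=> yw c ry b cb; case: (eqVneq b y) => // /eqP nb.
    have [c1 c2] := spm_lc sM yw c cb nb.
    have r0 : rk (M b) = 0 by move: (cov_rk c2); rewrite ry => -[].
    have bw := le_trans (cov_le cb) (spm_le sM yw).
    by case: (cov_neq c1); rewrite -{2}(spmK sM bw) (rk0 r0) Me.
  (* The image of a moved atom covers only that atom; a descent [j] of it other than [n.-1] would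
     produce a second covered atom. *)
  have atom l : l.+1 < n -> le (N l e) w -> M (N l e) <> N l e ->
      l.+2 = n /\ M (N l e) = N n.-1 (N l e).
    move=> hl lw ne; set y := N l e in lw ne *.
    have ry : rk y = 1 := rk_atom hl.
    have cy : cov y (M y).
      case: (spm_case sM lw) => // c; case: ne.
      have r0 : rk (M y) = 0 by move: (cov_rk c); rewrite ry => -[].
      by rewrite -[RHS](spmK sM lw) (rk0 r0) Me.
    have lo := low y lw cy ry.
    have ze : M y <> e by move=> E; have := cov_rk cy; rewrite E rk_e.
    have [j dj] := exists_dn ze; have cj := dn_cov dj; have E := lo _ cj.
    have zE : M y = N j y by rewrite -{2}E NK.
    have jn : j = n.-1.
      case: (eqVneq j n.-1) => // /eqP nj; exfalso.
      have cj' : cov e (N j e).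
        have jm := dn_lt dj; case: (ltnP j.+1 n) => jn; first exact: atom_cov.
        by rewrite N_e_flip //; apply: atom_cov; move: jn nj jm; clear; lia.
      case: (eqVneq (N j e) y) => [E2|/eqP n2].
        by apply: ze; rewrite zE -E2 NK.
      have [_ c3] := N_up (atom_cov hl) cj' n2; rewrite -/y -zE in c3.
      exact: n2 (lo _ c3).
    split; last by rewrite zE jn.
    case: (eqVneq l.+2 n) => // /eqP nl; case: ne; rewrite zE jn /y N_far.
    - by rewrite mid0.
    - by move: hl nl; clear; lia.
    - by move: hl nl; clear; lia.
  have Mj : M e = N n.-1 e by rewrite Me mid0.
  left; apply: (use n.-1); apply: (spm_rigid sM (le_refl w) Mj) => y yw ry.
  have [l hl yE] := atom_rep ry; rewrite yE in yw *.
  case: (eqVneq (M (N l e)) (N l e)) => [fy|/eqP ne]; last by case: (atom l hl yw ne).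
  have nl : l.+2 <> n.
    (* If the atom next to the middle is fixed, [M] fixes everything below [w]: a minimal moved
       element would be an atom by [single_cover_rk]. *)
    move=> nl; have [k] := ubnP (rk w); suff H v : le v w -> rk v < k -> M v = v.
      by move/(H w (le_refl w)); apply: cov_neq (spm_top sM).
    elim: k v => // k IH v vw vk.
    have low' b : cov b v -> M b = b.
      move=> c; apply: IH; first exact: le_trans (cov_le c) vw.
      by move: (cov_rk c) vk; clear; lia.
    case: (spm_case sM vw) => // [c|c].
      by case: (cov_neq c); rewrite -{2}(spmK sM vw) (low' _ c).
    have v0 : rk v <> 0 by move=> /rk0 E; move: (cov_neq c); rewrite E Me.
    have r2 : rk (M v) = 2.
      apply: single_cover_rk; first by move: (cov_rk c) v0; clear; lia.
      have uq b : cov b (M v) -> b = v.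
        move=> cb; case: (eqVneq b v) => // /eqP nb; exfalso.
        have [c1 c2] := spm_lc sM vw c cb nb; have := low' _ c2.
        have bw := le_trans (cov_le cb) (spm_le sM vw).
        by rewrite (spmK sM bw) => E; apply: (cov_neq c1).
      by move=> b b' /uq -> /uq ->.
    have r1 : rk v = 1 by move: (cov_rk c) r2; clear; lia.
    have [l' hl' vE] := atom_rep r1; rewrite vE in vw c *.
    case: (eqVneq (M (N l' e)) (N l' e)) => // /eqP ne.
    have [E _] := atom l' hl' vw ne.
    have ll : l' = l by move: E nl; clear; lia.
    by rewrite ll fy in ne.
  by rewrite fy N_far ?mid0 //; move: hl nl; clear; lia.
have ce : cov e (M e).
  by case: (spm_case sM ew) => // /cov_rk; rewrite rk_e.
have r1 : rk (M e) = 1 by rewrite (cov_rk ce) rk_e.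
have [i hi Mi] := atom_rep r1; have im : i.+1 < m by move: hi; clear; lia.
case: (dec i Mi) => [h|[l1 [hl1 lw1 n1]]]; first by left; apply: use h.
have Mi' : M e = N (m - i.+2) e by rewrite -N_e_flip.
case: (dec _ Mi') => [h|[l2 [hl2 lw2 n2]]]; first by left; apply: use h.
right.
case: (atom_case sM hi Mi hl1 lw1) => [//|[a1 E1]].
have far l : l.+1 < n -> N (m - i.+2) (N l e) = N l (N i e).
  by move=> hl; rewrite (N_e_flip im) N_far //; move: hl hi; clear; lia.
case: (atom_case sM hi Mi hl2 lw2) => [E2|[_ E2]]; last by case: n2; rewrite E2 far.
have a2 : l2 = i.+1 \/ i = l2.+1.
  case: (eqVneq l2 i) => [E|/eqP n3].
    by case: n2; rewrite E2 far // E.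
  case: (eqVneq l2 i.+1) => [|/eqP n4]; first by left.
  case: (eqVneq i l2.+1) => [|/eqP n5]; first by right.
  by case: n2; rewrite E2 far // N_far.
have l12 : l1 <> l2.
  by move=> E; case: n1; rewrite E.
case: a1 => e1; case: a2 => e2.
- by case: l12; rewrite e1 e2.
- by subst i l1; apply: (@mixed_commuting M w l2).
- by subst i l2; apply: (@mixed_commuting_flip M w l1).
- by case: l12; move: e1; rewrite e2 => -[].
Qed.

End Descent.

(** * Special partial matchings compute the Q-polynomials *)

Import GRing.Theory.

Section TwistedIdentities.
Variable n : nat.
Local Notation m := (2 * n).
Local Notation T := (matching n).
Local Notation e := (e n).
Implicit Types (u v w x y z : T).

Definition io v : 'S_m := w0 m ∘ val v.

Lemma io_inj : injective io.
Proof. by move=> x y /mulIg /val_inj. Qed.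

Lemma io_conj (t : 'S_m) : theta t^-1%g ∘ t = io (cj e t^-1%g).
Proof. by rewrite /io /theta /Defs.pcomp /= /conjg invgK !mulgA. Qed.

Lemma io_iota v : io v \in iota_set m.
Proof.
suff [t ->] : exists t, v = cj e t.
  by apply/imsetP; exists t^-1%g; rewrite ?inE // io_conj invgK.
elim/dn_ind: v => [|i v _ [t E]].
  by exists 1%g; apply: val_inj; rewrite /= conjg1.
by exists (t * sg m i)%g; rewrite -cjM -E; rewrite -[LHS](NK i).
Qed.

Lemma iotaP (t : 'S_m) : t \in iota_set m -> exists v, t = io v.
Proof. by case/imsetP=> s _ ->; exists (cj e s^-1%g); rewrite io_conj. Qed.

Lemma w0_compK (t : 'S_m) : w0 m ∘ (w0 m ∘ t) = t.
Proof. by rewrite /Defs.pcomp -mulgA w0_sq mulg1. Qed.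

Lemma bruhat_io x y : bruhat (io x) (io y) = le x y.
Proof.
apply/idP/idP => [/bruhat_w0|]; last exact: bruhat_w0.
by rewrite !w0_compK.
Qed.

Lemma twist_io i v : twist (io v) (sg m i) = io (N i v).
Proof.
rewrite /twist /io /theta /Defs.pcomp sgV val_N !mulgA.
by rewrite -[(_ * _ * w0 m * w0 m)%g]mulgA w0_sq mulg1.
Qed.

Lemma sg_DR i w : dn i w -> sg m i \in DR (io w).
Proof.
move=> d; have im := dn_lt d; rewrite inE; apply/andP; split.
  have [a [b [ha hb ->]]] := sgE im; rewrite inE; apply/existsP; exists a.
  by apply/existsP; exists b; rewrite hb ha !eqxx.
have -> : io w ∘ sg m i = w0 m ∘ (sg m i * val w)%g by rewrite /io /Defs.pcomp mulgA.
have := ell_w0_comp (sg m i * val w)%g; have := ell_w0_comp (val w).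
rewrite ell_sgR // /io; set a := ell (w0 m ∘ _); set b := ell (w0 m ∘ _).
by clear; lia.
Qed.

Lemma cov_io x y : cov x y -> iota_cover (io x) (io y).
Proof.
move=> c; apply/and4P; split; rewrite ?io_iota //.
  by rewrite /bruhat_lt bruhat_io (cov_le c) (inj_eq io_inj) andbT; apply/eqP/cov_neq.
apply/forall_inP=> t /iotaP[z ->]; apply/negP => /andP[].
rewrite /bruhat_lt !bruhat_io !(inj_eq io_inj) => h1 h2.
have := lt_rk h1; have := lt_rk h2; move: (cov_rk c); clear; lia.
Qed.

Lemma rho_io v : rho (io v) = rk v. Proof. by []. Qed.

End TwistedIdentities.

Section Transport.
Variable n : nat.
Local Notation m := (2 * n).
Local Notation T := (matching n).
Local Notation e := (e n).
Implicit Types (u v w x y z : T) (K M : T -> T).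
Local Open Scope ring_scope.

(* The right-hand side of the recursion for Q, with [K] in place of a twisted
   conjugation and [f] in place of the polynomials for the smaller element. *)
Definition Qstep K (f : T -> {poly int}) x :=
  if (rk (K x) < rk x)%N then f (K x)
  else if (rk x < rk (K x))%N then 'X * f (K x) + ('X - 1) * f x
  else 'X * f x.

Lemma eq_Qstep K K' f f' x : K x = K' x -> f x = f' x -> f (K x) = f' (K' x) ->
  Qstep K f x = Qstep K' f' x.
Proof. by move=> E1 E2 E3; rewrite /Qstep E3 E2 E1. Qed.

(** [M] maps the cover between [x] and [K x] to a strict relation in the same direction. *)
Lemma spm_compare K M w x : spm M w -> spm K w -> le x w -> M (K x) = K (M x) ->
  K x <> M x ->
  (rk (K (M x)) < rk (M x))%N = (rk (K x) < rk x)%N /\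
  (rk (M x) < rk (K (M x)))%N = (rk x < rk (K x))%N.
Proof.
move=> sM sK xw E ne; rewrite -E; case: (spm_case sK xw) => [c|->|c].
- have h : M (K x) <> x by move=> h; apply: ne; rewrite -{2}h (spmK sM (spm_le sK xw)).
  by have := lt_rk (spm_cov sM xw c h); move: (cov_rk c); clear; lia.
- by rewrite !ltnn.
- have h : M x <> K x by move/esym.
  by have := lt_rk (spm_cov sM (spm_le sK xw) c h); move: (cov_rk c); clear; lia.
Qed.

Lemma Qstep_commute K M w x f : spm M w -> spm K w -> le x w -> M (K x) = K (M x) ->
  Qstep K (Qstep M f) x = Qstep M (Qstep K f) x.
Proof.
move=> sM sK xw E; case: (eqVneq (K x) (M x)) => [E1|/eqP ne].
  have E2 : M (K x) = K (K x) by rewrite E E1.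
  by rewrite /Qstep -E1 E2.
have [c1 c2] := spm_compare sM sK xw E ne.
have [c3 c4] := spm_compare sK sM xw (esym E) (nesym ne).
rewrite /Qstep c1 c2 c3 c4 E.
by do ! case: ifP => _; ring.
Qed.

Variable Q : 'S_m -> 'S_m -> {poly int}.
Hypothesis hQ : is_Qfamily Q.

Definition Qm x w := Q (io x) (io w).

Lemma Qm_refl x : Qm x x = 1.
Proof. by case: hQ => h _ _; apply/h/io_iota. Qed.

Lemma Qm_out x w : ~~ le x w -> Qm x w = 0.
Proof. by case: hQ => _ h _ nle; apply: h; rewrite ?io_iota // bruhat_io. Qed.

Lemma Qm_rec j w x : dn j w -> Qm x w = Qstep (N j) (Qm^~ (N j w)) x.
Proof.
move=> dj; case: hQ => _ _ /(_ _ _ (io_iota x) (io_iota w) _ (sg_DR dj)).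
rewrite !twist_io => -[h1 h2 h3]; rewrite /Qstep /Qm.
case: (NP j x) => [_ c|_ c _|E].
- by rewrite (h1 (cov_io c)) (cov_rk c) ltnSn.
- by rewrite (h2 (cov_io c)) (cov_rk c) ltnSn ltnNge leqnSn.
- by rewrite E ltnn h3 // E.
Qed.

Lemma Qm_spm M w x : spm M w -> le x w -> Qm x w = Qstep M (Qm^~ (M w)) x.
Proof.
have [k] := ubnP (rk w); elim: k w M x => // k IH w M x wk sM xw.
have ww := le_refl w.
case: (spm_descent sM) => [[j [dj E]]|[j [dj ne E]]].
  by rewrite (Qm_rec _ dj); apply: eq_Qstep; rewrite ?E.
have cj := dn_cov dj; have sN := N_spm dj; have Nw := cov_le cj.
have cM := spm_coatom sM cj ne; have sM' := spm_res sM Nw cM.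
have dM : dn j (M w).
  apply: cov_dn; apply: (spm_coatom sN (spm_top sM)); exact: nesym.
have bN := cov_le cM.
(* The induction covers [y] below [N j w]. For other [y], neither [y] nor [M y] is below
   [M (N j w)], and both sides vanish. *)
have R y : le y w -> Qm y (N j w) = Qstep M (Qm^~ (N j (M w))) y.
  move=> yw; rewrite -E //; case: (boolP (le y (N j w))) => yN.
    by apply: IH => //; move: (cov_rk cj) wk; clear; lia.
  have ny z : le z (M (N j w)) -> le z (N j w) by move=> h; apply: le_trans h bN.
  rewrite Qm_out //; have -> : forall f, f y = 0 -> f (M y) = 0 -> Qstep M f y = 0.
  - by move=> f h1 h2; rewrite /Qstep h1 h2 !mulr0 addr0 !if_same.
  - by [].
  - by apply: Qm_out; apply: contra yN => /ny.
  apply: Qm_out; apply: contra yN => /ny h.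
  by have := spm_le sM' h; rewrite (spmK sM yw).
have -> : Qm x w = Qstep (N j) (Qstep M (Qm^~ (N j (M w)))) x.
  by rewrite (Qm_rec _ dj); apply: eq_Qstep => //; apply: R => //; exact: (spm_le sN xw).
rewrite (Qstep_commute _ sM sN xw (E x xw)).
by apply: eq_Qstep => //; rewrite -Qm_rec.
Qed.

End Transport.

(** * Isomorphisms of lower intervals *)

Section Isomorphism.
Variable n : nat.
Local Notation m := (2 * n).
Local Notation T := (matching n).
Local Notation e := (e n).
Implicit Types (u v w x y z : T) (g h M : T -> T).

(** With the inverse as explicit data the notion is symmetric; values outside the intervals are
    arbitrary. *)
Definition iso g h w w' := [/\ forall x, le x w -> le (g x) w' /\ h (g x) = x,
  forall y, le y w' -> le (h y) w /\ g (h y) = y,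
  forall x y, le y w -> le x y -> le (g x) (g y) &
  forall x y, le y w' -> le x y -> le (h x) (h y)].

Lemma iso_sym g h w w' : iso g h w w' -> iso h g w' w.
Proof. by case. Qed.

Section Iso.
Variables (g h : T -> T) (w w' : T).
Hypothesis gh : iso g h w w'.

Lemma iso_to x : le x w -> le (g x) w'. Proof. by case: gh => + _ _ _ => /[apply] -[]. Qed.
Lemma iso_from y : le y w' -> le (h y) w. Proof. by case: gh => _ + _ _ => /[apply] -[]. Qed.
Lemma isoK x : le x w -> h (g x) = x. Proof. by case: gh => + _ _ _ => /[apply] -[]. Qed.
Lemma isoVK y : le y w' -> g (h y) = y. Proof. by case: gh => _ + _ _ => /[apply] -[]. Qed.
Lemma iso_mono x y : le y w -> le x y -> le (g x) (g y).
Proof. by case: gh => _ _ + _; apply. Qed.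
Lemma iso_monoV x y : le y w' -> le x y -> le (h x) (h y).
Proof. by case: gh => _ _ _; apply. Qed.

Lemma iso_inj x y : le x w -> le y w -> g x = g y -> x = y.
Proof. by move=> xw yw E; rewrite -(isoK xw) E isoK. Qed.

Lemma iso_le x y : le x w -> le y w -> le (g x) (g y) = le x y.
Proof.
move=> xw yw; apply/idP/idP => [/(iso_monoV (iso_to yw))|]; last exact: iso_mono.
by rewrite !isoK.
Qed.

Lemma iso_lt x y : le y w -> lt x y -> lt (g x) (g y).
Proof.
move=> yw /andP[ne xy]; rewrite /lt iso_mono // andbT.
by apply: contra ne => /eqP/(iso_inj (le_trans xy yw) yw) ->.
Qed.

Lemma iso_cov x y : le y w -> cov x y -> cov (g x) (g y).
Proof.
move=> yw c; have [z cz zy] := atom_above (iso_lt yw (cov_lt c)).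
have zw' := le_trans zy (iso_to yw).
suff -> : y = h z by rewrite isoVK.
have hzy : le (h z) y by rewrite -(isoK yw); apply: iso_monoV zy; exact: iso_to.
have xh : le x (h z).
  by rewrite -(isoK (le_trans (cov_le c) yw)); apply: iso_monoV (cov_le cz).
apply/esym/(le_rk_eq hzy); rewrite (cov_rk c).
have [/eqP E|//] := orP (le_eqVlt xh).
by case: (cov_neq cz); rewrite E isoVK.
Qed.

Lemma iso_e : g e = e.
Proof.
apply: le_anti (e_min _); rewrite -[X in le _ X](isoVK (e_min w')).
by apply: iso_mono (e_min _); apply/iso_from/e_min.
Qed.

Lemma iso_w : g w = w'.
Proof.
apply: le_anti; first exact/iso_to/le_refl.
by rewrite -{1}(isoVK (le_refl w')); apply: iso_mono (le_refl w) (iso_from (le_refl w')).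
Qed.

Lemma iso_rk x : le x w -> rk (g x) = rk x.
Proof.
have [k] := ubnP (rk x); elim: k x => // k IH x xk xw.
case: (eqVneq x e) => [->|/eqP/e_coatom[z c]]; first by rewrite iso_e.
rewrite (cov_rk (iso_cov xw c)) (cov_rk c) IH //; last exact: le_trans (cov_le c) xw.
by move: (cov_rk c) xk; clear; lia.
Qed.

Lemma iso_res v : le v w -> iso g h v (g v).
Proof.
move=> vw; have gw := iso_to vw; split.
- by move=> x xv; rewrite iso_mono ?isoK //; apply: le_trans xv vw.
- move=> y yv; rewrite isoVK; last exact: le_trans yv gw.
  by split=> //; rewrite -{1}(isoK vw); apply: iso_monoV.
- by move=> x y yv; apply: iso_mono; apply: le_trans yv vw.
- by move=> x y yv; apply: iso_monoV; apply: le_trans yv gw.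
Qed.

End Iso.

Lemma iso_spm g h w w' M : iso g h w w' -> spm M w' -> spm (fun x => h (M (g x))) w.
Proof.
move=> gh sM; have hg := iso_sym gh; have gw := iso_w gh; have hw := iso_w hg.
have to x : le x w -> le (g x) w' := iso_to gh (x:=x).
have Mto x : le x w -> le (M (g x)) w' by move=> xw; exact: (spm_le sM (to _ xw)).
split.
- move=> x xw; split; first exact: (iso_to hg (Mto x xw)).
  by rewrite (isoVK gh (Mto x xw)) (spmK sM (to x xw)) (isoK gh xw).
- by rewrite gw -[X in cov _ X]hw; apply: (iso_cov hg (le_refl w')) (spm_top sM).
- move=> x xw; case: (spm_case sM (to x xw)) => c.
  + by constructor 1; rewrite -[X in cov _ X](isoK gh xw); apply: (iso_cov hg (to x xw)).
  + by constructor 2; rewrite c (isoK gh xw).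
  + by constructor 3; rewrite -[X in cov X _](isoK gh xw); apply: (iso_cov hg (Mto x xw)).
- move=> x y yw c ne; have xw := le_trans (cov_le c) yw.
  apply: (iso_lt hg (Mto y yw)); apply: (spm_cov sM (to y yw) (iso_cov gh yw c)).
  by move=> E; apply: ne; rewrite E (isoK gh yw).
Qed.

Variable Q : 'S_m -> 'S_m -> {poly int}.
Hypothesis hQ : is_Qfamily Q.

Lemma Qm_iso g h w w' x : iso g h w w' -> le x w -> Qm Q x w = Qm Q (g x) w'.
Proof.
have [k] := ubnP (rk w); elim: k w w' x => // k IH w w' x wk gh xw.
have hg := iso_sym gh; have ww := le_refl w; have gw := iso_w gh.
case: (eqVneq w' e) => [we'|/eqP/exists_dn[j dj]].
  have we : w = e by apply: rk0; rewrite -(iso_rk gh ww) gw we' rk_e.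
  have xe : x = e by apply: le_anti (e_min _); rewrite -we.
  by rewrite we we' xe (iso_e gh) !(Qm_refl hQ).
pose M x := h (N j (g x)); have sN := N_spm dj; have sM : spm M w := iso_spm gh sN.
rewrite (Qm_spm hQ sM xw) (Qm_rec hQ _ dj).
have Nw := cov_le (dn_cov dj).
have MwE : M w = h (N j w') by rewrite /M gw.
have gMw : g (M w) = N j w' by rewrite MwE (isoVK gh).
have Mw := spm_le sM ww.
have R y : le y w -> Qm Q y (M w) = Qm Q (g y) (N j w').
  move=> yw; case: (boolP (le y (M w))) => yM.
    rewrite -gMw; apply: IH (iso_res gh Mw) yM.
    by move: (cov_rk (spm_top sM)) wk; clear; lia.
  by rewrite !(Qm_out hQ) // -gMw (iso_le gh).
have gM : g (M x) = N j (g x).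
  by rewrite /M (isoVK gh) //; apply: (spm_le sN (iso_to gh xw)).
by rewrite /Qstep !R ?(spm_le sM) // gM -(iso_rk gh xw) -(iso_rk gh (spm_le sM xw)) gM.
Qed.

End Isomorphism.

(** * Invariance of the Kazhdan-Lusztig-Vogan polynomials *)

Section Vogan.
Variable n : nat.
Local Notation m := (2 * n).
Local Notation T := (matching n).
Local Notation e := (e n).
Implicit Types (u v w x y z : T) (g h M : T -> T) (p : {poly int}).
Local Open Scope ring_scope.

Lemma zq_X_neq0 : zq_frac 'X != 0.
Proof. by rewrite /zq_frac tofrac_eq0 polyX_eq0. Qed.

Lemma eval_qinvB p p' : eval_qinv (p - p') = eval_qinv p - eval_qinv p'.
Proof. by rewrite /eval_qinv rmorphB hornerD hornerN. Qed.

Lemma eval_qinv_clear p (d : nat) : (size p <= d.+1)%N ->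
  exists p', zq_frac 'X ^+ d * eval_qinv p = zq_frac p'.
Proof.
move=> sp; exists (\sum_(i < d.+1) (p`_i)%:~R * 'X ^+ (d - i)).
rewrite /eval_qinv (@horner_coef_wide _ d.+1); last exact: leq_trans (size_poly _ _) sp.
rewrite mulr_sumr /zq_frac rmorph_sum; apply: eq_bigr => i _ /=.
rewrite coef_map_id0 // rmorphM rmorphXn rmorph_int mulrCA; congr (_ * _).
have id : (i <= d)%N by rewrite -ltnS.
by rewrite -{1}(subnK id) exprD exprVn mulfK // expf_neq0 // zq_X_neq0.
Qed.

(** With [d] the degree of [p], the left side is divisible by ['X ^+ (r - d)], and [r - d > d]. *)
Lemma reciprocal0 p (r : nat) : (0 < r)%N -> (2 * (size p).-1 <= r.-1)%N ->
  zq_frac 'X ^+ r * eval_qinv p = zq_frac p -> p = 0.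
Proof.
move=> r0 sp; set d := (size p).-1 in sp.
have [|p' E] := @eval_qinv_clear p d; first exact: leqSpred.
have -> : r = ((r - d) + d)%N by move: sp r0; clear; lia.
rewrite exprD -mulrA E /zq_frac -rmorphXn -rmorphM => /eqP; rewrite tofrac_eq => /eqP E'.
apply/eqP; apply: contraT => pn0.
have p0' : p' != 0 by apply: contra pn0 => /eqP p'0; rewrite -E' p'0 mulr0.
have := congr1 (size \o polyseq) E'; rewrite /= mulrC size_mulXn //.
have := p0'; rewrite -size_poly_gt0 => s1; have := pn0; rewrite -size_poly_gt0 => s2.
by move: sp r0 s1 s2; rewrite /d; move: (size p') (size p) => a b; clear; lia.
Qed.

Variables Q PI : 'S_m -> 'S_m -> {poly int}.
Hypotheses (hQ : is_Qfamily Q) (hP : is_KLVfamily Q PI).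

Definition Pm x w := PI (io x) (io w).

Lemma Pm_fun x w : le x w -> zq_frac 'X ^+ rk w * eval_qinv (Pm x w) =
  zq_frac 'X ^+ rk x * zq_frac (\sum_(y | le x y && le y w) Pm y w * Qm Q x y).
Proof.
move=> xw; case: hP => _ _ _ /(_ _ _ (io_iota x) (io_iota w)).
rewrite bruhat_io !rho_io => /(_ xw) ->; congr (_ * zq_frac _).
have -> : iota_itv (io x) (io w) = @io n @: [set y | le x y && le y w].
  apply/setP=> t; apply/idP/imsetP => [|[y + ->]].
    by rewrite inE => /andP[/iotaP[y ->]]; rewrite !bruhat_io => h; exists y; rewrite ?inE.
  by rewrite !inE io_iota !bruhat_io.
rewrite big_imset /=; last by move=> ? ? _ _; apply: io_inj.
by apply: eq_bigl => y; rewrite inE.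
Qed.

(** By induction the terms with [y] above [x] agree in the two defining sums. The difference [D] of
    the polynomials at [x] is therefore self-reciprocal, and [reciprocal0] makes it vanish. *)
Lemma Pm_iso g h w w' x : iso g h w w' -> le x w -> Pm x w = Pm (g x) w'.
Proof.
move=> gh; have [k] := ubnP (rk w - rk x); elim: k x => // k IH x xk xw.
have gw := iso_w gh; have hg := iso_sym gh.
case: hP => _ P1 Pd _.
case: (eqVneq x w) => [->|ne]; first by rewrite gw /Pm !P1 ?io_iota.
have ltxw : lt x w by rewrite /lt ne.
have lrk := lt_rk ltxw.
have ltg := iso_lt gh (le_refl w) ltxw; rewrite gw in ltg.
have rx := iso_rk gh xw; have rw := iso_rk gh (le_refl w); rewrite gw in rw.
have := Pd _ _ (io_iota x) (io_iota w).
rewrite /bruhat_lt bruhat_io (inj_eq (@io_inj n)) !rho_io => /(_ ltxw) d1.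
have := Pd _ _ (io_iota (g x)) (io_iota w').
rewrite /bruhat_lt bruhat_io (inj_eq (@io_inj n)) !rho_io => /(_ ltg) d2.
rewrite -/(Pm _ _) in d1; rewrite -/(Pm _ _) rx rw in d2.
have S : \sum_(y | le (g x) y && le y w') Pm y w' * Qm Q (g x) y =
  \sum_(y | le x y && le y w) Pm (g y) w' * Qm Q x y.
  rewrite (reindex_onto g h) => [|y /andP[_ yw]]; last exact: (isoVK gh).
  apply: eq_big => [y|y /andP[/andP[_ yw] /eqP E]].
    (* [g] is arbitrary off the interval, but [h (g y) = y] with [g y] below [w'] puts [y] below
       [w]. *)
    case: (boolP (le y w)) => yw; last first.
      rewrite andbF; apply/negP => /andP[/andP[_ yw'] /eqP E].
      by rewrite -E (iso_to hg yw') in yw.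
    by rewrite (isoK gh yw) eqxx (iso_to gh yw) (iso_le gh xw yw) !andbT.
  have yw' : le y w by rewrite -E (iso_to hg yw).
  case: (boolP (le x y)) => xy; first by rewrite (Qm_iso hQ (iso_res gh yw') xy).
  by rewrite !(Qm_out hQ) // (iso_le gh).
have e1 := Pm_fun xw; have e2 := Pm_fun (lt_le ltg); rewrite S rx rw in e2.
pose D := Pm x w - Pm (g x) w'.
suff : D = 0 by move/subr0_eq.
apply: (@reciprocal0 _ (rk w - rk x)%N); first by rewrite subn_gt0.
  rewrite -subn1; have := size_polyD (Pm x w) (- Pm (g x) w'); rewrite size_polyN -/D.
  move: d1 d2; move: (size D) (size (Pm x w)) (size (Pm (g x) w')) => a b c.
  by move: lrk; clear; lia.
apply: (mulfI (expf_neq0 (rk x) zq_X_neq0)).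
rewrite mulrA -exprD subnKC; last exact: ltnW.
rewrite eval_qinvB mulrBr e1 e2 -mulrBr; congr (_ * _).
rewrite /zq_frac -rmorphB; congr (FracField.tofrac _).
rewrite -sumrB (bigD1 x) ?xw ?le_refl //= -mulrBl (Qm_refl hQ) mulr1 big1 ?addr0 //.
move=> y /andP[/andP[xy yw] ne'].
have l : lt x y by rewrite /lt eq_sym ne'.
by rewrite -IH ?subrr //; move: (lt_rk l) (le_rk yw) xk; clear; lia.
Qed.

End Vogan.

Theorem theorem1p2 (n : nat) (hn : (1 <= n)%N)
  (Q PI : 'S_(2 * n) -> 'S_(2 * n) -> {poly int})
  (hQ : is_Qfamily Q) (hP : is_KLVfamily Q PI)
  (u u' : 'S_(2 * n)) (hu : u \in fpf (2 * n)) (hu' : u' \in fpf (2 * n))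
  (f : 'S_(2 * n) -> 'S_(2 * n))
  (hf : bruhat_iso (fpf_itv u (w0 (2 * n))) (fpf_itv u' (w0 (2 * n))) f) :
  forall v : 'S_(2 * n), v \in fpf (2 * n) -> bruhat u v ->
    KLV_fpf PI v u = KLV_fpf PI (f v) u'.
Proof.
move=> v0 hv uv0; case: hf => inj im mono.
pose U : matching n := exist _ u hu; pose U' : matching n := exist _ u' hu'.
(* As [le] reverses the Bruhat order, upper intervals of Br(F) become lower intervals of [le]. *)
have itv (x w : matching n) : (val x \in fpf_itv (val w) (w0 (2 * n))) = le x w.
  by rewrite inE (valP x) -[bruhat _ (w0 _)]/(le (e n) x) e_min andbT.
have fU (x : matching n) : le x U -> f (val x) \in fpf_itv u' (w0 (2 * n)).
  by move=> xU; rewrite -im; apply: imset_f; rewrite (itv x U).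
(* The default [e n], here and in [h], only concerns arguments outside the intervals. *)
pose g (x : matching n) : matching n := insubd (e n) (f (val x)).
have gE x : le x U -> val (g x) = f (val x).
  by move=> /fU; rewrite inE => /andP[h _]; rewrite /g val_insubd h.
pose h (y : matching n) := odflt (e n) [pick x : matching n | le x U && (g x == y)].
have gU x : le x U -> le (g x) U'.
  by move=> xU; rewrite -itv gE // fU.
have ginj x y : le x U -> le y U -> g x = g y -> x = y.
  move=> xU yU E; apply: val_inj; apply: inj; rewrite ?(itv _ U) //.
  by rewrite -!gE // E.
have hK y : le y U' -> le (h y) U /\ g (h y) = y.
  move=> yU; rewrite /h; case: pickP => [x /andP[xU /eqP] //|no].
  have := yU; rewrite -itv -im => /imsetP[t tU E].
  have tf : t \in fpf (2 * n) by move: tU; rewrite inE => /andP[].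
  have tU' : le (exist _ t tf : matching n) U by rewrite -itv.
  have /idP[] := no (exist _ t tf); rewrite tU' /=; apply/eqP/val_inj.
  by rewrite gE.
have gle x y : le x U -> le y U -> le (g x) (g y) = le x y.
  by move=> xU yU; rewrite /le !gE // mono // (itv _ U).
have gh : iso g h U U'.
  split=> [x xU|y /hK //|x y yU xy|x y yU xy].
  - have [h1 h2] := hK _ (gU x xU).
    by split; [exact: gU|exact: ginj].
  - by rewrite gle //; apply: le_trans xy yU.
  - have [h1 h2] := hK _ yU; have [h3 h4] := hK _ (le_trans xy yU).
    by rewrite -gle // h2 h4.
pose V : matching n := exist _ v0 hv.
have VU : le V U by [].
by have := Pm_iso hQ hP gh VU; rewrite /Pm /io gE.
Qed.
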